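(* Consider a linear elastic body with displacement field $\mathbf{u}(\mathtt{X},t)=\lambda_1(\mathtt{x}^c)\,\mathbf{r}(\mathtt{x},t)$, strain $\varepsilon(\mathtt{X},t)=\lambda_2(\mathtt{x}^c)\,\mathcal{F}\,\mathbf{r}(\mathtt{x},t)$, constitutive law $\sigma=C\varepsilon$, kinetic energy $T$, elastic potential energy $U$ and external work $W_E$ as described in the context, and suppose that its evolution $\mathbf{r}(\mathtt{x},t)$ satisfies Hamilton's principle (see context). Let $$p=\mathcal{M}\dot{\mathbf{r}}\in\mathbb{R}^n,\qquad \epsilon=\mathcal{F}\mathbf{r}\in\mathbb{R}^m,\qquad \mathcal{M}(\mathtt{x})=\rho(\mathtt{x})\int_{\Omega^c}\lambda_1^\top\lambda_1\,d\mathtt{x}^c,\qquad \mathcal{K}(\mathtt{x})=\int_{\Omega^c}\lambda_2^\top C\lambda_2\,d\mathtt{x}^c,$$ and take as state variable $x(\mathtt{x},t)=[p(\mathtt{x},t)^\top\ \epsilon(\mathtt{x},t)^\top]^\top\in\mathbb{R}^{n+m}$. Define the Hamiltonian $$H[p,\epsilon]=T[p]+U[\epsilon]=\frac12\int_\Omega \left(p(\mathtt{x},t)^\top\mathcal{M}(\mathtt{x})^{-1}p(\mathtt{x},t)+\epsilon(\mathtt{x},t)^\top\mathcal{K}(\mathtt{x})\epsilon(\mathtt{x},t)\right)d\mathtt{x}.$$ Then the dynamics of the system defines an infinite-dimensional port-Hamiltonian system of the form $$\begin{bmatrix} f_p\\ f_\epsilon\end{bmatrix}=\begin{bmatrix}0&-\mathcal{F}^*\\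 \mathcal{F}&0\end{bmatrix}\begin{bmatrix}e_p\\ e_\epsilon\end{bmatrix}+\begin{bmatrix}B_d\\0\end{bmatrix}u_d,\qquad y_d=B_d^*(e_p),$$ where $\mathcal{J}=\begin{bmatrix}0&-\mathcal{F}^*\\ \mathcal{F}&0\end{bmatrix}=-\mathcal{J}^*$ (formally skew-adjoint), $f_p=\dot p=\mathcal{M}\ddot{\mathbf{r}}$, $f_\epsilon=\dot\epsilon=\mathcal{F}\dot{\mathbf{r}}$, $e_p=\delta_pH=\mathcal{M}^{-1}p=\dot{\mathbf{r}}$, $e_\epsilon=\delta_\epsilon H=\mathcal{K}\epsilon=\mathcal{K}\mathcal{F}\mathbf{r}$ ($\delta_p H,\delta_\epsilon H$ denoting the variational derivatives of $H$), and the power exchanged with the environment is given by $$\partial_tH=\int_\Omega y_d(\mathtt{x},t)^\top u_d(\mathtt{x},t)\,d\mathtt{x}+\int_{\partial\Omega}\mathcal{B}(e_p(\mathtt{s},t))^\top\mathcal{Q}_\partial(\mathtt{s})\,\mathcal{B}(e_\epsilon(\mathtt{s},t))\,d\mathtt{s},$$ or equivalently by $$\partial_tH=\int_\Omega y_d(\mathtt{x},t)^\top u_d(\mathtt{x},t)\,d\mathtt{x}+\sum_{k=1}^{\ell}\sum_{i=1}^{N}\sum_{j=1}^{i}(-1)^{j-1}\int_{\partial\Omega}\partial_k^{i-j}e_p(\mathtt{s},t)^\top P_k(i)^\top\hat n_k(\mathtt{s})\,\partial_k^{j-1}e_\epsilon(\mathtt{s},t)\,d\mathtt{s},$$ where $\hat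 n_k$ is the component along the coordinate axis $\zeta_k$ of the outward unit normal vector to $\partial\Omega$.
   Context: **Coordinates and domains.** $\mathtt{X}=\{\zeta_1,\zeta_2,\zeta_3\}$ are Cartesian coordinates of $\mathbb{R}^3$, split disjointly as $\mathtt{X}=\mathtt{x}\cup\mathtt{x}^c$. The body is $\Omega_T=\Omega\times\Omega^c\subset\mathbb{R}^3$, with $\mathtt{x}=(\zeta_1,\dots,\zeta_\ell)\in\Omega\subset\mathbb{R}^\ell$ ($\ell\in\{1,2,3\}$) and $\mathtt{x}^c\in\Omega^c$; if $\ell=3$, $\mathtt{x}^c$ is empty and integration over $\Omega^c$ is the identity. $\Omega$ is open with boundary $\partial\Omega=\partial\Omega_u\cup\partial\Omega_\sigma$ (complementary parts on which essential, respectively natural, boundary conditions are imposed). $\mathtt{s}$ denotes a point of $\partial\Omega$, with $\mathtt{s}_u\in\partial\Omega_u$ and $\mathtt{s}_\sigma\in\partial\Omega_\sigma$; for $\ell=1$ a boundary integral is the sum over the end points. A dot, or $\partial_t$, is the time derivative; $\partial_k^i=\partial^i/\partial\zeta_k^i$. All fields are sufficiently smooth on $\overline\Omega$ and in $t$, and $\Omega$ is bounded and regular enough for the divergence theorem. **Kinematics and constitutive law.** $\lambda_1(\mathtt{x}^c)\in\mathbb{R}^{3\times n}$ has no zero columns; $\mathbf{r}(\mathtt{x},t)\in\mathbb{R}^n$ is the vector of generalized displacements; $\rho(\mathtt{x})$ is the mass density. $\varepsilon(\mathtt{X},t)\in\mathbb{R}^d$ collects the nonzero components of the Voigt strain vector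 $(\varepsilon_{11},\varepsilon_{22},\varepsilon_{33},2\varepsilon_{12},2\varepsilon_{13},2\varepsilon_{23})$ of the linearized strain tensor $\frac12(\nabla\mathbf{u}+(\nabla\mathbf{u})^\top)$, and $\sigma=C\varepsilon$ collects the corresponding stress components, with $C=C^\top>0$ in $\mathbb{R}^{d\times d}$. It is assumed that $\varepsilon=\lambda_2(\mathtt{x}^c)\mathcal{F}\mathbf{r}$ with $\lambda_2(\mathtt{x}^c)\in\mathbb{R}^{d\times m}$ and $\mathcal{F}$ an $m\times n$ operator of the class below, both without zero rows or columns. It is required that $\mathcal{M}(\mathtt{x})=\mathcal{M}(\mathtt{x})^\top>0$ and (by the choice of $m$) $\mathcal{K}(\mathtt{x})=\mathcal{K}(\mathtt{x})^\top>0$. **Differential operators.** $\mathcal{F}w=P_0w+\sum_{k=1}^\ell\sum_{i=1}^NP_k(i)\,\partial_k^iw$ with constant matrices $P_0,P_k(i)\in\mathbb{R}^{m\times n}$, where $N$ is the order of the highest derivative with respect to any $\zeta_k$; its formal adjoint is $\mathcal{F}^*v=P_0^\top v+\sum_{k=1}^\ell\sum_{i=1}^N(-1)^iP_k(i)^\top\partial_k^iv$. The operator $\mathcal{B}$ is $$\mathcal{B}(\cdot)=\begin{bmatrix}(\cdot)&\partial_1(\cdot)\cdots\partial_\ell(\cdot)&\partial_1^2(\cdot)\cdots\partial_\ell^2(\cdot)&\cdots&\partial_1^{N-1}(\cdot)\cdots\partial_\ell^{N-1}(\cdot)\end{bmatrix}^\top$$ (all these vectors stacked into one column). $\mathcal{Q}_\partial(\mathtt{s})$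 is the $(n+(N-1)n\ell)\times(m+(N-1)m\ell)$ block matrix with block rows and columns indexed by $a,b\in\{0,\dots,N-1\}$ whose $(a,b)$ block is: $P_\partial=\sum_{k=1}^\ell P_k(1)^\top\hat n_k$ for $a=b=0$; $(-1)^bW_{b+1}$ for $a=0$, $b\ge1$; $V_{a+1}$ for $a\ge1$, $b=0$; $(-1)^b\Lambda_{a+b+1}$ for $a,b\ge1$ and $a+b+1\le N$; and $0$ otherwise. Here $W_i=[P_1(i)^\top\hat n_1\ \cdots\ P_\ell(i)^\top\hat n_\ell]$ is a block row, $V_i$ is the block column with the same blocks stacked, $\Lambda_i$ is the block diagonal matrix with the same blocks, and $\hat n_k=\hat n_k(\mathtt{s})$. **Energies and external work.** $T=\frac12\int_{\Omega_T}\rho\,\dot{\mathbf{u}}\cdot\dot{\mathbf{u}}\,d\mathtt{X}$, $U=\frac12\int_{\Omega_T}\sigma\cdot\varepsilon\,d\mathtt{X}$, and $$W_E=-\left(\int_\Omega B_d(u_d(\mathtt{x},t))\cdot\mathbf{r}(\mathtt{x},t)\,d\mathtt{x}+\int_{\partial\Omega_\sigma}\tau_\partial(\mathtt{s}_\sigma,t)\cdot\mathcal{B}(\mathbf{r}(\mathtt{s}_\sigma,t))\,d\mathtt{s}_\sigma\right),$$ where $u_d$ is the distributed external input, $B_d(u_d)\in\mathbb{R}^n$ are the generalized loads with $B_d$ a linear mapping operator, and $\tau_\partial$ are the generalized boundary tractions. $B_d^*$ is the formal adjoint of $B_d$: $\int_\Omega e^\top B_d(u_d)\,d\mathtt{x}=\int_\Omega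 u_d^\top B_d^*(e)\,d\mathtt{x}$ for distributed inputs $u_d$ (which vanish on $\partial\Omega$). **Hamilton's principle.** For all times $t_1<t_2$, $\int_{t_1}^{t_2}(\delta U+\delta W_E-\delta T)\,dt=0$ for all admissible variations $\delta\mathbf{r}$ (equivalently $\delta\mathbf{u}=\lambda_1\delta\mathbf{r}$), i.e. smooth $\mathbb{R}^n$-valued variations that vanish at $t=t_1$ and $t=t_2$ and are consistent with the essential boundary conditions (vanish on $\partial\Omega_u$). The external data $u_d$, $\tau_\partial$ are not varied. *)

(* Defs.v *)
From HB Require Import structures.
From mathcomp Require Import all_boot all_order all_algebra.
From mathcomp Require Import all_classical all_reals all_analysis.
Set Implicit Arguments.
Unset Strict Implicit.
Unset Printing Implicit Defensive.
Import Order.TTheory GRing.Theory Num.Theory.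
Import numFieldNormedType.Exports.
Local Open Scope classical_set_scope.
Local Open Scope ring_scope.

(* The sigma-algebra on R^n is the one generated by the coordinates, i.e. the
   Borel one; leb n is the n-fold product of the Lebesgue measure of R. On R^0,
   which has one point, it has mass 1, so that integrating over R^0 evaluates. *)
Definition rV_display : measure_display. Proof. exact. Qed.

Section measurable_rV.
Context {R : realType} (n : nat).

Let coord (i : 'I_n) (v : 'rV[R]_n) : measurableTypeR R := v 0 i.

Let rV_set0 : g_sigma_preimage coord set0.
Proof. exact: sigma_algebra0. Qed.

Let rV_setC A : g_sigma_preimage coord A -> g_sigma_preimage coord (~` A).
Proof. exact: sigma_algebraC. Qed.

Let rV_bigcup (F : (set 'rV[R]_n)^nat) :
  (forall i, g_sigma_preimage coord (F i)) ->
  g_sigma_preimage coord (\bigcup_i (F i)).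
Proof. exact: sigma_algebra_bigcup. Qed.

HB.instance Definition _ := @isMeasurable.Build rV_display
  'rV[R]_n (g_sigma_preimage coord) rV_set0 rV_setC rV_bigcup.

End measurable_rV.

Lemma measurable_coord {R : realType} n (i : 'I_n) :
  measurable_fun setT (fun v : 'rV[R]_n => v 0 i : measurableTypeR R).
Proof.
case: n i => [[]//|n] i _ Y mY; rewrite setTI; apply: sub_sigma_algebra.
rewrite -bigcup_mkord_ord; exists i; first exact: (ltn_ord i).
by exists Y => //; rewrite setTI inord_val.
Qed.

Lemma measurable_fun_rV {R : realType} n d (T : measurableType d)
    (f : T -> 'rV[R]_n) :
  (forall i, measurable_fun setT (fun x => f x 0 i : measurableTypeR R)) ->
  measurable_fun setT f.
Proof.
move=> mf; apply: (@measurability _ _ _ _ setT f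
  (\big[setU/set0]_(i < n) preimage_set_system setT
     (fun v : 'rV[R]_n => v 0 i : measurableTypeR R) measurable)) => //.
move=> _ [A + <-]; case: n f mf A => [|k] f mf A; first by rewrite big_ord0.
rewrite -bigcup_mkord_ord => -[i _ [B mB <-]].
by have := mf (inord i) measurableT _ mB; rewrite !setTI.
Qed.

Section lebesgue_step.
Context {R : realType} (n : nat).
Variable mu : {sigma_finite_measure set 'rV[R]_n -> \bar R}.

Definition cons_rV (z : measurableTypeR R * 'rV[R]_n) : 'rV[R]_n.+1 :=
  \row_(i < n.+1) oapp (fun j : 'I_n => z.2 0 j) z.1 (unlift ord0 i).

Lemma measurable_cons_rV : measurable_fun setT cons_rV.
Proof.
apply: measurable_fun_rV => i; rewrite /cons_rV.
case: (unliftP ord0 i) => [j ->|->].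
- rewrite (_ : (fun _ => _) =
      (fun v : 'rV[R]_n => v 0 j : measurableTypeR R) \o snd).
    by apply: measurableT_comp => //; exact: measurable_coord.
  by apply/funext => z /=; rewrite mxE liftK.
- rewrite (_ : (fun _ => _) = fst) //.
  by apply/funext => z /=; rewrite mxE unlift_none.
Qed.

Let prod_mu : {measure set (measurableTypeR R * 'rV[R]_n) -> \bar R} :=
  (@lebesgue_measure R \x mu)%E.

Definition lebesgue_step : set 'rV[R]_n.+1 -> \bar R :=
  pushforward prod_mu cons_rV.

Let mpre A : measurable A -> measurable (cons_rV @^-1` A).
Proof.
by move=> mA; rewrite -[X in measurable X]setTI; exact: measurable_cons_rV.
Qed.

Let step0 : lebesgue_step set0 = 0%E.
Proof. by rewrite /lebesgue_step /pushforward preimage_set0 measure0. Qed.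

Let step_ge0 A : (0 <= lebesgue_step A)%E.
Proof. exact: (measure_ge0 prod_mu). Qed.

Let step_sigma_additive : semi_sigma_additive lebesgue_step.
Proof.
move=> F mF tF mUF; rewrite /lebesgue_step /pushforward preimage_bigcup.
apply: measure_semi_sigma_additive.
- by move=> k; exact: mpre.
- apply/trivIsetP => /= i j _ _ ij; rewrite -preimage_setI.
  by move/trivIsetP : tF => /(_ _ _ _ _ ij) ->//; rewrite preimage_set0.
- by rewrite -preimage_bigcup; exact: mpre.
Qed.

HB.instance Definition _ := isMeasure.Build _ _ _ lebesgue_step
  step0 step_ge0 step_sigma_additive.

Let uncons (v : 'rV[R]_n.+1) : measurableTypeR R * 'rV[R]_n :=
  (v 0 ord0, \row_j v 0 (lift ord0 j)).

Let measurable_uncons : measurable_fun setT uncons.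
Proof.
apply: measurable_fun_pair; first exact: measurable_coord.
apply: measurable_fun_rV => j; under eq_fun do rewrite mxE.
exact: measurable_coord.
Qed.

Let cons_rVK : cancel cons_rV uncons.
Proof.
move=> [x v]; rewrite /uncons/cons_rV mxE unlift_none/=; congr pair.
by apply/rowP => j; rewrite !mxE liftK.
Qed.

Let step_sigma_finite : sigma_finite setT lebesgue_step.
Proof.
have /sigma_finiteP[F [TF ndF Foo]] := sigma_finiteT (@lebesgue_measure R).
have /sigma_finiteP[G [TG ndG Goo]] := sigma_finiteT mu.
exists (fun k => uncons @^-1` (F k `*` G k)).
  rewrite -preimage_bigcup -(preimage_setT uncons); congr (_ @^-1` _).
  rewrite -setXTT TF TG predeqE => -[x y]; split.
    move=> [/= [a _ Fax] [b _ Gby]]; exists (maxn a b) => //; split.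
    - by move: x Fax; exact/subsetPset/ndF/leq_maxl.
    - by move: y Gby; exact/subsetPset/ndG/leq_maxr.
  by move=> [a _ []/= ? ?]; split; exists a.
move=> k; have [mF Fk] := Foo k; have [mG Gk] := Goo k; split.
  rewrite -[X in measurable X]setTI; apply: measurable_uncons => //.
  exact: measurableX.
rewrite /lebesgue_step /pushforward -comp_preimage.
rewrite (_ : uncons \o cons_rV = id) ?preimage_id; last first.
  by apply/funext => z; exact: cons_rVK.
by rewrite /= product_measure1E// lte_mul_pinfty// ge0_fin_numE.
Qed.

HB.instance Definition _ := Measure_isSigmaFinite.Build _ _ _ lebesgue_step
  step_sigma_finite.

Definition lebesgue_stepM :
  {sigma_finite_measure set 'rV[R]_n.+1 -> \bar R} := lebesgue_step.
End lebesgue_step.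

Fixpoint leb {R : realType} n :
    {sigma_finite_measure set 'rV[R]_n -> \bar R} :=
  match n with
  | 0 => dirac (0 : 'rV[R]_0)
  | n'.+1 => lebesgue_stepM (leb n')
  end.

Section geometry.
Context {R : realType} (l : nat).
Implicit Types (A Om : set 'rV[R]_l) (x y s nu : 'rV[R]_l).

Definition boundary Om : set 'rV[R]_l := closure Om `\` Om°.

Definition dotr x y : R := \sum_(k < l) x 0 k * y 0 k.

(* The library norm of 'rV_l is the sup norm. *)
Definition enorm x : R := Num.sqrt (dotr x x).

(* Around s, the set Om agrees with the half-space opposite to nu outside every
   cone about the hyperplane orthogonal to nu; this determines nu. *)
Definition outward_unit_normal Om s nu : Prop :=
  enorm nu = 1 /\
  forall e : R, 0 < e -> \forall y \near s,
    (dotr (y - s) nu < - (e * enorm (y - s)) -> Om y) /\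
    (e * enorm (y - s) < dotr (y - s) nu -> ~ closure Om y).

Definition ediam A : \bar R :=
  ereal_sup [set (enorm (z.1 - z.2))%:E | z in A `*` A].

(* Volume of the h-dimensional ball of diameter 1, for h <= 2. *)
Definition ball_const (h : nat) : R :=
  match h with 0 => 1 | 1 => 1 | _ => pi / 4 end.

(* The empty set has diameter -oo and must not contribute. *)
Definition hausdorff_gauge (h : nat) A : \bar R :=
  if A == set0 then 0%E else ((ball_const h)%:E * ediam A ^+ h)%E.

Definition hausdorff_delta (h : nat) (e : R) A : \bar R :=
  ereal_inf [set (\sum_(0 <= i <oo) hausdorff_gauge h (U i))%E | U in
    [set U : (set 'rV[R]_l)^nat |
      A `<=` \bigcup_i U i /\ forall i, (ediam (U i) <= e%:E)%E]].

(* For h = 0 this is the counting measure, for h = 1, 2 length and area. *)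
Definition hausdorff (h : nat) A : \bar R :=
  ereal_sup [set hausdorff_delta h e A | e in [set e : R | 0 < e]].

End geometry.

Section smoothness.
Context {R : realType}.

(* Class C^q on the open set U; derivatives in all directions are used instead
   of the partial derivatives along a basis. *)
Fixpoint Cq (V : normedModType R) (q : nat) (U : set V) (g : V -> R) : Prop :=
  (forall x, U x -> {for x, continuous g}) /\
  match q with
  | 0 => True
  | q'.+1 => forall v : V,
      (forall x, U x -> derivable g x v) /\ Cq q' U (fun x => 'D_v g x)
  end.

Definition smooth_near (V : normedModType R) (q : nat) (A : set V)
    (g : V -> R) : Prop :=
  exists U : set V, [/\ open U, A `<=` U & Cq q U g].

(* Fields are total functions; only their values near A are constrained. *)
Definition field_Cq (V : normedModType R) (a b q : nat) (A : set V)
    (f : V -> 'M[R]_(a, b)) : Prop :=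
  forall i j, smooth_near q A (fun x => f x i j).

Definition field_Coo (V : normedModType R) (a b : nat) (A : set V)
    (f : V -> 'M[R]_(a, b)) : Prop :=
  forall i j, exists U : set V,
    [/\ open U, A `<=` U & forall q, Cq q U (fun x => f x i j)].

Definition spacetime (l : nat) (Om : set 'rV[R]_l) : set (R * 'rV[R]_l) :=
  setT `*` closure Om.

Definition uncurried (l : nat) (T : Type) (f : R -> 'rV[R]_l -> T) :
  R * 'rV[R]_l -> T := fun z => f z.1 z.2.

End smoothness.

Section differential_operators.
Context {R : realType}.

Definition dot a (v w : 'cV[R]_a) : R := (v^T *m w) 0 0.

Definition dtime (X : Type) a (f : R -> X -> 'cV[R]_a) : R -> X -> 'cV[R]_a :=
  fun t x => \col_i derive1 (fun s : R => f s x i 0) t.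

Definition dpart l a (k : 'I_l) (w : 'rV[R]_l -> 'cV[R]_a) :
  'rV[R]_l -> 'cV[R]_a :=
  fun x => \col_i 'D_(delta_mx 0 k) (fun y => w y i 0) x.

Definition dpartn l a (i : nat) (k : 'I_l) (w : 'rV[R]_l -> 'cV[R]_a) :=
  iter i (dpart k) w.

(* Only the coefficients P k i with 1 <= i <= N matter. *)
Definition diffop l m n (N : nat) (P0 : 'M[R]_(m, n))
    (P : 'I_l -> nat -> 'M[R]_(m, n)) (w : 'rV[R]_l -> 'cV[R]_n) :
  'rV[R]_l -> 'cV[R]_m :=
  fun x => P0 *m w x +
    \sum_(k < l) \sum_(1 <= i < N.+1) P k i *m dpartn i k w x.

Definition diffop_adj l m n (N : nat) (P0 : 'M[R]_(m, n))
    (P : 'I_l -> nat -> 'M[R]_(m, n)) (v : 'rV[R]_l -> 'cV[R]_m) :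
  'rV[R]_l -> 'cV[R]_n :=
  fun x => P0^T *m v x +
    \sum_(k < l) \sum_(1 <= i < N.+1)
      (-1) ^+ i *: ((P k i)^T *m dpartn i k v x).

(* The operator matrix [0, -Fs; F, 0]. *)
Definition interconnection l m n
    (F : ('rV[R]_l -> 'cV[R]_n) -> 'rV[R]_l -> 'cV[R]_m)
    (Fs : ('rV[R]_l -> 'cV[R]_m) -> 'rV[R]_l -> 'cV[R]_n)
    (z : 'rV[R]_l -> 'cV[R]_(n + m)) : 'rV[R]_l -> 'cV[R]_(n + m) :=
  fun x => col_mx (- Fs (fun y => dsubmx (z y)) x) (F (fun y => usubmx (z y)) x).

Definition test_field l a (Om : set 'rV[R]_l) (w : 'rV[R]_l -> 'cV[R]_a) :=
  field_Coo setT w /\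
  exists A, [/\ compact A, A `<=` Om & forall x, ~ A x -> w x = 0].

Definition formal_adjoint l a b (Om : set 'rV[R]_l)
    (A : ('rV[R]_l -> 'cV[R]_a) -> 'rV[R]_l -> 'cV[R]_b)
    (As : ('rV[R]_l -> 'cV[R]_b) -> 'rV[R]_l -> 'cV[R]_a) : Prop :=
  forall v w, test_field Om v -> test_field Om w ->
    \int[leb l]_(x in Om) dot (v x) (A w x) =
    \int[leb l]_(x in Om) dot (As v x) (w x).

(* Block 0 of the stacked vector has n rows, block a >= 1 has l times n. *)
Definition blockdim (l n a : nat) : nat :=
  if a is 0 then n else (\sum_(k < l) n)%N.

Definition jet_block l n (w : 'rV[R]_l -> 'cV[R]_n) (x : 'rV[R]_l) (a : nat) :
  'cV[R]_(blockdim l n a) :=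
  match a return 'cV[R]_(blockdim l n a) with
  | 0 => w x
  | a'.+1 => \mxcol_(k < l) dpartn a'.+1 k w x
  end.

Definition jet l n (N : nat) (w : 'rV[R]_l -> 'cV[R]_n) (x : 'rV[R]_l) :
  'cV[R]_(\sum_(a < N) blockdim l n a) :=
  \mxcol_(a < N) jet_block w x a.

Section boundary_matrix.
Variables (l m n N : nat) (P : 'I_l -> nat -> 'M[R]_(m, n)) (nu : 'rV[R]_l).

Definition bterm (k : 'I_l) (i : nat) : 'M[R]_(n, m) := nu 0 k *: (P k i)^T.

Definition Wrow (i : nat) : 'M[R]_(n, \sum_(k < l) m) :=
  \mxrow_(k < l) bterm k i.

Definition Vcol (i : nat) : 'M[R]_(\sum_(k < l) n, m) :=
  \mxcol_(k < l) bterm k i.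

Definition Ldiag (i : nat) : 'M[R]_(\sum_(k < l) n, \sum_(k < l) m) :=
  \mxblock_(k < l, j < l) (if k == j then bterm k i else 0).

Definition Qblock (a b : nat) : 'M[R]_(blockdim l n a, blockdim l m b) :=
  match a, b return 'M[R]_(blockdim l n a, blockdim l m b) with
  | 0, 0 => \sum_(k < l) bterm k 1
  | 0, b'.+1 => (-1) ^+ b'.+1 *: Wrow b'.+2
  | a'.+1, 0 => Vcol a'.+2
  | a'.+1, b'.+1 =>
      if (a'.+1 + b'.+1 + 1 <= N)%N
      then (-1) ^+ b'.+1 *: Ldiag (a'.+1 + b'.+1 + 1) else 0
  end.

Definition Qbdry :
  'M[R]_(\sum_(a < N) blockdim l n a, \sum_(b < N) blockdim l m b) :=
  \mxblock_(a < N, b < N) Qblock a b.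

End boundary_matrix.
End differential_operators.

(* n generalized displacements, m generalized strains, d strain components;
   N is the order of the operator. C may vary over the body, and is a constant
   function for a homogeneous one. *)
Record elastic_body (R : realType) (l n m d N : nat) := ElasticBody {
  Om : set 'rV[R]_l ;
  Omc : set 'rV[R]_(3 - l) ;
  bdry_u : set 'rV[R]_l ;
  bdry_s : set 'rV[R]_l ;
  surf : {finite_measure set 'rV[R]_l -> \bar R} ;
  normal : 'rV[R]_l -> 'rV[R]_l ;
  rho : 'rV[R]_l -> R ;
  lam1 : 'rV[R]_(3 - l) -> 'M[R]_(3, n) ;
  lam2 : 'rV[R]_(3 - l) -> 'M[R]_(d, m) ;
  Cmat : 'rV[R]_l * 'rV[R]_(3 - l) -> 'M[R]_d ;
  P0 : 'M[R]_(m, n) ;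
  Pk : 'I_l -> nat -> 'M[R]_(m, n)
}.

Section body.
Context {R : realType} {l n m d N : nat}.
Variable b : elastic_body R l n m d N.
Local Notation point := ('rV[R]_l * 'rV[R]_(3 - l))%type.
Local Notation motion := (R -> 'rV[R]_l -> 'cV[R]_n).

Definition body_set : set point := Om b `*` Omc b.

Definition Fop := diffop N (P0 b) (Pk b).
Definition Fadj := diffop_adj N (P0 b) (Pk b).
Definition Jop := interconnection Fop Fadj.

Definition displacement (r : motion) : R -> point -> 'cV[R]_3 :=
  fun t X => lam1 b X.2 *m r t X.1.

Definition strain (r : motion) : R -> point -> 'cV[R]_d :=
  fun t X => lam2 b X.2 *m Fop (r t) X.1.

Definition stress (r : motion) : R -> point -> 'cV[R]_d :=
  fun t X => Cmat b X *m strain r t X.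

Definition volume : {measure set point -> \bar R} := (leb l \x leb (3 - l))%E.

Definition kinetic (r : motion) (t : R) : R :=
  2^-1 * \int[volume]_(X in body_set)
    (rho b X.1 * dot (dtime (displacement r) t X) (dtime (displacement r) t X)).

Definition elastic (r : motion) (t : R) : R :=
  2^-1 * \int[volume]_(X in body_set) dot (stress r t X) (strain r t X).

Definition work (load : motion)
    (tau : R -> 'rV[R]_l -> 'cV[R]_(\sum_(a < N) blockdim l n a))
    (r : motion) (t : R) : R :=
  - (\int[leb l]_(x in Om b) dot (load t x) (r t x) +
     \int[surf b]_(s in bdry_s b) dot (tau t s) (jet N (r t) s)).

Definition variation (G : motion -> R -> R) (r dr : motion) (t : R) : R :=
  derive1 (fun eta : R => G (fun s x => r s x + eta *: dr s x) t) 0.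

Definition hamilton_principle (load : motion)
    (tau : R -> 'rV[R]_l -> 'cV[R]_(\sum_(a < N) blockdim l n a))
    (r : motion) : Prop :=
  forall (t1 t2 : R) (dr : motion), t1 < t2 ->
    field_Coo (spacetime (Om b)) (uncurried dr) ->
    (forall x, closure (Om b) x -> dr t1 x = 0 /\ dr t2 x = 0) ->
    (forall t s, bdry_u b s -> dr t s = 0) ->
    \int[lebesgue_measure]_(t in `[t1, t2])
      (variation elastic r dr t + variation (work load tau) r dr t
       - variation kinetic r dr t) = 0.

Definition mass_matrix (x : 'rV[R]_l) : 'M[R]_n :=
  rho b x *: \matrix_(i, j)
    \int[leb (3 - l)]_(y in Omc b) ((lam1 b y)^T *m lam1 b y) i j.

Definition stiffness_matrix (x : 'rV[R]_l) : 'M[R]_m :=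
  \matrix_(i, j)
    \int[leb (3 - l)]_(y in Omc b)
      ((lam2 b y)^T *m Cmat b (x, y) *m lam2 b y) i j.

Definition hamiltonian (p : 'rV[R]_l -> 'cV[R]_n) (e : 'rV[R]_l -> 'cV[R]_m) :
  R :=
  2^-1 * \int[leb l]_(x in Om b)
    (dot (p x) (invmx (mass_matrix x) *m p x) +
     dot (e x) (stiffness_matrix x *m e x)).

(* Direction of the j-th Cartesian axis of R^3 in the splitting X = (x, xc). *)
Definition axis (j : 'I_3) : point :=
  (\row_i (i == j :> nat)%:R, \row_i (l + i == j)%N%:R).

Definition linear_strain (u : point -> 'cV[R]_3) (X : point) : 'M[R]_3 :=
  \matrix_(i, j) (('D_(axis j) (fun Y => u Y i 0) X +
                   'D_(axis i) (fun Y => u Y j 0) X) / 2).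

Definition voigt (E : 'M[R]_3) : 'cV[R]_6 :=
  let c (i j : nat) := E (inord i) (inord j) in
  \col_(k < 6) nth 0 [:: c 0%N 0%N; c 1%N 1%N; c 2%N 2%N;
                         2 * c 0%N 1%N; 2 * c 0%N 2%N; 2 * c 1%N 2%N] k.

(* The strain lists, in order, Voigt components outside of which all the others
   vanish. The interior makes two-sided derivatives along xc meaningful. *)
Definition strain_is_voigt (r : motion) : Prop :=
  exists2 c : 'I_d -> 'I_6, {homo c : i j / (i < j)%N} &
    forall t X, Om b X.1 -> (Omc b)° X.2 ->
      (forall i, strain r t X i 0 =
                 voigt (linear_strain (displacement r t) X) (c i) 0) /\
      (forall k, (forall i, c i <> k) ->
                 voigt (linear_strain (displacement r t) X) k 0 = 0).

(* The measure surf is the surface measure of the boundary; a domain with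
   edges has a normal almost everywhere only. *)
Record regular_domain : Prop := RegularDomain {
  dom_open : open (Om b) ;
  dom_bounded : bounded_set (Om b) ;
  dom_surf : forall A, measurable A ->
    surf b A = hausdorff l.-1 (A `&` boundary (Om b)) ;
  dom_normal : {ae surf b, forall s, boundary (Om b) s ->
    outward_unit_normal (Om b) s (normal b s)} ;
  dom_normal_meas : forall k,
    measurable_fun (boundary (Om b)) (fun s => normal b s 0 k) ;
  dom_divergence : forall phi : 'rV[R]_l -> 'cV[R]_l,
    field_Cq 1 (closure (Om b)) phi ->
    \int[leb l]_(x in Om b) (\sum_(k < l) dpart k phi x k 0) =
    \int[surf b]_(s in boundary (Om b)) (\sum_(k < l) phi s k 0 * normal b s 0 k)
}.

End body.

Section predicates.
Context {R : realType}.

Definition posdef a (A : 'M[R]_a) : Prop :=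
  A^T = A /\ forall v : 'cV[R]_a, v != 0 -> 0 < dot v (A *m v).

(* A column (row) is a zero one if it vanishes identically. *)
Definition no_zero_col (X : Type) a b (D : set X) (A : X -> 'M[R]_(a, b)) :=
  forall j, exists2 x, D x & exists i, A x i j != 0.

Definition no_zero_row (X : Type) a b (D : set X) (A : X -> 'M[R]_(a, b)) :=
  forall i, exists2 x, D x & exists j, A x i j != 0.

Definition op_no_zero_col l m n (N : nat) (P0 : 'M[R]_(m, n))
    (P : 'I_l -> nat -> 'M[R]_(m, n)) : Prop :=
  forall j, exists i, P0 i j != 0 \/
    exists k h, (1 <= h <= N)%N /\ P k h i j != 0.

Definition op_no_zero_row l m n (N : nat) (P0 : 'M[R]_(m, n))
    (P : 'I_l -> nat -> 'M[R]_(m, n)) : Prop :=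
  forall i, exists j, P0 i j != 0 \/
    exists k h, (1 <= h <= N)%N /\ P k h i j != 0.

Definition square_integrable d (T : measurableType d)
    (mu : {measure set T -> \bar R}) (D : set T) (f : T -> R) : Prop :=
  measurable_fun D f /\ mu.-integrable D (fun x => ((f x) ^+ 2)%:E).

Definition bounded_field (X : Type) a b (D : set X) (A : X -> 'M[R]_(a, b)) :=
  exists c : R, forall x, D x -> forall i j, `|A x i j| <= c.

Definition linear_input l c n (q : nat) (Om : set 'rV[R]_l)
    (Bd : ('rV[R]_l -> 'cV[R]_c) -> 'rV[R]_l -> 'cV[R]_n) : Prop :=
  (forall u, field_Cq q (closure Om) u -> field_Cq 0 (closure Om) (Bd u)) /\
  (forall (a : R) u v, field_Cq q (closure Om) u -> field_Cq q (closure Om) v ->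
    forall x, closure Om x ->
      Bd (fun y => a *: u y + v y) x = a *: Bd u x + Bd v x).

(* Unlike formal_adjoint, only the inputs u vanish on the boundary, not e. *)
Definition input_adjoint l c n (q : nat) (Om : set 'rV[R]_l)
    (Bd : ('rV[R]_l -> 'cV[R]_c) -> 'rV[R]_l -> 'cV[R]_n)
    (Bds : ('rV[R]_l -> 'cV[R]_n) -> 'rV[R]_l -> 'cV[R]_c) : Prop :=
  (forall e, field_Cq q (closure Om) e -> field_Cq 0 (closure Om) (Bds e)) /\
  (forall e u, field_Cq q (closure Om) e -> field_Cq q (closure Om) u ->
    (forall s, boundary Om s -> u s = 0) ->
    \int[leb l]_(x in Om) dot (e x) (Bd u x) =
    \int[leb l]_(x in Om) dot (u x) (Bds e x)).

Definition variational_derivative l a (Om : set 'rV[R]_l)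
    (G : ('rV[R]_l -> 'cV[R]_a) -> R) (w g : 'rV[R]_l -> 'cV[R]_a) : Prop :=
  field_Cq 0 (closure Om) g /\
  forall dw, field_Coo (closure Om) dw ->
    is_derive (0 : R) (1 : R) (fun eta : R => G (fun x => w x + eta *: dw x))
      (\int[leb l]_(x in Om) dot (g x) (dw x)).

End predicates.

(* Main.v *)
Require Import Defs.
From mathcomp Require Import all_boot all_order all_algebra.
From mathcomp Require Import all_classical all_reals all_analysis.
From mathcomp Require Import measurable_realfun ring lra.
Set Implicit Arguments.
Unset Strict Implicit.
Unset Printing Implicit Defensive.
Import Order.TTheory GRing.Theory Num.Theory.
Import numFieldNormedType.Exports.
Local Open Scope classical_set_scope.
Local Open Scope ring_scope.

(** Why the theorem is true.

    Integrating over the cross-section turns both energies into quadratic forms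
    of fields on the domain [Om]: the kinetic energy is half the integral of
    [M v . v] with [v] the time derivative of [r], the elastic one half the
    integral of [K F r . F r] ([inertia_form], [elastic_form], by Fubini). Their
    sum is [H] evaluated at [p = M v] and [eps = F r], because [M^-1 p = v].
    As quadratic polynomials of a perturbation parameter they are differentiated
    at once ([is_derive_energy]); this gives the variational derivatives of [H]
    and the variations that enter Hamilton's principle.

    For the dynamics, Hamilton's principle is tested with [phi(t) w(x)], where
    [phi] is a smooth bump in time and [w] a smooth field with compact support in
    [Om]. Boundary tractions do not see such a variation. Integrating by parts in
    time moves the derivative from [phi] to the momentum, and the fundamental
    lemma in time gives a weak form at each instant ([weak_form]); integrating by
    parts in space moves [F] from [w] to the stress resultant [K F r] as its
    formal adjoint, and the fundamental lemma in space gives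
    [M r'' = - F^* (K F r) + B_d u_d] ([equation_of_motion]). The other half of
    the system, [(F r)' = F r'], is the symmetry of second derivatives, iterated
    ([schwarz], [dtime_diffop]).

    All integrations by parts in space come from one pointwise identity
    ([adjoint_defect]): [F w . v - w . F^* v] is the divergence of a field whose
    terms are indexed by an axis [k], an order [i] and the number [j - 1] of
    derivatives that have already been moved to [v]. The divergence theorem turns
    it into boundary integrals. For compactly supported factors these vanish,
    which is the skew-adjointness of the interconnection operator; in general
    they are the triple sum of the power balance, and grouping its terms by the
    orders [a = i - j] and [b = j - 1] gives the block matrix
    ([boundary_matrixE]).

    Finally the derivative of [H] along the motion is the integral of
    [v . M r'' + F v . K F r] ([energy_derive]). Inserting the equation of motion
    leaves the power [v . B_d u_d] of the input, which is [y_d . u_d] by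
    adjunction, and the defect of adjointness of [F] at [v] and [K F r], which is
    the boundary term. The effort [M^-1 p] equals [v] not only on the closure of
    [Om] but on a neighbourhood of it, the mass matrix being invertible there
    ([mass_unit_near]); hence the derivatives of the two agree on the boundary
    as well. *)

(** * Functions of class C^q on an open set *)

Section Cq_calculus.
Context {R : realType}.

Section one_space.
Context {V : normedModType R}.
Implicit Types (U W A : set V) (f g : V -> R).

Lemma Cq_cont q U g x : Cq q U g -> U x -> {for x, continuous g}.
Proof. by case: q => [|q] [+ _]; apply. Qed.

Lemma Cq_derivable q U g x v : Cq q.+1 U g -> U x -> derivable g x v.
Proof. by case=> _ /(_ v)[+ _]; apply. Qed.

Lemma Cq_derive q U g v : Cq q.+1 U g -> Cq q U ('D_v g).
Proof. by case=> _ /(_ v)[]. Qed.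

Lemma Cq_sub q U W g : W `<=` U -> Cq q U g -> Cq q W g.
Proof.
move=> WU; elim: q g => [|q IH] g [cg dg]; split => //.
- by move=> x /WU; exact: cg.
- by move=> x /WU; exact: cg.
- by move=> v; have [dgv /IH Cg] := dg v; split => // x /WU; exact: dgv.
Qed.

Lemma CqW q U g : Cq q.+1 U g -> Cq q U g.
Proof.
elim: q g => [|q IH] g [cg dg]; split => // v.
by have [dgv /IH] := dg v.
Qed.

Lemma Cq_le p q U g : (p <= q)%N -> Cq q U g -> Cq p U g.
Proof.
by move=> /subnK <-; elim: (q - p)%N => // k IH; rewrite addSn => /CqW.
Qed.

Lemma near_open U (P : V -> Prop) : open U -> (forall x, U x -> P x) ->
  forall x, U x -> \forall y \near x, P y.
Proof.
move=> oU UP x Ux; apply: filterS (open_nbhs_nbhs (conj oU Ux)).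
by move=> y; exact: UP.
Qed.

Lemma derive_ext_open U f g v x : open U -> (forall y, U y -> f y = g y) ->
  U x -> 'D_v f x = 'D_v g x.
Proof. by move=> oU fg Ux; apply: near_eq_derive; exact: near_open Ux. Qed.

Lemma cont_ext U f g x : open U -> (forall y, U y -> f y = g y) -> U x ->
  {for x, continuous f} -> {for x, continuous g}.
Proof.
move=> oU fg Ux cf; have fgx : {near x, f =1 g} by exact: near_open Ux.
by rewrite /prop_for /continuous_at -(fg x Ux); exact: cvg_trans (near_eq_cvg fgx) cf.
Qed.

Lemma Cq_ext q U f g : open U -> (forall x, U x -> f x = g x) ->
  Cq q U f -> Cq q U g.
Proof.
move=> oU; elim: q f g => [|q IH] f g fg [cf df].
  by split => // x Ux; exact: (cont_ext oU fg Ux (cf x Ux)).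
split=> [x Ux|v]; first exact: (cont_ext oU fg Ux (cf x Ux)).
have [dfv Cdf] := df v; split=> [x Ux|].
  by apply: near_eq_derivable (dfv x Ux); exact: near_open Ux.
by apply: IH Cdf => x Ux; exact: derive_ext_open fg Ux.
Qed.

Lemma Cq_cst q U (a : R) : Cq q U (fun=> a).
Proof.
elim: q a => [|q IH] a; split => //.
- by move=> x _; exact: cvg_cst.
- by move=> x _; exact: cvg_cst.
- move=> v; split=> [x _|]; first exact: derivable_cst.
  have -> : 'D_v (fun=> a) = fun=> 0.
    by apply/funext => x; exact: (derive_cst a x v).
  exact: IH.
Qed.

Lemma Cq_add q U f g : open U -> Cq q U f -> Cq q U g ->
  Cq q U (fun x => f x + g x).
Proof.
move=> oU; elim: q f g => [|q IH] f g [cf df] [cg dg]; split => //.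
- by move=> x Ux; apply: cvgD; [exact: cf|exact: cg].
- by move=> x Ux; apply: cvgD; [exact: cf|exact: cg].
- move=> v; have [dfv Cdf] := df v; have [dgv Cdg] := dg v; split.
    by move=> x Ux; apply: derivableD; [exact: dfv|exact: dgv].
  apply: (Cq_ext oU _ (IH _ _ Cdf Cdg)) => x Ux.
  by rewrite -deriveD//; [exact: dfv|exact: dgv].
Qed.

Lemma Cq_mul q U f g : open U -> Cq q U f -> Cq q U g ->
  Cq q U (fun x => f x * g x).
Proof.
move=> oU; elim: q f g => [|q IH] f g Cf Cg.
  by split => // x Ux; apply: cvgM; [exact: Cq_cont Cf Ux|exact: Cq_cont Cg Ux].
split=> [x Ux|v].
  by apply: cvgM; [exact: Cq_cont Cf Ux|exact: Cq_cont Cg Ux].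
have dfv := fun x => @Cq_derivable q U f x v Cf.
have dgv := fun x => @Cq_derivable q U g x v Cg.
split=> [x Ux|]; first by apply: derivableM; [exact: dfv|exact: dgv].
have C1 := IH _ _ (CqW Cf) (Cq_derive v Cg).
have C2 := IH _ _ (CqW Cg) (Cq_derive v Cf).
apply: (Cq_ext oU _ (Cq_add oU C1 C2)) => x Ux.
by rewrite (_ : (fun _ => _) = f * g)// deriveM//; [exact: dfv|exact: dgv].
Qed.

End one_space.

Lemma derive_comp_affine {V W : normedModType R} (L0 L : W -> V) (g : V -> R) x v :
  (forall h, L (h *: v + x) = h *: L0 v + L x) ->
  'D_v (fun y => g (L y)) x = 'D_(L0 v) g (L x).
Proof. by move=> Lv; rewrite /derive; under eq_fun do rewrite /= Lv. Qed.

Lemma derivable_comp_affine {V W : normedModType R} (L0 L : W -> V) (g : V -> R) x v :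
  (forall h, L (h *: v + x) = h *: L0 v + L x) ->
  derivable g (L x) (L0 v) -> derivable (fun y => g (L y)) x v.
Proof.
by move=> Lv; rewrite /derivable; under [in X in _ -> X]eq_fun do rewrite /= Lv.
Qed.

(** On a line, the composite with an affine map is the given function on the image
    line. So its directional derivatives are again composites with the same map,
    and the induction on the order goes through. *)
Lemma Cq_comp_affine {V W : normedModType R} (L0 L : W -> V) q U (g : V -> R) :
  continuous L -> (forall x v h, L (h *: v + x) = h *: L0 v + L x) ->
  Cq q U g -> Cq q (L @^-1` U) (fun x => g (L x)).
Proof.
move=> cL Lv; elim: q g => [|q IH] g Cg.
  split => // x Ux; apply: continuous_comp; first exact: cL.
  exact: Cq_cont Cg Ux.
split=> [x Ux|v].
  apply: continuous_comp; first exact: cL.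
  exact: Cq_cont Cg Ux.
split=> [x Ux|].
  apply: (@derivable_comp_affine V W L0) => [h|]; first exact: Lv.
  exact: Cq_derivable Cg Ux.
have -> : 'D_v (fun x => g (L x)) = fun x => 'D_(L0 v) g (L x).
  by apply/funext => x; exact: (@derive_comp_affine V W L0).
exact: IH (Cq_derive _ Cg).
Qed.

Lemma is_derive_bigsum {V : normedModType R} I (r : seq I) (P : pred I)
    (F : I -> V -> R) (dF : I -> R) x v :
  (forall i, P i -> is_derive x v (F i) (dF i)) ->
  is_derive x v (fun y => \sum_(i <- r | P i) F i y) (\sum_(i <- r | P i) dF i).
Proof.
move=> dFP; elim: r => [|i r IH].
  rewrite big_nil; under [fun _ => _]eq_fun do rewrite big_nil.
  exact: is_derive_cst.
rewrite big_cons; under [fun _ => _]eq_fun do rewrite big_cons.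
by case: ifPn => // Pi; exact: (is_deriveD (dFP i Pi) IH).
Qed.

(** * Symmetry of second derivatives *)

Section schwarz.
Context {V : normedModType R}.
Implicit Types (U : set V) (f g : V -> R).

Lemma is_derive_line g (u y : V) (s : R) : derivable g (s *: u + y) u ->
  is_derive s 1 (fun s => g (s *: u + y)) ('D_u g (s *: u + y)).
Proof.
move=> dg.
have E h : (h *: 1 + s) *: u + y = h *: u + (s *: u + y).
  by rewrite scalerDl addrA -[h *: 1]/(h * 1) mulr1.
split.
  by move: dg; rewrite /derivable /=; under [in X in _ -> X]eq_fun do rewrite E.
by rewrite /derive /=; under eq_fun do rewrite E.
Qed.

Lemma MVT_line g (u y : V) (h : R) : 0 < h ->
  (forall s, 0 <= s <= h -> derivable g (s *: u + y) u) ->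
  exists2 s, 0 < s < h & g (h *: u + y) - g y = h * 'D_u g (s *: u + y).
Proof.
move=> h0 dg.
have [s| |s] := @MVT _ (fun s => g (s *: u + y)) (fun s => 'D_u g (s *: u + y)) 0 h h0.
- rewrite in_itv /= => /andP[s0 sh].
  by apply: is_derive_line; apply: dg; rewrite !ltW.
- apply: derivable_within_continuous => s.
  rewrite in_itv /= => s0h.
  by have [] := @is_derive_line g u y s (dg _ s0h).
- rewrite in_itv /= scale0r add0r subr0 => s0h ->; exists s => //.
  by rewrite mulrC.
Qed.

(** The second difference of [f] over the parallelogram of sides [h u] and [h v]. *)
Let second_diff f (u v x : V) (h : R) : R :=
  f (h *: u + (h *: v + x)) - f (h *: v + x) - (f (h *: u + x) - f x).

Let second_diffC f u v x (h : R) : second_diff f u v x h = second_diff f v u x h.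
Proof. by rewrite /second_diff addrCA opprD addrACA opprB addrACA; ring. Qed.

(** Two applications of the mean value theorem: to the difference of [f] along
    [v], then to ['D_u f]. *)
Let second_diff_MVT f u v x (h : R) : 0 < h ->
  (forall s t : R, 0 <= s <= h -> 0 <= t <= h ->
     derivable f (s *: u + (t *: v + x)) u /\
     derivable ('D_u f) (s *: u + (t *: v + x)) v) ->
  exists s t : R, [/\ 0 < s < h, 0 < t < h &
    second_diff f u v x h = h * (h * 'D_v ('D_u f) (s *: u + (t *: v + x)))].
Proof.
move=> h0 df.
have E (s t : R) : s *: u + (t *: v + x) = t *: v + (s *: u + x) by rewrite addrCA.
pose g y := f (h *: v + y) - f y.
have dsh (s : R) : 0 <= s <= h -> derivable (fun y => f (h *: v + y)) (s *: u + x) u.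
  move=> s0h.
  apply: (@derivable_comp_affine V V id) => [k|]; first by rewrite addrCA.
  by rewrite -E; apply: (df s h _ _).1 => //; rewrite lexx ltW.
have ds (s : R) : 0 <= s <= h -> derivable f (s *: u + x) u.
  have h0' : (0 : R) <= 0 <= h by rewrite lexx (ltW h0).
  by move=> s0h; have [+ _] := df s 0 s0h h0'; rewrite scale0r add0r.
have [s s0h|s s0h] := @MVT_line g u x h h0.
  by apply: derivableB; [exact: dsh|exact: ds].
have s0h' : 0 <= s <= h by case/andP: s0h => ? ?; rewrite !ltW.
have -> : 'D_u g (s *: u + x) =
    'D_u f (h *: v + (s *: u + x)) - 'D_u f (s *: u + x).
  rewrite (_ : g = (fun y => f (h *: v + y)) - f)//.
  rewrite deriveB; [|exact: dsh|exact: ds].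
  congr (_ - _); apply: (@derive_comp_affine V V id) => k; exact: addrCA.
have [t t0h|t t0h ->] := @MVT_line ('D_u f) v (s *: u + x) h h0.
  by rewrite -E; apply: (df s t s0h' t0h).2.
move=> gE; exists s, t; split; [exact: s0h|exact: t0h|].
by rewrite second_diffC E; exact: gE.
Qed.

Let dist_lt_half (a b c e : R) : `|a - c| < e / 2 -> `|b - c| < e / 2 ->
  `|a - b| < e.
Proof.
move=> ac bc; rewrite (splitr e) -(subrKA c) (le_lt_trans (ler_normD _ _))//.
by rewrite ltrD// distrC.
Qed.

(** Both mixed derivatives are limits of the same second difference quotient,
    which is symmetric in [u] and [v]. *)
Lemma schwarz U f (u v x : V) : open U -> Cq 2 U f -> U x ->
  'D_u ('D_v f) x = 'D_v ('D_u f) x.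
Proof.
move=> oU Cf Ux; apply/eqP; rewrite -subr_eq0 -normr_eq0.
rewrite eq_le normr_ge0 andbT; apply/ler_addgt0Pr => e e0; rewrite add0r.
have e20 : 0 < e / 2 by rewrite divr_gt0.
have cuv := Cq_cont (Cq_derive u (Cq_derive v Cf)) Ux.
have cvu := Cq_cont (Cq_derive v (Cq_derive u Cf)) Ux.
have nU := open_nbhs_nbhs (conj oU Ux).
move/cvgrPdist_lt : cuv => /(_ _ e20) cuv.
move/cvgrPdist_lt : cvu => /(_ _ e20) cvu.
have /nbhs_ballP[d /= d0 dP] : \forall y \near x, U y /\
    (`|'D_u ('D_v f) x - 'D_u ('D_v f) y| < e / 2 /\
     `|'D_v ('D_u f) x - 'D_v ('D_u f) y| < e / 2).
  exact: (filterI nU (filterI cuv cvu)).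
(* The step h keeps the whole parallelogram inside the ball of radius d. *)
pose n := `|u| + `|v| + 1.
have n0 : 0 < n by rewrite ltr_wpDl// addr_ge0.
pose h := d / n.
have h0 : 0 < h by rewrite divr_gt0.
have ballP s t : 0 <= s <= h -> 0 <= t <= h -> ball x d (s *: u + (t *: v + x)).
  move=> /andP[s0 sh] /andP[t0 th]; rewrite -ball_normE /ball_ /=.
  rewrite addrA opprD addrCA subrr addr0 normrN.
  rewrite (le_lt_trans (ler_normD _ _))// !normrZ !ger0_norm//.
  apply: (@le_lt_trans _ _ (h * (`|u| + `|v|))).
    by rewrite mulrDr lerD// ler_wpM2r.
  by rewrite /h mulrAC ltr_pdivrMr// ltr_pM2l// /n ltrDl.
have ballP' s t : 0 <= s <= h -> 0 <= t <= h -> ball x d (s *: v + (t *: u + x)).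
  by move=> ? ?; rewrite addrCA; exact: ballP.
have [|s [t [s0h t0h E1]]] := @second_diff_MVT f u v x h h0.
  move=> s t s0h t0h; have [Uy _] := dP _ (ballP s t s0h t0h).
  split; first exact: Cq_derivable (CqW Cf) Uy.
  exact: Cq_derivable (Cq_derive u Cf) Uy.
have [|s' [t' [s0h' t0h' E2]]] := @second_diff_MVT f v u x h h0.
  move=> a b ? ?; have [Uy _] := dP _ (ballP' a b ltac:(done) ltac:(done)).
  split; first exact: Cq_derivable (CqW Cf) Uy.
  exact: Cq_derivable (Cq_derive v Cf) Uy.
have le2 a : 0 < a < h -> 0 <= a <= h by case/andP => ? ?; rewrite !ltW.
have [_ [_]] := dP _ (ballP _ _ (le2 _ s0h) (le2 _ t0h)).
have [_ [+ _]] := dP _ (ballP' _ _ (le2 _ s0h') (le2 _ t0h')).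
move: E1; rewrite second_diffC E2 => /(mulfI (lt0r_neq0 h0))/(mulfI (lt0r_neq0 h0)) ->.
move=> Dvu Duv; rewrite ltW//.
exact: dist_lt_half Dvu Duv.
Qed.

End schwarz.
End Cq_calculus.

(** * Smooth fields near a set *)

Section smooth_near_theory.
Context {R : realType} {V : normedModType R}.
Implicit Types (A U : set V) (f g : V -> R).

Lemma smooth_near_ext q A U f g : open U -> A `<=` U ->
  (forall x, U x -> f x = g x) -> smooth_near q A f -> smooth_near q A g.
Proof.
move=> oU AU fg [W [oW AW CW]]; exists (U `&` W); split.
- exact: openI.
- by move=> x Ax; split; [exact: AU|exact: AW].
- apply: (@Cq_ext _ _ _ _ f); first exact: openI.
    by move=> x [Ux _]; exact: fg.
  by apply: Cq_sub CW => x [].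
Qed.

Lemma eq_smooth_near q A f g : f =1 g -> smooth_near q A f -> smooth_near q A g.
Proof. by move=> /funext ->. Qed.

Lemma smooth_near_le p q A f : (p <= q)%N -> smooth_near q A f -> smooth_near p A f.
Proof. by move=> pq [U [oU AU CU]]; exists U; split => //; exact: Cq_le CU. Qed.

Lemma smooth_near_sub q A B f : B `<=` A -> smooth_near q A f -> smooth_near q B f.
Proof. by move=> BA [U [oU AU CU]]; exists U; split => // x /BA/AU. Qed.

Lemma smooth_near_cst q A (a : R) : smooth_near q A (fun=> a).
Proof. by exists setT; split => //; [exact: openT|exact: Cq_cst]. Qed.

Lemma smooth_near_add q A f g : smooth_near q A f -> smooth_near q A g ->
  smooth_near q A (fun x => f x + g x).
Proof.
move=> [U [oU AU CU]] [W [oW AW CW]]; exists (U `&` W); split.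
- exact: openI.
- by move=> x Ax; split; [exact: AU|exact: AW].
- apply: Cq_add; first exact: openI.
    by apply: Cq_sub CU => x [].
  by apply: Cq_sub CW => x [].
Qed.

Lemma smooth_near_mul q A f g : smooth_near q A f -> smooth_near q A g ->
  smooth_near q A (fun x => f x * g x).
Proof.
move=> [U [oU AU CU]] [W [oW AW CW]]; exists (U `&` W); split.
- exact: openI.
- by move=> x Ax; split; [exact: AU|exact: AW].
- apply: Cq_mul; first exact: openI.
    by apply: Cq_sub CU => x [].
  by apply: Cq_sub CW => x [].
Qed.

Lemma smooth_near_sum q A I (s : seq I) (P : pred I) (F : I -> V -> R) :
  (forall i, P i -> smooth_near q A (F i)) ->
  smooth_near q A (fun x => \sum_(i <- s | P i) F i x).
Proof.
move=> CF; elim: s => [|i s IH].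
  apply: eq_smooth_near (smooth_near_cst _ _ 0) => x.
  by rewrite big_nil.
case: (boolP (P i)) => Pi.
  apply: eq_smooth_near (smooth_near_add (CF i Pi) IH) => x.
  by rewrite big_cons Pi.
by apply: eq_smooth_near IH => x; rewrite big_cons (negbTE Pi).
Qed.

Lemma smooth_near_derive q A f v : smooth_near q.+1 A f ->
  smooth_near q A ('D_v f).
Proof. by move=> [U [oU AU CU]]; exists U; split => //; exact: Cq_derive. Qed.

Lemma smooth_near_cont q A f x : smooth_near q A f -> A x -> {for x, continuous f}.
Proof. by move=> [U [oU AU CU]] Ax; apply: Cq_cont CU _; exact: AU. Qed.

Lemma smooth_near_derivable q A f x v : smooth_near q.+1 A f -> A x ->
  derivable f x v.
Proof. by move=> [U [oU AU CU]] Ax; apply: Cq_derivable CU _; exact: AU. Qed.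

End smooth_near_theory.

Lemma smooth_near_comp_affine {R : realType} {V W : normedModType R}
    (L0 L : W -> V) q A B (g : V -> R) :
  continuous L -> (forall x v h, L (h *: v + x) = h *: L0 v + L x) ->
  B `<=` L @^-1` A ->
  smooth_near q A g -> smooth_near q B (fun x => g (L x)).
Proof.
move=> cL Lv BA [U [oU AU CU]]; exists (L @^-1` U); split.
- by apply: open_comp => // x _; exact: cL.
- by move=> x /BA /= /AU.
- exact: Cq_comp_affine CU.
Qed.

Section field_theory.
Context {R : realType} {V : normedModType R}.
Implicit Types (A U : set V).

Lemma field_Cq_sub q a b A B (f : V -> 'M[R]_(a, b)) : B `<=` A ->
  field_Cq q A f -> field_Cq q B f.
Proof. by move=> BA Cf i j; exact: smooth_near_sub BA _. Qed.

Lemma field_Cq_le p q a b A (f : V -> 'M[R]_(a, b)) : (p <= q)%N ->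
  field_Cq q A f -> field_Cq p A f.
Proof. by move=> pq Cf i j; exact: smooth_near_le pq _. Qed.

Lemma field_Cq_ext q a b A U (f g : V -> 'M[R]_(a, b)) : open U -> A `<=` U ->
  (forall x, U x -> f x = g x) -> field_Cq q A f -> field_Cq q A g.
Proof.
move=> oU AU fg Cf i j; apply: (smooth_near_ext oU AU _ (Cf i j)) => x Ux.
by rewrite fg.
Qed.

Lemma field_Coo_Cq q a b A (f : V -> 'M[R]_(a, b)) :
  field_Coo A f -> field_Cq q A f.
Proof. by move=> Cf i j; have [U [oU AU CU]] := Cf i j; exists U; split. Qed.

(** Each entry comes with a neighbourhood of its own; a finite intersection of
    open sets is open. *)
Lemma field_CqP q a b A (f : V -> 'M[R]_(a, b)) : field_Cq q A f ->
  exists U, [/\ open U, A `<=` U & forall i j, Cq q U (fun x => f x i j)].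
Proof.
move=> Cf; have [U UP] := choice (fun ij : 'I_a * 'I_b => Cf ij.1 ij.2).
exists [set x | forall ij, U ij x]; split.
- rewrite openE => x /= Ux; apply: filter_forall => ij.
  by have [oU _ _] := UP ij; exact: open_nbhs_nbhs.
- by move=> x Ax ij; have [_ + _] := UP ij; apply.
- move=> i j; have [_ _ CU] := UP (i, j); apply: Cq_sub CU => x /= Ux.
  exact: (Ux (i, j)).
Qed.

Lemma field_Cq_cst q a b A (M : 'M[R]_(a, b)) : field_Cq q A (fun=> M).
Proof. by move=> i j; exact: smooth_near_cst. Qed.

Lemma field_Cq_add q a b A (f g : V -> 'M[R]_(a, b)) :
  field_Cq q A f -> field_Cq q A g -> field_Cq q A (fun x => f x + g x).
Proof.
move=> Cf Cg i j; apply: eq_smooth_near (smooth_near_add (Cf i j) (Cg i j)).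
by move=> x; rewrite mxE.
Qed.

Lemma field_Cq_scale q a b A (r : V -> R) (f : V -> 'M[R]_(a, b)) :
  smooth_near q A r -> field_Cq q A f -> field_Cq q A (fun x => r x *: f x).
Proof.
move=> Cr Cf i j; apply: eq_smooth_near (smooth_near_mul Cr (Cf i j)).
by move=> x; rewrite mxE.
Qed.

Lemma field_Cq_tr q a b A (f : V -> 'M[R]_(a, b)) :
  field_Cq q A f -> field_Cq q A (fun x => (f x)^T).
Proof.
move=> Cf i j; apply: eq_smooth_near (Cf j i).
by move=> x; rewrite mxE.
Qed.

Lemma field_Cq_mul q a b c A (f : V -> 'M[R]_(a, b)) (g : V -> 'M[R]_(b, c)) :
  field_Cq q A f -> field_Cq q A g -> field_Cq q A (fun x => f x *m g x).
Proof.
move=> Cf Cg i j.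
apply: (@eq_smooth_near _ _ _ _ (fun x => \sum_k f x i k * g x k j)).
  by move=> x; rewrite mxE.
by apply: smooth_near_sum => k _; exact: smooth_near_mul.
Qed.

Lemma field_Cq_sum q a b A I (s : seq I) (P : pred I) (F : I -> V -> 'M[R]_(a, b)) :
  (forall i, P i -> field_Cq q A (F i)) ->
  field_Cq q A (fun x => \sum_(i <- s | P i) F i x).
Proof.
move=> CF i j.
apply: (@eq_smooth_near _ _ _ _ (fun x => \sum_(k <- s | P k) F k x i j)).
  by move=> x; rewrite summxE.
by apply: smooth_near_sum => k Pk; exact: CF.
Qed.

Lemma smooth_near_dot q a A (f g : V -> 'cV[R]_a) :
  field_Cq q A f -> field_Cq q A g -> smooth_near q A (fun x => dot (f x) (g x)).
Proof. by move=> Cf Cg; apply: field_Cq_mul => //; exact: field_Cq_tr. Qed.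

End field_theory.

(** * Spatial operators *)

Section spatial.
Context {R : realType} {l : nat}.
Implicit Types (A U : set 'rV[R]_l).

Lemma dpart_Cq q a A k (w : 'rV[R]_l -> 'cV[R]_a) :
  field_Cq q.+1 A w -> field_Cq q A (dpart k w).
Proof.
move=> Cw i j.
apply: (@eq_smooth_near _ _ _ _ ('D_(delta_mx 0 k) (fun y => w y i 0))).
  by move=> x; rewrite mxE.
by apply: smooth_near_derive; exact: Cw.
Qed.

Lemma dpartn_Cq p q a A i k (w : 'rV[R]_l -> 'cV[R]_a) : (p + i <= q)%N ->
  field_Cq q A w -> field_Cq p A (dpartn i k w).
Proof.
move=> piq /(field_Cq_le piq); elim: i p {piq} => [|i IH] p.
  by rewrite addn0.
by rewrite addnS -addSn => /IH; exact: dpart_Cq.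
Qed.

Lemma diffop_Cq p q m n N A P0 P (w : 'rV[R]_l -> 'cV[R]_n) : (p + N <= q)%N ->
  field_Cq q A w -> field_Cq p A (@diffop _ l m n N P0 P w).
Proof.
move=> pNq Cw; apply: field_Cq_add.
  apply: field_Cq_mul; first exact: field_Cq_cst.
  by apply: field_Cq_le Cw; rewrite (leq_trans _ pNq)// leq_addr.
apply: field_Cq_sum => k _.
rewrite (_ : (fun _ => _) = fun x =>
  \sum_(i <- index_iota 1 N.+1 | (1 <= i < N.+1)%N && true) P k i *m dpartn i k w x).
  apply: field_Cq_sum => i /andP[/andP[_ iN] _].
  apply: field_Cq_mul; first exact: field_Cq_cst.
  by apply: dpartn_Cq Cw; rewrite (leq_trans _ pNq)// leq_add2l.
by apply/funext => x; exact: big_nat_cond.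
Qed.

Lemma diffop_adj_Cq p q m n N A P0 P (v : 'rV[R]_l -> 'cV[R]_m) : (p + N <= q)%N ->
  field_Cq q A v -> field_Cq p A (@diffop_adj _ l m n N P0 P v).
Proof.
move=> pNq Cv; apply: field_Cq_add.
  apply: field_Cq_mul; first exact: field_Cq_cst.
  by apply: field_Cq_le Cv; rewrite (leq_trans _ pNq)// leq_addr.
apply: field_Cq_sum => k _.
rewrite (_ : (fun _ => _) = fun x =>
  \sum_(i <- index_iota 1 N.+1 | (1 <= i < N.+1)%N && true)
     (-1) ^+ i *: ((P k i)^T *m dpartn i k v x)).
  apply: field_Cq_sum => i /andP[/andP[_ iN] _].
  apply: field_Cq_scale; first exact: smooth_near_cst.
  apply: field_Cq_mul; first exact: field_Cq_cst.
  by apply: dpartn_Cq Cv; rewrite (leq_trans _ pNq)// leq_add2l.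
by apply/funext => x; exact: big_nat_cond.
Qed.

Lemma dpart_ext a U k (w w' : 'rV[R]_l -> 'cV[R]_a) x : open U ->
  (forall y, U y -> w y = w' y) -> U x -> dpart k w x = dpart k w' x.
Proof.
move=> oU ww' Ux; apply/colP => i; rewrite !mxE.
by apply: derive_ext_open oU _ Ux => y Uy; rewrite ww'.
Qed.

Lemma dpartn_ext a U i k (w w' : 'rV[R]_l -> 'cV[R]_a) x : open U ->
  (forall y, U y -> w y = w' y) -> U x -> dpartn i k w x = dpartn i k w' x.
Proof.
move=> oU ww'; elim: i x => [|i IH] x Ux; first exact: ww'.
by apply: dpart_ext oU _ Ux => y Uy; exact: IH.
Qed.

Lemma diffop_ext m n N P0 P U (w w' : 'rV[R]_l -> 'cV[R]_n) x : open U ->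
  (forall y, U y -> w y = w' y) -> U x ->
  @diffop _ l m n N P0 P w x = diffop N P0 P w' x.
Proof.
move=> oU ww' Ux; rewrite /diffop (ww' x Ux); congr (_ + _).
apply: eq_bigr => k _; apply: eq_bigr => i _.
by rewrite (dpartn_ext _ _ oU ww' Ux).
Qed.

Lemma jet_ext n N U (w w' : 'rV[R]_l -> 'cV[R]_n) x : open U ->
  (forall y, U y -> w y = w' y) -> U x -> jet N w x = jet N w' x.
Proof.
move=> oU ww' Ux; apply: eq_mxcol => -[[|a] ai] /=; first exact: ww'.
by apply: eq_mxcol => k; exact: (dpartn_ext a.+1 k oU ww' Ux).
Qed.

Lemma dpart_lin a A k (c : R) (w w' : 'rV[R]_l -> 'cV[R]_a) x :
  field_Cq 1 A w -> field_Cq 1 A w' -> A x ->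
  dpart k (fun y => w y + c *: w' y) x = dpart k w x + c *: dpart k w' x.
Proof.
move=> Cw Cw' Ax; apply/colP => i; rewrite !mxE.
have dw := smooth_near_derivable (v := delta_mx 0 k) (Cw i 0) Ax.
have dw' := smooth_near_derivable (v := delta_mx 0 k) (Cw' i 0) Ax.
have -> : (fun y => (w y + c *: w' y) i 0) =
    (fun y => w y i 0) + c *: (fun y => w' y i 0).
  by apply/funext => y; rewrite !mxE.
by rewrite (deriveD dw (derivableZ dw')) (deriveZ c dw').
Qed.

Lemma dpartn_lin a U i k (c : R) (w w' : 'rV[R]_l -> 'cV[R]_a) x : open U ->
  field_Cq i U w -> field_Cq i U w' -> U x ->
  dpartn i k (fun y => w y + c *: w' y) x = dpartn i k w x + c *: dpartn i k w' x.
Proof.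
move=> oU; elim: i x => // i IH x Cw Cw' Ux.
rewrite /dpartn !iterS -/(dpartn i k _) -/(dpartn i k _) -/(dpartn i k _).
rewrite -(@dpart_lin _ U)//; try exact: dpartn_Cq (_ : 1 + i <= i.+1)%N _.
apply: dpart_ext oU _ Ux => y Uy.
by apply: IH => //; exact: field_Cq_le (leqnSn i) _.
Qed.

Lemma diffop_lin m n N P0 P U (c : R) (w w' : 'rV[R]_l -> 'cV[R]_n) x : open U ->
  field_Cq N U w -> field_Cq N U w' -> U x ->
  @diffop _ l m n N P0 P (fun y => w y + c *: w' y) x =
  diffop N P0 P w x + c *: diffop N P0 P w' x.
Proof.
move=> oU Cw Cw' Ux; rewrite /diffop scalerDr addrACA; congr (_ + _).
  by rewrite mulmxDr -scalemxAr.
rewrite scaler_sumr -big_split/=; apply: eq_bigr => k _.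
rewrite scaler_sumr -big_split/=; apply: eq_big_nat => i /andP[_ iN].
have {}iN : (i <= N)%N by [].
rewrite (dpartn_lin k c oU (field_Cq_le iN Cw) (field_Cq_le iN Cw') Ux).
by rewrite mulmxDr -scalemxAr.
Qed.

End spatial.

(** * Fields depending on time *)

Section spacetime_fields.
Context {R : realType} {l : nat}.
Implicit Types (A : set 'rV[R]_l) (W : set (R * 'rV[R]_l)).
Local Notation ST A := ([set: R] `*` A).

(** A motion is regarded as one function on spacetime, whose derivatives along
    [(1, 0)] and [(0, e_k)] are the time and the space derivatives; the symmetry of
    second derivatives then applies to them. *)
Lemma dtimeE a (f : R -> 'rV[R]_l -> 'cV[R]_a) t x i j :
  dtime f t x i j = 'D_(1, 0) (fun z => uncurried f z i j) (t, x).
Proof.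
rewrite mxE derive1E [j]ord1.
apply: (@derive_comp_affine _ _ _ (fun h : R => (h, 0) : R * 'rV[R]_l)
  (fun s : R => (s, x)) (fun z => uncurried f z i 0)) => h.
by congr pair; rewrite /= scaler0 add0r.
Qed.

Lemma dpart_timeE a (f : R -> 'rV[R]_l -> 'cV[R]_a) k t x i j :
  dpart k (f t) x i j = 'D_(0, delta_mx 0 k) (fun z => uncurried f z i j) (t, x).
Proof.
rewrite mxE [j]ord1.
apply: (@derive_comp_affine _ _ _ (fun h => (0, h) : R * 'rV[R]_l)
  (fun y => (t, y)) (fun z => uncurried f z i 0)) => h.
by congr pair; rewrite /= scaler0 add0r.
Qed.

Lemma eq_derive (V : normedModType R) (F G : V -> R) v x :
  F =1 G -> 'D_v F x = 'D_v G x.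
Proof. by move=> /funext ->. Qed.

Lemma dtime_dpartE a (f : R -> 'rV[R]_l -> 'cV[R]_a) k t x i j :
  dtime (fun s => dpart k (f s)) t x i j =
  'D_(1, 0) ('D_(0, delta_mx 0 k) (fun z => uncurried f z i j)) (t, x).
Proof.
apply: etrans (dtimeE _ t x i j) _; apply: eq_derive => -[s y].
exact: (dpart_timeE f k s y i j).
Qed.

Lemma dpart_dtimeE a (f : R -> 'rV[R]_l -> 'cV[R]_a) k t x i j :
  dpart k (dtime f t) x i j =
  'D_(0, delta_mx 0 k) ('D_(1, 0) (fun z => uncurried f z i j)) (t, x).
Proof.
apply: etrans (dpart_timeE _ k t x i j) _; apply: eq_derive => -[s y].
exact: (dtimeE f s y i j).
Qed.

Lemma dtime_Cq q a A (f : R -> 'rV[R]_l -> 'cV[R]_a) :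
  field_Cq q.+1 (ST A) (uncurried f) -> field_Cq q (ST A) (uncurried (dtime f)).
Proof.
move=> Cf i j; apply: eq_smooth_near (smooth_near_derive ((1, 0) : R * 'rV[R]_l) (Cf i j)).
by move=> [t x]; rewrite /uncurried -dtimeE.
Qed.

Lemma dpart_time_Cq q a A k (f : R -> 'rV[R]_l -> 'cV[R]_a) :
  field_Cq q.+1 (ST A) (uncurried f) ->
  field_Cq q (ST A) (uncurried (fun t => dpart k (f t))).
Proof.
move=> Cf i j; apply: eq_smooth_near (smooth_near_derive ((0, delta_mx 0 k) : R * 'rV[R]_l) (Cf i j)).
by move=> [t x]; rewrite /uncurried -dpart_timeE.
Qed.

Lemma dpartn_time_Cq p q a A i k (f : R -> 'rV[R]_l -> 'cV[R]_a) : (p + i <= q)%N ->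
  field_Cq q (ST A) (uncurried f) ->
  field_Cq p (ST A) (uncurried (fun t => dpartn i k (f t))).
Proof.
move=> piq /(field_Cq_le piq); elim: i p {piq} => [|i IH] p.
  by rewrite addn0.
by rewrite addnS -addSn => /IH; exact: dpart_time_Cq.
Qed.

Lemma diffop_time_Cq p q m n N A P0 P (f : R -> 'rV[R]_l -> 'cV[R]_n) :
  (p + N <= q)%N -> field_Cq q (ST A) (uncurried f) ->
  field_Cq p (ST A) (uncurried (fun t => @diffop _ l m n N P0 P (f t))).
Proof.
move=> pNq Cw; apply: field_Cq_add.
  apply: field_Cq_mul; first exact: field_Cq_cst.
  by apply: field_Cq_le Cw; rewrite (leq_trans _ pNq)// leq_addr.
apply: field_Cq_sum => k _.
rewrite (_ : (fun _ => _) = fun z =>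
  \sum_(i <- index_iota 1 N.+1 | (1 <= i < N.+1)%N && true)
     P k i *m uncurried (fun t => dpartn i k (f t)) z).
  apply: field_Cq_sum => i /andP[/andP[_ iN] _].
  apply: field_Cq_mul; first exact: field_Cq_cst.
  by apply: dpartn_time_Cq Cw; rewrite (leq_trans _ pNq)// leq_add2l.
by apply/funext => x; exact: big_nat_cond.
Qed.

Lemma slice_continuous (t : R) : continuous (fun x : 'rV[R]_l => (t, x)).
Proof. by move=> x; apply: (@cvg_pair _ _ _ (nbhs x) (nbhs t) (nbhs x)); [exact: cvg_cst|exact: cvg_id]. Qed.

Lemma slice_Cq q a c A (f : R -> 'rV[R]_l -> 'M[R]_(a, c)) t :
  field_Cq q (ST A) (uncurried f) -> field_Cq q A (f t).
Proof.
move=> Cf i j.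
apply: (@smooth_near_comp_affine _ _ _ (fun h => (0, h) : R * 'rV[R]_l)
  (fun y => (t, y)) q (ST A) A (fun z => uncurried f z i j)) => //.
- exact: slice_continuous.
- by move=> x v h; congr pair; rewrite /= scaler0 add0r.
Qed.

Lemma const_time_smooth q A (g : 'rV[R]_l -> R) :
  smooth_near q A g -> smooth_near q (ST A) (fun z => g z.2).
Proof.
apply: (@smooth_near_comp_affine _ _ _ (fun z : R * 'rV[R]_l => z.2)) => //.
- by move=> z; apply: (@cvg_snd _ _ (nbhs z.1) (nbhs z.2)).
- by move=> z [].
Qed.

Lemma const_time_Cq q a c A (f : 'rV[R]_l -> 'M[R]_(a, c)) :
  field_Cq q A f -> field_Cq q (ST A) (uncurried (fun _ : R => f)).
Proof. by move=> Cf i j; exact: (const_time_smooth (Cf i j)). Qed.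

Lemma time_derivable q a A (f : R -> 'rV[R]_l -> 'cV[R]_a) t x i :
  field_Cq q.+1 (ST A) (uncurried f) -> A x ->
  derivable (fun s => f s x i 0) t 1.
Proof.
move=> Cf Ax.
apply: (@derivable_comp_affine _ _ _ (fun h : R => (h, 0) : R * 'rV[R]_l)
  (fun s : R => (s, x)) (fun z => uncurried f z i 0)) => [h|].
  by congr pair; rewrite /= scaler0 add0r.
by apply: smooth_near_derivable (Cf i 0) _; split.
Qed.

(** Symmetry of second derivatives, iterated: the induction needs the identity
    on an open set, not only on the slab itself. *)
Lemma dtime_dpartn a W i k (f : R -> 'rV[R]_l -> 'cV[R]_a) t x : open W ->
  field_Cq i.+1 W (uncurried f) -> W (t, x) ->
  dtime (fun s => dpartn i k (f s)) t x = dpartn i k (dtime f t) x.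
Proof.
move=> oW; have oWt s : open [set y | W (s, y)].
  by apply: open_comp => // y _; exact: slice_continuous.
have Cpart j : (j <= i)%N -> field_Cq i.+1 W (uncurried f) ->
    field_Cq (i.+1 - j) W (uncurried (fun s => dpartn j k (f s))).
  elim: j => [|j IH] ji Cf; first by rewrite subn0.
  have {IH} := IH (ltnW ji) Cf.
  rewrite subSS subSn ?(ltnW ji)// => C u v.
  apply: eq_smooth_near (smooth_near_derive ((0, delta_mx 0 k) : R * 'rV[R]_l) (C u v)).
  by move=> [s y]; exact: (esym (dpart_timeE (fun s => dpartn j k (f s)) k s y u v)).
move: t x.
have : forall j, (j <= i)%N -> field_Cq i.+1 W (uncurried f) ->
    forall t x, W (t, x) ->
    dtime (fun s => dpartn j k (f s)) t x = dpartn j k (dtime f t) x.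
  elim=> [//|j IH] ji Cf t x Wtx.
  rewrite /dpartn iterS -/(dpartn j k _).
  transitivity (dpart k (dtime (fun s => dpartn j k (f s)) t) x); last first.
    by apply: dpart_ext (oWt t) _ Wtx => y Wy; exact: IH (ltnW ji) Cf _ _ _.
  set g := fun s => dpartn j k (f s).
  apply/colP => u.
  apply: etrans (dtime_dpartE g k t x u 0) _.
  apply: etrans _ (esym (dpart_dtimeE g k t x u 0)).
  have [U [oU WU CU]] := Cpart j (ltnW ji) Cf u 0.
  apply: (schwarz _ _ oU _ (WU _ Wtx)).
  by apply: Cq_le CU; rewrite ltn_subRL addn1 ltnS.
by move=> H t x Cf Wtx; exact: H (leqnn i) Cf _ _ Wtx.
Qed.

Lemma dtime_diffop m n N P0 P A (f : R -> 'rV[R]_l -> 'cV[R]_n) t x :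
  field_Cq N.+1 (ST A) (uncurried f) -> A x ->
  dtime (fun s => @diffop _ l m n N P0 P (f s)) t x = diffop N P0 P (dtime f t) x.
Proof.
move=> Cf Ax; have [W [oW AW CW]] := field_CqP Cf.
have Wtx : W (t, x) by exact: AW.
have CfW i : (i <= N)%N -> field_Cq i.+1 W (uncurried f).
  by move=> iN u v; exists W; split => //; exact: Cq_le (CW u v).
have dP i k u : (i <= N)%N -> derivable (fun s => dpartn i k (f s) x u 0) t 1.
  move=> iN; apply: (@time_derivable 0 _ A (fun s => dpartn i k (f s))) => //.
  by apply: dpartn_time_Cq Cf; rewrite add1n.
apply/colP => u; rewrite !mxE.
have -> : (fun s => diffop N P0 P (f s) x u 0) = (fun s =>
    \sum_j P0 u j * f s x j 0 +
    \sum_(k < l) \sum_(1 <= i < N.+1) \sum_j P k i u j * dpartn i k (f s) x j 0).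
  apply/funext => s; rewrite !mxE summxE; congr (_ + _).
  apply: eq_bigr => k _; rewrite summxE; apply: eq_bigr => i _.
  by rewrite mxE.
have scal (c : R) (g : R -> R) : derivable g t 1 ->
    is_derive t 1 (fun s => c * g s) (c * derive1 g t).
  by move=> dg; rewrite derive1E; apply: is_deriveZ; exact: derivableP.
rewrite derive1E summxE; apply: derive_val.
apply: is_deriveD.
  apply: is_derive_bigsum => j _; rewrite mxE; apply: scal.
  exact: (@time_derivable N _ A f).
apply: is_derive_bigsum => k _; rewrite summxE.
rewrite big_nat_cond [X in is_derive _ _ X _](_ : _ = fun s =>
  \sum_(1 <= i < N.+1 | (1 <= i < N.+1)%N && true)
    \sum_j P k i u j * dpartn i k (f s) x j 0); last first.
  by apply/funext => s; exact: big_nat_cond.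
apply: is_derive_bigsum => i /andP[/andP[_ iN] _].
rewrite mxE; apply: is_derive_bigsum => j _.
rewrite -(dtime_dpartn _ oW) //; last exact: CfW.
by rewrite mxE; apply: scal; exact: dP.
Qed.


End spacetime_fields.

(** * Integration over bounded open sets *)

Section rV_measure.
Context {R : realType}.

Let box l (q : 'rV[R]_l) (e : R) : set 'rV[R]_l :=
  \bigcap_(i in [set: 'I_l]) [set y | ball (q 0 i) e (y 0 i)].

Let measurable_box l (q : 'rV[R]_l) e : measurable (box q e).
Proof.
apply: fin_bigcap_measurable; first exact: finite_finset.
move=> i _.
by have := @measurable_coord R l i measurableT _ (measurable_ball (q 0 i) e); rewrite setTI.
Qed.

(** Rational cubes form a countable base of the topology. *)
Lemma open_measurable_rV l (A : set 'rV[R]_l) : open A -> measurable A.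
Proof.
move=> oA.
pose F (n : nat) : set 'rV[R]_l :=
  if unpickle n is Some (q, k) then
    let B := box (map_mx ratr q) (k.+1%:R^-1) in if `[< B `<=` A >] then B else set0
  else set0 : set 'rV[R]_l.
pose idx := ('rV[rat]_l * nat)%type.
have -> : A = \bigcup_n F n.
  apply/seteqP; split => [x Ax|x [n _]]; last first.
    rewrite /F; case: unpickle => [[q k]|//] /=.
    by case: ifPn => // /asboolP; apply.
  have /nbhs_ballP[e /= e0 eA] := open_nbhs_nbhs (conj oA Ax).
  (* Cubes of radius 1/(k + 1) < e/2 around a rational point. *)
  pose k := Num.truncn (2 / e).
  have ke : k.+1%:R^-1 < e / 2.
    rewrite invf_plt ?posrE ?divr_gt0// invf_div.
    by have /andP[] := truncn_itv (ltW (divr_gt0 (ltr0n R 2) e0)).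
  have k0 : 0 < k.+1%:R^-1 :> R by rewrite invr_gt0.
  have qP (i : 'I_l) : exists q : rat, ball (ratr q : R) k.+1%:R^-1 (x 0 i).
    have [q] := @rat_in_itvoo R (x 0 i - k.+1%:R^-1) (x 0 i + k.+1%:R^-1)
      ltac:(by rewrite ltrD2l gtrN).
    rewrite in_itv /= => /andP[q1 q2]; exists q.
    rewrite -ball_normE /= ltr_norml; apply/andP; split.
      by rewrite ltrBrDl.
    by rewrite ltrBlDl.
  have [q {}qP] := choice qP.
  exists (pickle ((\row_i q i, k) : idx)) => //.
  rewrite /F pickleK; case: ifPn => [_ i _ /=|/asboolP]; first by rewrite !mxE.
  case=> y Bqy; apply: eA; split => // i j; rewrite [i]ord1.
  have /= := Bqy j I; rewrite !mxE -!ball_normE /= => yq.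
  have := qP j; rewrite -ball_normE /= => xq.
  rewrite (splitr e) -(subrKA (ratr (q j))) (le_lt_trans (ler_normD _ _))//.
  by rewrite ltrD// (lt_trans _ ke)// distrC.
apply: bigcupT_measurable => n; rewrite /F; case: unpickle => [[q k]|//].
by case: ifPn => // _; exact: measurable_box.
Qed.

Lemma continuous_measurable_rV l (A U : set 'rV[R]_l) (g : 'rV[R]_l -> R) :
  open U -> A `<=` U -> measurable A -> (forall x, U x -> {for x, continuous g}) ->
  measurable_fun A g.
Proof.
move=> oU AU mA cg; apply: (measurable_funS _ AU); first exact: open_measurable_rV.
apply: (measurability _ (RGenOpens.measurableE R)).
move=> _ [_ [a [b ->]] <-]; apply: open_measurable_rV.
rewrite openE => x [Ux Bx]; rewrite /interior.
apply: filterI; first exact: open_nbhs_nbhs.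
by apply: (cg x Ux); apply: open_nbhs_nbhs; split => //; exact: interval_open.
Qed.

Let cube l (M : R) : set 'rV[R]_l :=
  \bigcap_(i in [set: 'I_l]) [set v | `|v 0 i| <= M].
Arguments cube : clear implicits.

Let measurable_cube l M : measurable (cube l M).
Proof.
apply: fin_bigcap_measurable; first exact: finite_finset.
move=> i _; pose c (v : 'rV[R]_l) : measurableTypeR R := v 0 i.
have E : setT `&` c @^-1` `[- M, M] = [set v : 'rV[R]_l | `|v 0 i| <= M].
  by rewrite setTI; apply/seteqP; split => v /=; rewrite in_itv /= ler_norml.
have : measurable (setT `&` c @^-1` `[- M, M]).
  by apply: (measurable_coord i); [exact: measurableT|exact: measurable_itv].
by rewrite E.
Qed.

Let leb_cube l M : (leb l (cube l M) < +oo)%E.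
Proof.
elim: l => [|l IH]; first by rewrite /= diracE ltry.
have -> : leb l.+1 (cube l.+1 M) =
    (@lebesgue_measure R \x leb l)%E ([set` `[- M, M]] `*` cube l M).
  rewrite /= /lebesgue_step /pushforward; congr (_ _).
  apply/seteqP; split => -[a v] /=.
    move=> H; split.
      have := H ord0 I; rewrite /cons_rV /= mxE unlift_none /=.
      by rewrite in_itv /= ler_norml.
    by move=> i _; have := H (lift ord0 i) I; rewrite /cons_rV /= mxE liftK.
  move=> [aM Hv] i _; rewrite /cons_rV /= mxE.
  case: (unliftP ord0 i) => [j _|_] /=; first exact: Hv.
  by move: aM; rewrite in_itv /= ler_norml.
rewrite product_measure1E//; last exact: measurable_cube.
have E : (@lebesgue_measure R [set` `[- M, M]%R] < +oo)%E.
  by rewrite lebesgue_measure_itv /=; case: ifPn => _; rewrite -?EFinD ltry.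
by apply: lte_mul_pinfty; [|rewrite ge0_fin_numE|exact: IH].
Qed.

Lemma leb_bounded_lty l (A : set 'rV[R]_l) : measurable A -> bounded_set A ->
  (leb l A < +oo)%E.
Proof.
move=> mA [M [_ AM]]; apply: le_lt_trans (leb_cube l (M + 1)).
apply: le_measure; rewrite ?inE//; first exact: measurable_cube.
move=> v Av i _; apply: le_trans (AM (M + 1) _ v Av); last by rewrite ltrDl.
rewrite [leRHS]/Num.Def.normr/= mx_normrE.
exact: (le_bigmax _ (fun ij => `|v ij.1 ij.2|) (0, i)).
Qed.

Lemma compact_smooth_bounded (V : normedModType R) (K : set V) (g : V -> R) :
  compact K -> smooth_near 0 K g -> exists M, forall x, K x -> `|g x| <= M.
Proof.
move=> cK Cg.
have /compact_bounded[M [_ MP]] : compact (g @` K).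
  apply: continuous_compact => //; apply: continuous_in_subspaceT => x /set_mem Kx.
  exact: smooth_near_cont Cg Kx.
by exists (M + 1) => x Kx; apply: (MP (M + 1)); [rewrite ltrDl|exists x].
Qed.

Section domain.
Context {l : nat} (D : set 'rV[R]_l).
Hypotheses (oD : open D) (bD : bounded_set D).

Let mD : measurable D. Proof. exact: open_measurable_rV. Qed.

Lemma closure_compact : compact (closure D).
Proof.
apply: bounded_closed_compact; last exact: closed_closure.
have [M [Mr MP]] := bD; exists M; split => // x Mx y Dy.
have: closed [set v : 'rV[R]_l | `|v| <= x].
  apply: (@closed_comp _ _ (fun v : 'rV[R]_l => `|v|) [set y : R | y <= x]).
    by move=> v _; exact: norm_continuous.
  exact: closed_le.
move=> /closure_id ->; apply: closure_subset Dy => v; exact: MP.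
Qed.

Lemma smooth_near_bounded (g : 'rV[R]_l -> R) : smooth_near 0 (closure D) g ->
  exists M, forall x, closure D x -> `|g x| <= M.
Proof. by apply: compact_smooth_bounded; exact: closure_compact. Qed.

Lemma smooth_near_measurable (g : 'rV[R]_l -> R) : smooth_near 0 D g ->
  measurable_fun D g.
Proof.
by move=> [U [oU DU [cg _]]]; apply: continuous_measurable_rV DU _ cg.
Qed.

Lemma bounded_integrable (g : 'rV[R]_l -> R) (M : R) : measurable_fun D g ->
  (forall x, D x -> `|g x| <= M) -> (leb l).-integrable D (EFin \o g).
Proof.
move=> mg gM; apply: measurable_bounded_integrable => //.
  exact: leb_bounded_lty.
exists M; split; first exact: num_real.
by move=> y My x Dx; exact: le_trans (gM x Dx) (ltW My).
Qed.

Lemma smooth_near_integrable (g : 'rV[R]_l -> R) : smooth_near 0 (closure D) g ->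
  (leb l).-integrable D (EFin \o g).
Proof.
move=> Cg; have [M gM] := smooth_near_bounded Cg.
apply: (@bounded_integrable _ M) => [|x Dx]; last exact/gM/subset_closure.
by apply: smooth_near_measurable; exact: smooth_near_sub (@subset_closure _ D) _.
Qed.

Lemma smooth_near_Rintegral_sum I (s : seq I) (P : pred I) (F : I -> 'rV[R]_l -> R) :
  (forall i, P i -> smooth_near 0 (closure D) (F i)) ->
  \int[leb l]_(x in D) (\sum_(i <- s | P i) F i x) =
  \sum_(i <- s | P i) \int[leb l]_(x in D) F i x.
Proof.
move=> CF; elim: s => [|i s IH].
  rewrite big_nil.
  under eq_Rintegral do rewrite big_nil.
  by rewrite Rintegral_cst// mul0r.
rewrite big_cons; case: (boolP (P i)) => Pi.
  rewrite -IH -RintegralD//; last 2 first.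
  - by apply: smooth_near_integrable; exact: CF.
  - by apply: smooth_near_integrable; exact: smooth_near_sum.
  by apply: eq_Rintegral => x _; rewrite big_cons Pi.
by rewrite -IH; apply: eq_Rintegral => x _; rewrite big_cons (negbTE Pi).
Qed.

Local Notation ST := ([set: R] `*` closure D).

(** A compact time interval times the closure of the domain is compact; this
    provides the dominating constants below. *)
Let time_bound (g : R -> 'rV[R]_l -> R) (t : R) : smooth_near 0 ST (uncurried g) ->
  exists2 M : R, 0 <= M & forall (s : R) x, `]t - 1, t + 1[%classic s -> D x -> `|g s x| <= M.
Proof.
move=> Cg.
have cK : compact ([set` `[t - 1, t + 1]] `*` closure D).
  by apply: compact_setX; [exact: segment_compact|exact: closure_compact].
have sub : [set` `[t - 1, t + 1]] `*` closure D `<=` ST by move=> z [].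
have [M MP] := compact_smooth_bounded cK (smooth_near_sub sub Cg).
exists (Num.max 0 M); first by rewrite le_max lexx.
move=> s x ts Dx; rewrite le_max; apply/orP; right.
apply: (MP (s, x)); split => /=; last exact: subset_closure.
exact: subset_itv_oo_cc ts.
Qed.

Lemma slice_smooth q (g : R -> 'rV[R]_l -> R) t : smooth_near q ST (uncurried g) ->
  smooth_near q (closure D) (g t).
Proof.
move=> Cg.
apply: (@smooth_near_comp_affine _ _ _ (fun h => (0, h) : R * 'rV[R]_l)
  (fun y => (t, y)) q ST _ (uncurried g)) => //.
- exact: slice_continuous.
- by move=> x v h; congr pair; rewrite /= scaler0 add0r.
Qed.

Let slice_time_continuous (x : 'rV[R]_l) : continuous (fun s : R => (s, x)).
Proof.
move=> s; apply: (@cvg_pair _ _ _ (nbhs s) (nbhs s) (nbhs x)).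
  exact: cvg_id.
exact: cvg_cst.
Qed.

Lemma Rintegral_time_continuous (g : R -> 'rV[R]_l -> R) :
  smooth_near 0 ST (uncurried g) ->
  continuous (fun t => \int[leb l]_(x in D) g t x).
Proof.
move=> Cg t; have [M M0 MP] := time_bound t Cg.
have tI : t \in (`]t - 1, t + 1[%classic : set R).
  by rewrite inE /= in_itv /= ltrBlDr ltrDl ltr01.
apply: (continuity_under_integral mD _ _ _ _ tI (g := cst M)).
- by move=> s _; apply: smooth_near_integrable; exact: slice_smooth.
- apply: aeW => x Dx s _.
  apply: (@continuous_comp _ _ _ (fun s => (s, x)) (uncurried g)).
    exact: slice_time_continuous.
  by apply: smooth_near_cont Cg _; split => //; exact: subset_closure.
- by apply: (@bounded_integrable _ M) => // x _; rewrite ger0_norm.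
- by move=> s ts; apply: aeW => x Dx; exact: MP.
Qed.

(** In space the densities are only asked to be continuous: those of the kinetic
    energy are no smoother than the mass density. *)
Lemma is_derive_Rintegral_time (g dg : R -> 'rV[R]_l -> R) (t : R) :
  smooth_near 0 ST (uncurried g) -> smooth_near 0 ST (uncurried dg) ->
  (forall (s : R) x, D x -> is_derive s (1 : R) (g ^~ x) (dg s x)) ->
  is_derive t (1 : R) (fun s => \int[leb l]_(x in D) g s x)
    (\int[leb l]_(x in D) dg t x).
Proof.
move=> Cg Cdg dgP; have [M M0 MP] := time_bound t Cdg.
have dE s x : D x -> partial1of2 g s x = dg s x.
  by move=> Dx; rewrite partial1of2E; have [_ ->] := dgP s x Dx.
have tI : `]t - 1, t + 1[%classic t.
  by rewrite /= in_itv /= ltrBlDr ltrDl ltr01.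
have intg s : `]t - 1, t + 1[%classic s -> (leb l).-integrable D (EFin \o g s).
  by move=> _; apply: smooth_near_integrable; exact: slice_smooth.
have der s x : `]t - 1, t + 1[%classic s -> D x -> derivable (g^~ x) s 1.
  by move=> _ Dx; have [] := dgP s x Dx.
have iM : (leb l).-integrable D (EFin \o cst M).
  by apply: (@bounded_integrable _ M) => // x _; rewrite ger0_norm.
have dM s x : `]t - 1, t + 1[%classic s -> D x -> `|partial1of2 g s x| <= M.
  by move=> ts Dx; rewrite dE//; exact: MP.
split; first exact: (derivable_under_integral mD tI intg der (fun=> M0) iM dM).
rewrite -derive1E (differentiation_under_integral mD tI intg der (fun=> M0) iM dM).
by apply: eq_Rintegral => x /set_mem Dx; exact: dE.
Qed.

End domain.
End rV_measure.

(** * The dot product *)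

Section dot_theory.
Context {R : realType}.

Lemma dotE a (v w : 'cV[R]_a) : dot v w = \sum_i v i 0 * w i 0.
Proof. by rewrite /dot mxE; apply: eq_bigr => i _; rewrite mxE. Qed.

Lemma dotC a (v w : 'cV[R]_a) : dot v w = dot w v.
Proof. by rewrite !dotE; apply: eq_bigr => i _; rewrite mulrC. Qed.

Lemma dotDr a (v w w' : 'cV[R]_a) : dot v (w + w') = dot v w + dot v w'.
Proof. by rewrite /dot mulmxDr mxE. Qed.

Lemma dotDl a (v v' w : 'cV[R]_a) : dot (v + v') w = dot v w + dot v' w.
Proof. by rewrite dotC dotDr !(dotC w). Qed.

Lemma dotZr a (c : R) (v w : 'cV[R]_a) : dot v (c *: w) = c * dot v w.
Proof. by rewrite /dot -scalemxAr mxE. Qed.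

Lemma dotZl a (c : R) (v w : 'cV[R]_a) : dot (c *: v) w = c * dot v w.
Proof. by rewrite dotC dotZr dotC. Qed.

Lemma dot0r a (v : 'cV[R]_a) : dot v 0 = 0.
Proof. by rewrite /dot mulmx0 mxE. Qed.

Lemma dot0l a (v : 'cV[R]_a) : dot 0 v = 0.
Proof. by rewrite dotC dot0r. Qed.

Lemma dotNr a (v w : 'cV[R]_a) : dot v (- w) = - dot v w.
Proof. by rewrite -scaleN1r dotZr mulN1r. Qed.

Lemma dotNl a (v w : 'cV[R]_a) : dot (- v) w = - dot v w.
Proof. by rewrite dotC dotNr dotC. Qed.

Lemma dot_sumr a I (s : seq I) (Q : pred I) (v : 'cV[R]_a) F :
  dot v (\sum_(i <- s | Q i) F i) = \sum_(i <- s | Q i) dot v (F i).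
Proof. by rewrite (big_morph (dot v) (dotDr v) (dot0r v)). Qed.

Lemma dot_suml a I (s : seq I) (Q : pred I) (v : 'cV[R]_a) F :
  dot (\sum_(i <- s | Q i) F i) v = \sum_(i <- s | Q i) dot (F i) v.
Proof. by rewrite dotC dot_sumr; apply: eq_bigr => i _; rewrite dotC. Qed.

Lemma dot_mulmx a b (M : 'M[R]_(a, b)) v w : dot (M *m v) w = dot v (M^T *m w).
Proof. by rewrite /dot trmx_mul mulmxA. Qed.

Lemma dot_mxcol p (p_ : 'I_p -> nat) (v w : forall i, 'cV[R]_(p_ i)) :
  dot (\mxcol_i v i) (\mxcol_i w i) = \sum_i dot (v i) (w i).
Proof. by rewrite /dot tr_mxcol mul_mxrow_mxcol summxE. Qed.

Lemma dot_col_mx a b (v v' : 'cV[R]_a) (w w' : 'cV[R]_b) :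
  dot (col_mx v w) (col_mx v' w') = dot v v' + dot w w'.
Proof. by rewrite /dot tr_col_mx mul_row_col mxE. Qed.

Lemma derive_dot l a b A (k : 'I_l) (M : 'M[R]_(b, a)) (f : 'rV[R]_l -> 'cV[R]_b)
    (g : 'rV[R]_l -> 'cV[R]_a) x :
  field_Cq 1 A f -> field_Cq 1 A g -> A x ->
  'D_(delta_mx 0 k) (fun y => dot (f y) (M *m g y)) x =
  dot (dpart k f x) (M *m g x) + dot (f x) (M *m dpart k g x).
Proof.
move=> Cf Cg Ax.
have -> : (fun y => dot (f y) (M *m g y)) =
    (fun y => \sum_i \sum_j f y i 0 * (M i j * g y j 0)).
  apply/funext => y; rewrite dotE; apply: eq_bigr => i _.
  by rewrite mxE mulr_sumr.
have -> : dot (dpart k f x) (M *m g x) + dot (f x) (M *m dpart k g x) =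
    \sum_i \sum_j (f x i 0 * (M i j * dpart k g x j 0) +
                   M i j * g x j 0 * dpart k f x i 0).
  rewrite !dotE -big_split /=; apply: eq_bigr => i _.
  rewrite [(M *m g x) i 0]mxE [(M *m dpart k g x) i 0]mxE !mulr_sumr -big_split /=.
  by apply: eq_bigr => j _; ring.
apply: derive_val; apply: is_derive_bigsum => i _; apply: is_derive_bigsum => j _.
have df := smooth_near_derivable (v := delta_mx 0 k) (Cf i 0) Ax.
have dg := smooth_near_derivable (v := delta_mx 0 k) (Cg j 0) Ax.
have := is_deriveM (derivableP df) (is_deriveZ (M i j) (derivableP dg)).
by rewrite !mxE.
Qed.

End dot_theory.

(** * Integration by parts *)

Section boundary_form.
Context {R : realType} {l m n : nat} (N : nat).
Variables (P0 : 'M[R]_(m, n)) (P : 'I_l -> nat -> 'M[R]_(m, n)).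

(** The index [i] is the order of the term of the operator, [j - 1] the number of
    its derivatives that act on [v]. *)
Definition flux (w : 'rV[R]_l -> 'cV[R]_n) (v : 'rV[R]_l -> 'cV[R]_m)
    (k : 'I_l) (i j : nat) (x : 'rV[R]_l) : R :=
  dot (dpartn (i - j) k w x) ((P k i)^T *m dpartn (j - 1) k v x).

Lemma flux_smooth (A : set 'rV[R]_l) w v k i j :
  field_Cq N A w -> field_Cq N A v -> (i <= N)%N -> (1 <= j <= i)%N ->
  smooth_near 1 A (flux w v k i j).
Proof.
move=> Cw Cv iN /andP[j1 ji]; apply: smooth_near_dot.
  apply: dpartn_Cq Cw; rewrite (leq_trans _ iN)//.
  by rewrite add1n ltn_subrL j1 (leq_trans j1 ji).
apply: field_Cq_mul; first exact: field_Cq_cst.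
by apply: dpartn_Cq Cv; rewrite subnKC// (leq_trans ji).
Qed.

(** Integrating by parts one derivative at a time: the sum over [j] telescopes
    between all derivatives falling on [w] and all of them falling on [v]. *)
Lemma adjoint_defect (A : set 'rV[R]_l) w v x :
  field_Cq N A w -> field_Cq N A v -> A x ->
  dot (diffop N P0 P w x) (v x) - dot (w x) (diffop_adj N P0 P v x) =
  \sum_(k < l) \sum_(1 <= i < N.+1) \sum_(1 <= j < i.+1)
    (-1) ^+ (j - 1) * 'D_(delta_mx 0 k) (flux w v k i j) x.
Proof.
move=> Cw Cv Ax; rewrite /diffop /diffop_adj dotDl dotDr dot_mulmx.
rewrite opprD addrACA subrr add0r dot_suml dot_sumr -sumrB.
apply: eq_bigr => k _; rewrite dot_suml dot_sumr -sumrB.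
apply: eq_big_nat => i /andP[i1 iN].
pose a j := (-1) ^+ j * dot (dpartn (i - j) k w x) ((P k i)^T *m dpartn j k v x).
transitivity (\sum_(0 <= j < i) - (a j.+1 - a j)).
  rewrite sumrN telescope_sumr// opprB /a subn0 expr0 mul1r subnn.
  by rewrite dot_mulmx dotZr.
rewrite big_add1 /=; apply: eq_big_nat => j /andP[_ ji].
rewrite subn1 /= opprB /a.
have sij : (i - j = (i - j.+1).+1)%N by rewrite subnSK.
rewrite /flux subn1 /= (derive_dot (A := A)); last 3 first.
- by apply: dpartn_Cq Cw; rewrite add1n -sij (leq_trans (leq_subr _ _)).
- by apply: dpartn_Cq Cv; rewrite add1n (leq_trans ji).
- by [].
have dS c h (f : 'rV[R]_l -> 'cV[R]_c) : dpart k (dpartn h k f) = dpartn h.+1 k f by [].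
rewrite !dS -sij.
by rewrite exprS mulN1r mulNr opprK mulrDr.
Qed.

Definition boundary_form (w : 'rV[R]_l -> 'cV[R]_n) (v : 'rV[R]_l -> 'cV[R]_m)
    (nu s : 'rV[R]_l) : R :=
  \sum_(k < l) \sum_(1 <= i < N.+1) \sum_(1 <= j < i.+1)
    (-1) ^+ (j - 1) * (flux w v k i j s * nu 0 k).

(** Summation over the triangle [a + b < N] along its antidiagonals. *)
Let triangle_sum (F : nat -> nat -> R) :
  \sum_(0 <= a < N) \sum_(0 <= b < N - a) F a b =
  \sum_(1 <= i < N.+1) \sum_(1 <= j < i.+1) F (i - j)%N (j - 1)%N.
Proof.
elim: N => [|M IH]; first by rewrite !big_geq.
rewrite [RHS]big_nat_recr //= -IH.
transitivity (\sum_(0 <= a < M.+1) (\sum_(0 <= b < M - a) F a b + F a (M - a)%N)).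
  apply: eq_big_nat => a /andP[_ aM].
  by rewrite subSn// big_nat_recr.
rewrite big_split /=; congr (_ + _).
  by rewrite big_nat_recr //= subnn [X in _ + X = _]big_geq// addr0.
rewrite big_nat_rev big_add1 /=; apply: eq_big_nat => j /andP[_ jM].
by rewrite add0n !subSS subKn// subn0.
Qed.

(** The block [(a, b)] pairs the derivatives of order [a] of [w] and of order [b]
    of [v] along the same axis; it holds the flux term [i = a + b + 1],
    [j = b + 1]. *)
Lemma boundary_matrixE w v (nu s : 'rV[R]_l) :
  dot (jet N w s) (Qbdry N P nu *m jet N v s) = boundary_form w v nu s.
Proof.
pose T a b := (-1) ^+ b * \sum_(k < l)
  dot (dpartn a k w s) (bterm P nu k (a + b + 1) *m dpartn b k v s).
have blockE (a b : 'I_N) :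
    dot (jet_block w s a) (Qblock N P nu a b *m jet_block v s b) =
    if (a + b < N)%N then T a b else 0.
  rewrite /T; case: a b => [[|a] ha] [[|b] hb] /=.
  - rewrite ha expr0 mul1r mulmx_suml dot_sumr.
    by apply: eq_bigr => k _.
  - rewrite hb -scalemxAl dotZr /Wrow mul_mxrow_mxcol dot_sumr; congr (_ * _).
    by apply: eq_bigr => k _; rewrite add0n addn1.
  - rewrite addn0 ha expr0 mul1r /Vcol mxcol_mul dot_mxcol.
    by apply: eq_bigr => k _; rewrite addn1.
  - rewrite addn1; case: ifP => _; last by rewrite mul0mx dot0r.
    rewrite -scalemxAl dotZr /Ldiag mul_mxblock_mxrow dot_mxcol; congr (_ * _).
    apply: eq_bigr => k _; rewrite (bigD1 k)//= eqxx big1 ?addr0 ?addn1// => j jk.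
    by rewrite eq_sym (negbTE jk) mul0mx.
rewrite /jet /Qbdry mul_mxblock_mxrow dot_mxcol.
transitivity (\sum_(0 <= a < N) \sum_(0 <= b < N - a) T a b).
  rewrite big_mkord; apply: eq_bigr => a _; rewrite dot_sumr.
  rewrite (big_nat_widen _ _ N) ?leq_subr// big_mkord [RHS]big_mkcond /=.
  by apply: eq_bigr => b _; rewrite blockE ltn_subRL.
rewrite triangle_sum /boundary_form [RHS]exchange_big; apply: eq_bigr => i _ /=.
rewrite exchange_big; apply: eq_big_nat => j /andP[j1 ji].
rewrite /T mulr_sumr; apply: eq_bigr => k _; congr (_ * _).
rewrite /bterm -scalemxAl dotZr mulrC /flux.
by rewrite -addnA subn1 addn1 prednK// subnK.
Qed.

End boundary_form.

Section divergence.
Context {R : realType} {l : nat} (D : set 'rV[R]_l).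
Hypotheses (oD : open D) (bD : bounded_set D).
Variables (mu : {measure set 'rV[R]_l -> \bar R}) (nu : 'rV[R]_l -> 'rV[R]_l).
Hypothesis dvg : forall phi : 'rV[R]_l -> 'cV[R]_l,
  field_Cq 1 (closure D) phi ->
  \int[leb l]_(x in D) (\sum_(k < l) dpart k phi x k 0) =
  \int[mu]_(s in boundary D) (\sum_(k < l) phi s k 0 * nu s 0 k).

Lemma divergence_sum (g : 'I_l -> 'rV[R]_l -> R) :
  (forall k, smooth_near 1 (closure D) (g k)) ->
  \int[leb l]_(x in D) (\sum_(k < l) 'D_(delta_mx 0 k) (g k) x) =
  \int[mu]_(s in boundary D) (\sum_(k < l) g k s * nu s 0 k).
Proof.
move=> Cg; pose phi x : 'cV[R]_l := \col_k g k x.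
transitivity (\int[leb l]_(x in D) (\sum_(k < l) dpart k phi x k 0)).
  apply: eq_Rintegral => x _; apply: eq_bigr => k _; rewrite [RHS]mxE.
  by apply: eq_derive => y; rewrite mxE.
rewrite dvg; last first.
  by move=> k j; apply: eq_smooth_near (Cg k) => x; rewrite mxE.
by apply: eq_Rintegral => s _; apply: eq_bigr => k _; rewrite mxE.
Qed.

(** The boundary terms of the expanded power balance come one axis and one order
    at a time, hence the case of a field directed along one axis. *)
Lemma divergence_component k (g : 'rV[R]_l -> R) :
  smooth_near 1 (closure D) g ->
  \int[leb l]_(x in D) 'D_(delta_mx 0 k) g x =
  \int[mu]_(s in boundary D) (g s * nu s 0 k).
Proof.
move=> Cg; pose G k' : 'rV[R]_l -> R := if k' == k then g else fun=> 0.
have := @divergence_sum G; set a := Rintegral _ _ _; set b := Rintegral _ _ _.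
move=> ab; transitivity a.
  apply: eq_Rintegral => x _; rewrite (bigD1 k)//= /G eqxx big1 ?addr0// => j jk.
  by rewrite (negbTE jk); exact: derive_cst.
rewrite ab; last first.
  move=> j; rewrite /G; case: ifP => _; first exact: Cg.
  exact: smooth_near_cst.
apply: eq_Rintegral => s _; rewrite (bigD1 k)//= /G eqxx big1 ?addr0// => j jk.
by rewrite (negbTE jk) mul0r.
Qed.

Section by_parts.
Context {m n : nat} (N : nat).
Variables (P0 : 'M[R]_(m, n)) (P : 'I_l -> nat -> 'M[R]_(m, n)).
Variables (w : 'rV[R]_l -> 'cV[R]_n) (v : 'rV[R]_l -> 'cV[R]_m).
Hypotheses (Cw : field_Cq N (closure D) w) (Cv : field_Cq N (closure D) v).

Let smooth_Fw : smooth_near 0 (closure D) (fun x => dot (diffop N P0 P w x) (v x)).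
Proof.
apply: smooth_near_dot; first exact: diffop_Cq Cw.
exact: field_Cq_le Cv.
Qed.

Let smooth_Fv : smooth_near 0 (closure D) (fun x => dot (w x) (diffop_adj N P0 P v x)).
Proof.
apply: smooth_near_dot; last exact: diffop_adj_Cq Cv.
exact: field_Cq_le Cw.
Qed.

Let defect_integral :
  \int[leb l]_(x in D) dot (diffop N P0 P w x) (v x) =
  \int[leb l]_(x in D) dot (w x) (diffop_adj N P0 P v x) +
  \int[leb l]_(x in D) (\sum_(k < l) \sum_(1 <= i < N.+1) \sum_(1 <= j < i.+1)
    (-1) ^+ (j - 1) * 'D_(delta_mx 0 k) (flux P w v k i j) x).
Proof.
apply/eqP; rewrite addrC -subr_eq; apply/eqP.
rewrite -RintegralB//; last 3 first.
- exact: open_measurable_rV.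
- exact: smooth_near_integrable.
- exact: smooth_near_integrable.
apply: eq_Rintegral => x /set_mem Dx.
by rewrite (adjoint_defect P0 P Cw Cv)//; exact: subset_closure.
Qed.

Let flux_smooth_ij k i j : (1 <= i < N.+1)%N -> (1 <= j < i.+1)%N ->
  smooth_near 1 (closure D) (flux P w v k i j).
Proof. by move=> /andP[_ iN] ij; exact: flux_smooth. Qed.

Lemma by_parts_form :
  \int[leb l]_(x in D) dot (diffop N P0 P w x) (v x) =
  \int[leb l]_(x in D) dot (w x) (diffop_adj N P0 P v x) +
  \int[mu]_(s in boundary D) boundary_form N P w v (nu s) s.
Proof.
rewrite defect_integral; congr (_ + _).
pose G k x := \sum_(1 <= i < N.+1 | (1 <= i < N.+1)%N && true)
  \sum_(1 <= j < i.+1 | (1 <= j < i.+1)%N && true) (-1) ^+ (j - 1) * flux P w v k i j x.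
have CG k : smooth_near 1 (closure D) (G k).
  apply: smooth_near_sum => i /andP[iN _]; apply: smooth_near_sum => j /andP[ij _].
  apply: smooth_near_mul; first exact: smooth_near_cst.
  exact: flux_smooth_ij.
have := divergence_sum CG; set a := Rintegral _ _ _; set b := Rintegral _ _ _ => ab.
transitivity a.
  apply: eq_Rintegral => x /set_mem Dx; apply: eq_bigr => k _.
  apply/esym; apply: derive_val.
  rewrite [X in is_derive _ _ _ X]big_nat_cond.
  apply: is_derive_bigsum => i /andP[iN _].
  rewrite [X in is_derive _ _ _ X]big_nat_cond.
  apply: is_derive_bigsum => j /andP[ij _].
  apply: is_deriveZ; apply: derivableP.
  by apply: smooth_near_derivable (flux_smooth_ij k iN ij) _; exact: subset_closure.
rewrite ab; apply: eq_Rintegral => s _; rewrite /boundary_form; apply: eq_bigr => k _.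
rewrite /G mulr_suml [RHS]big_nat_cond; apply: eq_bigr => i _.
rewrite mulr_suml [RHS]big_nat_cond; apply: eq_bigr => j _.
by rewrite mulrA.
Qed.

Lemma by_parts_expanded :
  \int[leb l]_(x in D) dot (diffop N P0 P w x) (v x) =
  \int[leb l]_(x in D) dot (w x) (diffop_adj N P0 P v x) +
  \sum_(k < l) \sum_(1 <= i < N.+1) \sum_(1 <= j < i.+1)
    (-1) ^+ (j - 1) * \int[mu]_(s in boundary D)
      dot (dpartn (i - j) k w s) ((nu s 0 k *: (P k i)^T) *m dpartn (j - 1) k v s).
Proof.
rewrite defect_integral; congr (_ + _).
have Cd k i j : (1 <= i < N.+1)%N && true -> (1 <= j < i.+1)%N && true ->
    smooth_near 0 (closure D)
      (fun x => (-1) ^+ (j - 1) * 'D_(delta_mx 0 k) (flux P w v k i j) x).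
  move=> /andP[iN _] /andP[ij _].
  apply: smooth_near_mul; first exact: smooth_near_cst.
  by apply: smooth_near_derive; exact: flux_smooth_ij.
transitivity (\int[leb l]_(x in D) (\sum_(k < l)
  \sum_(1 <= i < N.+1 | (1 <= i < N.+1)%N && true)
  \sum_(1 <= j < i.+1 | (1 <= j < i.+1)%N && true)
    (-1) ^+ (j - 1) * 'D_(delta_mx 0 k) (flux P w v k i j) x)).
  apply: eq_Rintegral => x _; apply: eq_bigr => k _.
  rewrite big_nat_cond; apply: eq_bigr => i _; exact: big_nat_cond.
rewrite smooth_near_Rintegral_sum//; last first.
  move=> k _; apply: smooth_near_sum => i iN; apply: smooth_near_sum => j ij.
  exact: Cd.
apply: eq_bigr => k _; rewrite smooth_near_Rintegral_sum//; last first.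
  by move=> i iN; apply: smooth_near_sum => j ij; exact: Cd.
rewrite [RHS]big_nat_cond; apply: eq_bigr => i iN.
rewrite smooth_near_Rintegral_sum//; last by move=> j ij; exact: Cd.
rewrite [RHS]big_nat_cond; apply: eq_bigr => j ij.
have Cf : smooth_near 1 (closure D) (flux P w v k i j).
  by case/andP: iN => iN _; case/andP: ij => ij _; exact: flux_smooth_ij.
rewrite RintegralZl; last 2 first.
- exact: open_measurable_rV.
- by apply: smooth_near_integrable => //; exact: smooth_near_derive.
congr (_ * _); rewrite divergence_component//.
apply: eq_Rintegral => s _.
by rewrite -scalemxAl dotZr mulrC.
Qed.

(** A compactly supported factor kills the boundary terms, together with its
    derivatives, which vanish near the boundary. *)
Lemma by_parts_compact (A : set 'rV[R]_l) : compact A -> A `<=` D ->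
  (forall x, ~ A x -> w x = 0) \/ (forall x, ~ A x -> v x = 0) ->
  \int[leb l]_(x in D) dot (diffop N P0 P w x) (v x) =
  \int[leb l]_(x in D) dot (w x) (diffop_adj N P0 P v x).
Proof.
move=> cA AD wv0; rewrite by_parts_form.
suff -> : \int[mu]_(s in boundary D) boundary_form N P w v (nu s) s =
    \int[mu]_(s in boundary D) 0.
  by rewrite /Rintegral integral0 addr0.
apply: eq_Rintegral => s /set_mem[_ Ds].
have As : ~ A s by move=> /AD Ds'; apply: Ds; exact: open_nbhs_nbhs (conj oD Ds').
have oA : open (~` A) by apply: closed_openC; exact: compact_closed.
have dpartn0 a i k (f : 'rV[R]_l -> 'cV[R]_a) : (forall x, ~ A x -> f x = 0) ->
    dpartn i k f s = 0.
  move=> f0; rewrite (@dpartn_ext _ _ _ _ i k f (fun=> 0) s oA)//.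
  have -> : dpartn i k (fun=> 0) = (fun=> 0) :> ('rV[R]_l -> 'cV[R]_a).
    elim: i => [//|i IH]; rewrite /dpartn iterS -/(dpartn i k _) IH.
    by apply/funext => x; apply/colP => j; rewrite mxE; under [fun _ => _]eq_fun do rewrite mxE; rewrite derive_cst mxE.
  by [].
rewrite /boundary_form big1 // => k _; rewrite big1 // => i _; rewrite big1 // => j _.
case: wv0 => f0; rewrite /flux (dpartn0 _ _ _ _ f0).
  by rewrite dot0l mul0r mulr0.
by rewrite mulmx0 dot0r mul0r mulr0.
Qed.

End by_parts.
End divergence.

(** * Bump functions *)

Section flat_functions.
Context {R : realType}.

(** The function [exp (- 1 / x)], extended by [0] to the left half-line, has all
    its derivatives of this form: the family is closed under derivation. *)
Definition flat (p : {poly R}) (x : R) : R :=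
  if 0 < x then p.[x^-1] * expR (- x^-1) else 0.

(** A single term of the exponential series gives the bound. *)
Let monomial_decay n (y : R) : 0 < y ->
  y ^+ n * expR (- y) <= (n.+1)`!%:R * y^-1.
Proof.
move=> y0; rewrite ler_pdivlMr// mulrAC -exprSr expRN ler_pdivrMr ?expR_gt0//.
rewrite mulrC -ler_pdivrMr ?ltr0n ?fact_gt0//.
by apply: le_trans (expR_ge1Dxn n (ltW y0)); rewrite lerDr.
Qed.

(** Applied to ['X * p], whose flat function is the difference quotient of
    [flat p] at [0], the bound shows that the derivative there is [0]. *)
Let flat_small p : exists2 C : R, 0 <= C & forall x, `|flat p x| <= C * `|x|.
Proof.
exists (\sum_(i < size p) `|p`_i| * (i.+1)`!%:R).
  by apply: sumr_ge0 => i _; rewrite mulr_ge0.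
move=> x; rewrite /flat; case: ifPn => [x0|_]; last first.
  by rewrite normr0 mulr_ge0// sumr_ge0// => i _; rewrite mulr_ge0.
rewrite (gtr0_norm x0) horner_coef mulr_suml (le_trans (ler_norm_sum _ _ _))//.
rewrite mulr_suml ler_sum// => i _.
have y0 : 0 < x^-1 by rewrite invr_gt0.
rewrite -mulrA normrM -mulrA ler_wpM2l// gtr0_norm.
  by rewrite -[x in leRHS]invrK; exact: monomial_decay.
by rewrite mulr_gt0 ?exprn_gt0 ?expR_gt0.
Qed.

Lemma is_derive_flat (p : {poly R}) (x : R) :
  is_derive x 1 (flat p) (flat ('X^2 * (p - p^`())) x).
Proof.
have [x0|x0|x0] := ltgtP 0 x.
- have := @is_deriveV R id x 1 1 (lt0r_neq0 x0) (is_derive_id _ _).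
  rewrite /= => dV.
  have dp := is_derive1_comp (is_derive_poly p x^-1) dV.
  have dN : is_derive x 1 (fun y => - y^-1) _ := is_deriveN dV.
  have de := @is_derive1_comp R expR (fun y => - y^-1) x _ _
    (is_derive_expR (- x^-1)) dN.
  have dpe := is_deriveM dp de.
  rewrite /flat x0.
  apply: near_eq_is_derive (is_derive_eq dpe _).
    near=> y; rewrite /flat ifT//; near: y; exact: lt_nbhsr.
  rewrite !hornerE /= exprVn -[_ *: 1]mulr1; set e := expR _; set i2 := (x ^+ 2)^-1.
  rewrite /GRing.scale /=; ring.
- rewrite /flat ltNge (ltW x0) /=.
  apply: near_eq_is_derive (is_derive_cst 0 x 1).
  near=> y; rewrite ifF//; apply/negbTE; rewrite -leNgt ltW//.
  by near: y; exact: lt_nbhsl.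
- rewrite -x0 {2}/flat ltxx.
  have [C C0 CP] := flat_small p.
  have lim0 : h^-1 *: (flat p (h *: 1 + 0) - flat p 0) @[h --> 0^'] --> (0 : R).
    have [D D0 DP] := flat_small ('X * p).
    apply/cvgrPdist_le => e e0; near=> h.
    have -> : h^-1 *: (flat p (h *: 1 + 0) - flat p 0) = flat ('X * p) h.
      rewrite addr0 -[h *: 1]/(h * 1) mulr1 {2}/flat ltxx subr0 /flat.
      by case: ifP => _; rewrite ?scaler0// hornerM hornerX -mulrA.
    rewrite sub0r normrN (le_trans (DP h))//.
    have hD : `|h| <= e / (D + 1).
      by near: h; apply: dnbhs0_le; rewrite divr_gt0// ltr_wpDl.
    rewrite (le_trans (ler_wpM2l D0 hD))// mulrCA ger_pMr// ler_pdivrMr ?ltr_wpDl//.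
    by rewrite mul1r lerDl.
  by split; [apply/cvg_ex; exists 0|exact/cvg_lim].
Unshelve. all: by end_near. Qed.

Lemma is_derive_dir (f : R -> R) (x v df : R) :
  is_derive x 1 f df -> is_derive x v f (v * df).
Proof.
move=> [/derivable1_diffP df1 <-].
split; first exact: diff_derivable.
by rewrite !deriveE// -[in LHS](mulr1 v) -[v * 1]/(v *: (1 : R)) linearZ.
Qed.

Lemma flat_Cq q (p : {poly R}) : Cq q setT (flat p).
Proof.
have cf (r : {poly R}) x : {for x, continuous (flat r)}.
  apply/differentiable_continuous/derivable1_diffP.
  by have [] := is_derive_flat r x.
elim: q p => [|q IH] p; first by split.
split => // v; split=> [x _|].
  by have [] := is_derive_dir v (is_derive_flat p x).
have -> : 'D_v (flat p) = fun x => v * flat ('X^2 * (p - p^`())) x.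
  by apply/funext => x; have [_ ->] := is_derive_dir v (is_derive_flat p x).
by apply: Cq_mul; [exact: openT|exact: Cq_cst|exact: IH].
Qed.

Definition bump1 (a b x : R) : R := flat 1 (x - a) * flat 1 (b - x).

Lemma flat1_gt0 (x : R) : 0 < x -> 0 < flat 1 x.
Proof. by move=> x0; rewrite /flat x0 hornerE mul1r expR_gt0. Qed.

Lemma bump1_gt0 a b x : a < x < b -> 0 < bump1 a b x.
Proof. by move=> /andP[ax xb]; rewrite mulr_gt0// flat1_gt0// subr_gt0. Qed.

Lemma bump1_eq0 a b x : ~~ (a < x < b) -> bump1 a b x = 0.
Proof.
rewrite negb_and -!leNgt /bump1 /flat !subr_gt0 => /orP[ax|xb].
  by rewrite ltNge ax mul0r.
by rewrite [x < b]ltNge xb mulr0.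
Qed.

Lemma bump1_Cq q a b : Cq q setT (bump1 a b).
Proof.
apply: Cq_mul; first exact: openT.
  have := @Cq_comp_affine R R R id (fun x => x - a) q setT (flat 1).
  rewrite preimage_setT; apply => [x|x v h|]; [|by rewrite addrA|exact: flat_Cq].
  by apply: cvgB; [exact: cvg_id|exact: cvg_cst].
have := @Cq_comp_affine R R R -%R (fun x => b - x) q setT (flat 1).
rewrite preimage_setT; apply => [x|x v h|]; [| |exact: flat_Cq].
  by apply: cvgB; [exact: cvg_cst|exact: cvg_id].
by rewrite scalerN opprD addrCA.
Qed.

Section box_bump.
Context {l : nat}.

Definition box_bump (x0 : 'rV[R]_l) (e : R) (x : 'rV[R]_l) : R :=
  \prod_(i < l) bump1 (x0 0 i - e) (x0 0 i + e) (x 0 i).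

Let inside (x0 x : 'rV[R]_l) e i : (x0 0 i - e < x 0 i < x0 0 i + e) =
  (`|x0 0 i - x 0 i| < e).
Proof.
by rewrite ltr_distlC.
Qed.

Lemma box_bump_gt0 (x0 : 'rV[R]_l) (e : R) (x : 'rV[R]_l) : (forall i, `|x0 0 i - x 0 i| < e) -> 0 < box_bump x0 e x.
Proof. by move=> xe; apply: prodr_gt0 => i _; rewrite bump1_gt0// inside. Qed.

Lemma box_bump_eq0 (x0 : 'rV[R]_l) (e : R) (x : 'rV[R]_l) : ~ (forall i, `|x0 0 i - x 0 i| < e) -> box_bump x0 e x = 0.
Proof.
move=> xe; have {xe}[i xe] : exists i, ~~ (`|x0 0 i - x 0 i| < e).
  apply: contrapT => H; apply: xe => i; apply: contrapT => /negP xi.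
  by apply: H; exists i.
rewrite /box_bump (bigD1 i)//= bump1_eq0 ?mul0r//.
by rewrite inside.
Qed.

Lemma box_bump_ge0 (x0 : 'rV[R]_l) (e : R) (x : 'rV[R]_l) : 0 <= box_bump x0 e x.
Proof.
have [xe|xe] := pselect (forall i, `|x0 0 i - x 0 i| < e).
  exact/ltW/box_bump_gt0.
by rewrite box_bump_eq0.
Qed.

Lemma box_bump_Cq q (x0 : 'rV[R]_l) (e : R) : Cq q setT (box_bump x0 e).
Proof.
have -> : box_bump x0 e = fun x => \big[*%R/1]_(i <- enum 'I_l)
    bump1 (x0 0 i - e) (x0 0 i + e) (x 0 i).
  by apply/funext => x; rewrite /box_bump big_enum.
elim: (enum 'I_l) => [|i s IH].
  have -> : (fun x : 'rV[R]_l => \big[*%R/1]_(i <- [::])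
    bump1 (x0 0 i - e) (x0 0 i + e) (x 0 i)) = fun=> 1.
    by apply/funext => x; rewrite big_nil.
  exact: Cq_cst.
have -> : (fun x : 'rV[R]_l => \big[*%R/1]_(i <- i :: s)
    bump1 (x0 0 i - e) (x0 0 i + e) (x 0 i)) =
    (fun x => bump1 (x0 0 i - e) (x0 0 i + e) (x 0 i) * \big[*%R/1]_(i <- s)
    bump1 (x0 0 i - e) (x0 0 i + e) (x 0 i)).
  by apply/funext => x; rewrite big_cons.
apply: Cq_mul; [exact: openT| |exact: IH].
have := @Cq_comp_affine R R 'rV[R]_l (fun x => x 0 i) (fun x => x 0 i) q setT
  (bump1 (x0 0 i - e) (x0 0 i + e)).
rewrite preimage_setT; apply => [x|x v h|]; [|by rewrite !mxE|exact: bump1_Cq].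
exact: coord_continuous.
Qed.

End box_bump.
End flat_functions.

(** * The fundamental lemma of the calculus of variations *)

Section fundamental_lemma.
Context {R : realType}.

(** A nonnegative function with zero integral vanishes almost everywhere. *)
Lemma null_of_integral_eq0 d (T : measurableType d) (mu : {measure set T -> \bar R})
    (D B : set T) (f : T -> R) :
  measurable D -> measurable B -> B `<=` D -> mu.-integrable D (EFin \o f) ->
  (forall x, D x -> 0 <= f x) -> (forall x, B x -> 0 < f x) ->
  \int[mu]_(x in D) f x = 0 -> mu B = 0%E.
Proof.
move=> mD mB BD intf f0 fB if0.
have mf := measurable_int _ intf.
have /(ae_eq_integral_abs mu mD mf) : (\int[mu]_(x in D) `|(EFin \o f) x|)%E = 0%E.
  transitivity (\int[mu]_(x in D) (f x)%:E)%E.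
    apply: eq_integral => x /set_mem Dx /=.
    by rewrite ger0_norm// f0.
  by rewrite -[LHS]fineK ?[fine _]if0//; exact: integrable_fin_num.
move=> [N [mN N0 NP]].
apply: (subset_measure0 mB mN _ N0) => x Bx; apply: NP => /= /(_ (BD x Bx)).
by case => fx0; have := fB x Bx; rewrite fx0 ltxx.
Qed.

Definition cube l (x0 : 'rV[R]_l) (e : R) : set 'rV[R]_l :=
  [set x | forall i, `|x0 0 i - x 0 i| < e].

Lemma cube_ball l (x0 : 'rV[R]_l) (e : R) : 0 < e -> cube x0 e = ball x0 e.
Proof.
move=> e0; apply/seteqP; split => x /=.
  by move=> xe; split => // i j; rewrite [i]ord1 -ball_normE; exact: xe.
by case=> _ xe i; have := xe 0 i; rewrite -ball_normE.
Qed.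

(** The measure is built one coordinate at a time, and so is the cube. *)
Lemma leb_cube_gt0 l (x0 : 'rV[R]_l) (e : R) : 0 < e -> (0 < leb l (cube x0 e))%E.
Proof.
move=> e0; elim: l x0 => [|l IH] x0.
  by rewrite /= diracE mem_set ?lte01// => -[].
pose y0 : 'rV[R]_l := \row_j x0 0 (lift ord0 j).
pose J := [set` `]x0 0 ord0 - e, x0 0 ord0 + e[%R].
have -> : leb l.+1 (cube x0 e) = (@lebesgue_measure R \x leb l)%E (J `*` cube y0 e).
  rewrite /= /lebesgue_step /pushforward; congr (_ _).
  apply/seteqP; split => -[a v] /=.
    move=> H; split.
      have := H ord0; rewrite /cons_rV /= mxE unlift_none /=.
      by rewrite /J /= in_itv /= -ltr_distlC.
    by move=> i; have := H (lift ord0 i); rewrite /cons_rV /= mxE liftK /y0 mxE.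
  move=> [aJ Hv] i; rewrite /cons_rV /= mxE.
  case: (unliftP ord0 i) => [j ->|->] /=; first by have := Hv j; rewrite /y0 mxE.
  by move: aJ; rewrite /J /= in_itv /= -ltr_distlC.
rewrite product_measure1E; last 2 first.
- exact: measurable_itv.
- by rewrite cube_ball//; apply: open_measurable_rV; exact: ball_open.
have ab : x0 0 ord0 - e < x0 0 ord0 + e by rewrite ltrD2l gtrN.
have J0 : (0 < @lebesgue_measure R J)%E.
  by rewrite /J lebesgue_measure_itv /= lte_fin ab -EFinB lte_fin subr_gt0.
by apply: mule_gt0; [exact: J0|exact: IH].
Qed.

(** Near a point where [g] is positive, a bump [w] makes [g * w] nonnegative
    everywhere and positive on a cube, which has positive measure. *)
Lemma fundamental_rV l (D : set 'rV[R]_l) (g : 'rV[R]_l -> R) :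
  open D -> bounded_set D -> smooth_near 0 (closure D) g ->
  (forall (w : 'rV[R]_l -> R) A, (forall q, Cq q setT w) -> compact A -> A `<=` D ->
     (forall x, ~ A x -> w x = 0) -> \int[leb l]_(x in D) (g x * w x) = 0) ->
  forall x, D x -> g x = 0.
Proof.
move=> oD bD; have mD : measurable D by exact: open_measurable_rV.
suff pos h : smooth_near 0 (closure D) h ->
    (forall (w : 'rV[R]_l -> R) A, (forall q, Cq q setT w) -> compact A -> A `<=` D ->
     (forall x, ~ A x -> w x = 0) -> \int[leb l]_(x in D) (h x * w x) = 0) ->
    forall x, D x -> ~ (0 < h x).
  move=> Cg g0 x Dx; have [gx|gx|//] := ltgtP (g x) 0; last first.
    by case: (pos g Cg g0 x Dx).
  case: (pos (fun x => -1 * g x) _ _ x Dx); last by rewrite mulN1r oppr_gt0.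
    by apply: smooth_near_mul => //; exact: smooth_near_cst.
  move=> w A Cw cA AD wA.
  under eq_Rintegral do rewrite -mulrA.
  rewrite RintegralZl// ?(g0 w A)// ?mulr0//.
  apply: smooth_near_integrable => //; apply: smooth_near_mul => //.
  by exists setT; split => //; exact: openT.
move=> Ch h0 x0 Dx0 hx0.
have ch : {for x0, continuous h}.
  by apply: smooth_near_cont Ch _; exact: subset_closure.
have /nbhs_ballP[d /= d0 dP] : \forall y \near x0, D y /\ 0 < h y.
  near=> y; split; near: y; first exact: open_nbhs_nbhs.
  exact: (cvgr_gt (h x0) ch 0 hx0).
have d20 : 0 < d / 2 by rewrite divr_gt0.
pose A := [set x : 'rV[R]_l | forall i, `|x0 0 i - x 0 i| <= d / 2].
have Ad : A `<=` ball x0 d.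
  rewrite -cube_ball// => x Ax i; apply: le_lt_trans (Ax i) _.
  by rewrite ltr_pdivrMr// ltr_pMr// ltr1n.
have BA : cube x0 (d / 2) `<=` A by move=> x Bx i; exact/ltW/Bx.
have cA : compact A.
  apply: bounded_closed_compact.
    exists (`|x0| + d); split; first exact: num_real.
    move=> M dM x /Ad; rewrite -ball_normE /= => xd.
    rewrite (le_trans _ (ltW dM))// -[x](subrK x0) (le_trans (ler_normD _ _))//.
    by rewrite addrC lerD2l distrC ltW.
  have -> : A = \bigcap_(i in [set: 'I_l]) [set x | `|x0 0 i - x 0 i| <= d / 2].
    by apply/seteqP; split => x Ax i; [move=> _; exact: Ax|exact: Ax].
  apply: closed_bigI => i _.
  apply: (@closed_comp _ _ (fun x : 'rV[R]_l => `|x0 0 i - x 0 i|) [set y : R | y <= d / 2]).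
    move=> x _; apply: (@continuous_comp _ _ _ (fun x : 'rV[R]_l => x0 0 i - x 0 i)
      (fun y : R => `|y|)); last exact: norm_continuous.
    apply: (@continuousB _ _ _ (fun=> x0 0 i) (fun x : 'rV[R]_l => x 0 i)).
      exact: cst_continuous.
    exact: coord_continuous.
  exact: closed_le.
have AD : A `<=` D by move=> x /Ad/dP[].
have wA x : ~ A x -> box_bump x0 (d / 2) x = 0.
  by move=> nA; apply: box_bump_eq0 => /BA.
have := h0 _ A (fun q => box_bump_Cq q x0 (d / 2)) cA AD wA.
move/null_of_integral_eq0 => /(_ (cube x0 (d / 2))) => H.
have := leb_cube_gt0 x0 d20; rewrite H ?ltxx//.
- by rewrite cube_ball//; apply: open_measurable_rV; exact: ball_open.
- by move=> x /BA/AD.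
- apply: smooth_near_integrable => //; apply: smooth_near_mul => //.
  by exists setT; split => //; [exact: openT|exact: box_bump_Cq].
- move=> x Dx; have [xB|xB] := pselect (cube x0 (d / 2) x).
    rewrite mulr_ge0 ?box_bump_ge0//.
    by have /BA/Ad/dP[_ /ltW] := xB.
  by rewrite box_bump_eq0// mulr0.
- move=> x xB; rewrite mulr_gt0 ?box_bump_gt0//.
  by have /BA/Ad/dP[] := xB.
Unshelve. all: by end_near. Qed.

(** The same argument in time; the bumps stay away from the end points, where
    admissible variations vanish. *)
Lemma fundamental_itv (t1 t2 : R) (G : R -> R) : t1 < t2 -> continuous G ->
  (forall a b, t1 < a -> a < b -> b < t2 ->
    \int[lebesgue_measure]_(t in `[t1, t2]) (bump1 a b t * G t) = 0) ->
  forall t, t1 < t < t2 -> G t = 0.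
Proof.
move=> t12.
have intb (h : R -> R) a b : continuous h ->
    lebesgue_measure.-integrable `[t1, t2] (EFin \o (fun t => bump1 a b t * h t)).
  move=> ch; apply: continuous_compact_integrable; first exact: segment_compact.
  apply: continuous_subspaceT => t; apply: cvgM; last exact: ch.
  exact: (Cq_cont (bump1_Cq 0 a b)).
suff pos h : continuous h ->
    (forall a b, t1 < a -> a < b -> b < t2 ->
    \int[lebesgue_measure]_(t in `[t1, t2]) (bump1 a b t * h t) = 0) ->
    forall t, t1 < t < t2 -> ~ (0 < h t).
  move=> cG G0 t t0; have [gx|gx|//] := ltgtP (G t) 0; last first.
    by case: (pos G cG G0 t t0).
  case: (pos (fun t => -1 * G t) _ _ t t0); last by rewrite mulN1r oppr_gt0.
    by move=> x; apply: cvgM; [exact: cvg_cst|exact: cG].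
  move=> a b ta ab bt.
  under eq_Rintegral do rewrite mulrCA.
  by rewrite RintegralZl// ?G0// ?mulr0//; exact: intb.
move=> ch h0 t t0 ht0.
have /nbhs_ballP[d /= d0 dP] : \forall y \near t, (t1 < y < t2) /\ 0 < h y.
  case/andP: t0 => t10 t20.
  near=> y; split; last by near: y; exact: (cvgr_gt (h t) (ch t) 0 ht0).
  by apply/andP; split; near: y; [exact: lt_nbhsr|exact: lt_nbhsl].
have d20 : 0 < d / 2 by rewrite divr_gt0.
have dP' y : `|t - y| <= d / 2 -> (t1 < y < t2) /\ 0 < h y.
  move=> yd; apply: dP; rewrite -ball_normE /=; apply: le_lt_trans yd _.
  by rewrite ltr_pdivrMr// ltr_pMr// ltr1n.
have ta : t1 < t - d / 2.
  have [] := dP' (t - d / 2); last by case/andP.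
  by rewrite opprB addrC subrK ger0_norm// ltW.
have bt : t + d / 2 < t2.
  have [] := dP' (t + d / 2); last by case/andP.
  by rewrite opprD addNKr normrN ger0_norm// ltW.
have ab : t - d / 2 < t + d / 2 by rewrite ltrD2l gtrN.
have ins y : (t - d / 2 < y < t + d / 2) -> 0 < h y.
  by rewrite -ltr_distlC => /ltW/dP'[].
pose B : set R := [set` `]t - d / 2, t + d / 2[].
have BD : B `<=` `[t1, t2].
  move=> y; rewrite /B /= !in_itv /= => /andP[ay yb].
  by rewrite (ltW (lt_trans ta ay)) (ltW (lt_trans yb bt)).
have B0 : lebesgue_measure B = 0%E.
  apply: (@null_of_integral_eq0 _ _ (@lebesgue_measure R) _ B
    (fun y => bump1 (t - d / 2) (t + d / 2) y * h y) _ _ BD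
    (intb h (t - d / 2) (t + d / 2) ch)); last exact: h0.
  - exact: measurable_itv.
  - exact: measurable_itv.
  - move=> y _; have [yB|yB] := boolP (t - d / 2 < y < t + d / 2).
      by rewrite mulr_ge0// ltW// ?bump1_gt0// ins.
    by rewrite bump1_eq0// mul0r.
  - move=> y; rewrite /B /= in_itv /= => yB.
    by rewrite mulr_gt0 ?bump1_gt0// ins.
have : (0 < lebesgue_measure B)%E.
  by rewrite /B lebesgue_measure_itv /= lte_fin ab -EFinB lte_fin subr_gt0.
by rewrite B0 ltxx.
Unshelve. all: by end_near. Qed.

End fundamental_lemma.

(** * Integrals of bilinear forms over a product *)

Section product_integrals.
Context {R : realType}.

Lemma Rintegral_sum d (T : measurableType d) (mu : {measure set T -> \bar R})
    (D : set T) I (s : seq I) (P : pred I) (F : I -> T -> R) : measurable D ->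
  (forall i, P i -> mu.-integrable D (EFin \o F i)) ->
  mu.-integrable D (EFin \o (fun x => \sum_(i <- s | P i) F i x)) /\
  \int[mu]_(x in D) (\sum_(i <- s | P i) F i x) =
  \sum_(i <- s | P i) \int[mu]_(x in D) F i x.
Proof.
move=> mD intF; elim: s => [|i s [IHi IH]].
  have -> : (fun x => \sum_(i <- [::] | P i) F i x) = cst 0.
    by apply/funext => x; rewrite big_nil.
  rewrite big_nil; split; last by rewrite Rintegral_cst// mul0r.
  exact: integrable0.
rewrite big_cons; case: (boolP (P i)) => Pi.
  have -> : (fun x => \sum_(i <- i :: s | P i) F i x) =
      (fun x => F i x + \sum_(i <- s | P i) F i x).
    by apply/funext => x; rewrite big_cons Pi.
  split; last by rewrite RintegralD// ?IH//; exact: intF.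
  have := integrableD mD (intF i Pi) IHi; congr integrable.
have -> : (fun x => \sum_(i <- i :: s | P i) F i x) =
    (fun x => \sum_(i <- s | P i) F i x).
  by apply/funext => x; rewrite big_cons (negbTE Pi).
by [].
Qed.

Section fubini_form.
Context d1 d2 (T1 : measurableType d1) (T2 : measurableType d2).
Variables (m1 : {sigma_finite_measure set T1 -> \bar R})
  (m2 : {sigma_finite_measure set T2 -> \bar R}).
Variables (D1 : set T1) (D2 : set T2).
Hypotheses (mD1 : measurable D1) (mD2 : measurable D2) (D1oo : (m1 D1 < +oo)%E).
Variables (a : T1 -> R) (u v : T2 -> R) (c : T1 * T2 -> R) (A B : R).
Hypotheses (ma : measurable_fun D1 a) (aA : forall x, D1 x -> `|a x| <= A).
Hypotheses (mc : measurable_fun (D1 `*` D2) c)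
  (cB : forall z, (D1 `*` D2) z -> `|c z| <= B).
Hypotheses (u2 : square_integrable m2 D2 u) (v2 : square_integrable m2 D2 v).

Let G (y : T2) : R := u y ^+ 2 + v y ^+ 2.

Let G_ge0 y : 0 <= G y. Proof. by rewrite addr_ge0// sqr_ge0. Qed.

Let intG : m2.-integrable D2 (EFin \o G).
Proof. by have := integrableD mD2 u2.2 v2.2. Qed.

(** Square integrability of [u] and [v] enters through this domination. *)
Let uvG y : `|u y * v y| <= G y.
Proof.
rewrite normrM /G -(real_normK (num_real (u y))) -(real_normK (num_real (v y))).
have := sqr_ge0 (`|u y| - `|v y|); have := mulr_ge0 (normr_ge0 (u y)) (normr_ge0 (v y)).
nra.
Qed.

Let mpair x : D1 x -> measurable_fun D2 (fun y => c (x, y)).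
Proof.
move=> Dx; apply: (measurable_comp (F := D1 `*` D2)) => //.
- exact: measurableX.
- by move=> _ [y Dy <-].
- exact/measurable_funTS/pair1_measurable.
Qed.

Let msection x : D1 x -> measurable_fun D2 (fun y => u y * c (x, y) * v y).
Proof.
move=> Dx; apply: measurable_funM; last exact: v2.1.
by apply: measurable_funM; [exact: u2.1|exact: mpair].
Qed.

Let section_bound x y : D1 x -> D2 y -> `|u y * c (x, y) * v y| <= B * G y.
Proof.
move=> Dx Dy; rewrite mulrAC mulrC normrM.
by apply: ler_pM => //; exact: cB.
Qed.

Lemma section_integrable x : D1 x ->
  m2.-integrable D2 (EFin \o (fun y => u y * c (x, y) * v y)).
Proof.
move=> Dx; apply: (le_integrable mD2 (g := EFin \o (fun y => B * G y))).
- by apply/measurable_EFinP; exact: msection.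
- move=> y Dy /=; rewrite lee_fin; apply: le_trans (section_bound Dx Dy) _.
  exact: ler_norm.
- exact: (integrableZl mD2 B intG).
Qed.

Let f (z : T1 * T2) : R := a z.1 * (u z.2 * c z * v z.2).

Let mD : measurable (D1 `*` D2). Proof. exact: measurableX. Qed.

Let mf : measurable_fun (D1 `*` D2) f.
Proof.
have m1f (h : T1 -> R) : measurable_fun D1 h -> measurable_fun (D1 `*` D2) (fun z => h z.1).
  move=> mh; apply: (measurable_comp (F := D1)) => //.
    by move=> _ [z [Dz _] <-].
  by apply: measurable_funTS; exact: measurable_fst.
have m2f (h : T2 -> R) : measurable_fun D2 h -> measurable_fun (D1 `*` D2) (fun z => h z.2).
  move=> mh; apply: (measurable_comp (F := D2)) => //.
    by move=> _ [z [_ Dz] <-].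
  by apply: measurable_funTS; exact: measurable_snd.
apply: measurable_funM; first exact: m1f.
apply: measurable_funM; last by apply: m2f; exact: v2.1.
by apply: measurable_funM => //; apply: m2f; exact: u2.1.
Qed.

Let g := (EFin \o f) \_ (D1 `*` D2).

Let mg : measurable_fun setT g.
Proof. by apply/(measurable_restrictT _ mD); apply/measurable_EFinP. Qed.

Let gE x y : D1 x -> g (x, y) = ((EFin \o (fun y => a x * (u y * c (x, y) * v y))) \_ D2) y.
Proof.
move=> Dx; rewrite /g /patch; case: ifPn => [/set_mem[_ Dy]|Dxy].
  by rewrite mem_set.
rewrite ifF//; apply/negbTE; apply: contra Dxy => /set_mem Dy.
by rewrite mem_set.
Qed.

Let gE0 x y : ~ D1 x -> g (x, y) = 0%E.
Proof. by move=> Dx; rewrite /g /patch ifF//; apply/negbTE/negP => /set_mem[]. Qed.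

Let intg : (m1 \x m2)%E.-integrable setT g.
Proof.
apply/integrable12ltyP => //.
have mF : measurable_fun setT (fun x => (\int[m2]_y `|g (x, y)|)%E).
  apply: (@measurable_fun_fubini_tonelli_F _ _ _ _ _ m2 (fun z => `|g z|%E)) => //.
  exact: measurableT_comp.
pose C := \int[m2]_(y in D2) (`|A * B| * G y).
have C0 : 0 <= C by apply: Rintegral_ge0 => y _; rewrite mulr_ge0.
apply: (@le_lt_trans _ _ (\int[m1]_x ((EFin \o cst C) \_ D1) x)%E); last first.
  rewrite -integral_mkcond (@integral_cst _ _ _ m1 D1 mD1 C%:E).
  by apply: lte_mul_pinfty => //; rewrite lee_fin.
apply: ge0_le_integral => //.
- by move=> x _; exact: integral_ge0.
- by apply/(measurable_restrictT _ mD1)/measurable_EFinP; exact: measurable_cst.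
move=> x _; have [Dx|Dx] := pselect (D1 x); last first.
  rewrite integral0_eq; last by move=> y _; rewrite gE0// abse0.
  by rewrite /patch ifF//; apply/negbTE/negP => /set_mem.
rewrite /patch mem_set//=.
pose h y : R := `|A * B| * G y.
have : (\int[m2]_y `|g (x, y)| <= \int[m2]_y ((EFin \o h) \_ D2) y)%E.
  apply: ge0_le_integral => //.
  - by apply: measurableT_comp => //; exact: measurableT_comp.
  - apply/(measurable_restrictT _ mD2).
    by have := measurable_int _ intG => mG; apply/measurable_EFinP/measurable_funM => //; exact/measurable_EFinP.
  move=> y _; rewrite gE// /patch; case: ifPn => [/set_mem Dy|_]; last by rewrite abse0.
  rewrite /= lee_fin normrM; apply: le_trans (ler_wpM2r (G_ge0 y) (ler_norm _)).
  by rewrite -[leRHS]mulrA; apply: ler_pM => //; [exact: aA|exact: section_bound].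
have iG : m2.-integrable D2 (EFin \o h) by exact: (integrableZl mD2 `|A * B| intG).
by rewrite -integral_mkcond /C /Rintegral fineK//; exact: integrable_fin_num.
Qed.

Lemma form_integrable : (m1 \x m2)%E.-integrable (D1 `*` D2) (EFin \o f).
Proof. exact/(integrable_mkcond _ mD). Qed.

Let marginalE : fubini_F m2 g =
  (EFin \o (fun x => a x * \int[m2]_(y in D2) (u y * c (x, y) * v y))) \_ D1.
Proof.
apply/funext => x; rewrite /fubini_F [RHS]/patch.
have [Dx|Dx] := pselect (D1 x); last first.
  rewrite ifF; last by apply/negbTE/negP => /set_mem.
  by rewrite integral0_eq// => y _; rewrite gE0.
rewrite mem_set//=.
under eq_integral do rewrite gE//.
rewrite -integral_mkcond /=.
have intx := section_integrable Dx.
rewrite EFinM fineK; last exact: integrable_fin_num.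
by rewrite -integralZl.
Qed.

Lemma marginal_integrable :
  m1.-integrable D1
    (EFin \o (fun x => a x * \int[m2]_(y in D2) (u y * c (x, y) * v y))).
Proof.
by apply/(integrable_mkcond _ mD1); rewrite -marginalE; exact: integrable_fubini_F.
Qed.

Lemma fubini_form :
  \int[(m1 \x m2)%E]_(z in D1 `*` D2) f z =
  \int[m1]_(x in D1) (a x * \int[m2]_(y in D2) (u y * c (x, y) * v y)).
Proof.
rewrite /Rintegral; congr fine.
by rewrite integral_mkcond -/g -(integral12_prod_meas1 intg) [RHS]integral_mkcond marginalE.
Qed.

End fubini_form.

Let quad_coef e k (C : 'M[R]_e) (La : 'M[R]_(e, k)) j i :
  (La^T *m C *m La) j i = \sum_p \sum_q La p j * C p q * La q i.
Proof.
rewrite mxE exchange_big; apply: eq_bigr => q _ /=.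
by rewrite mxE mulr_suml; apply: eq_bigr => p _; rewrite mxE.
Qed.

(** Expanded in entries, every term is a function of [x] times an integrand whose
    partial integral is an entry of the matrix on the right. *)
Lemma fubini_quadratic_form d1 d2 (T1 : measurableType d1) (T2 : measurableType d2)
    (m1 : {sigma_finite_measure set T1 -> \bar R})
    (m2 : {sigma_finite_measure set T2 -> \bar R})
    (D1 : set T1) (D2 : set T2) e k (A : R)
    (f g : T1 -> 'cV[R]_k) (La : T2 -> 'M[R]_(e, k)) (C : T1 * T2 -> 'M[R]_e) :
  measurable D1 -> measurable D2 -> (m1 D1 < +oo)%E ->
  (forall i, measurable_fun D1 (fun x => f x i 0)) ->
  (forall i, measurable_fun D1 (fun x => g x i 0)) ->
  (forall x i, D1 x -> `|f x i 0| <= A /\ `|g x i 0| <= A) ->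
  (forall i j, measurable_fun (D1 `*` D2) (fun z => C z i j)) ->
  bounded_field (D1 `*` D2) C ->
  (forall i j, square_integrable m2 D2 (fun y => La y i j)) ->
  \int[(m1 \x m2)%E]_(z in D1 `*` D2)
    dot (C z *m (La z.2 *m f z.1)) (La z.2 *m g z.1) =
  \int[m1]_(x in D1)
    dot ((\matrix_(i, j) \int[m2]_(y in D2) ((La y)^T *m C (x, y) *m La y) i j)
         *m f x) (g x).
Proof.
move=> mD1 mD2 D1oo mf mg fgA mC [B CB] La2.
pose idx := (('I_k * 'I_k) * ('I_e * 'I_e))%type.
pose a (t : idx) x := g x t.1.1 0 * f x t.1.2 0.
pose F (t : idx) x y := La y t.2.1 t.1.1 * C (x, y) t.2.1 t.2.2 * La y t.2.2 t.1.2.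
have sum4 (h : 'I_k -> 'I_k -> 'I_e -> 'I_e -> R) :
    \sum_j \sum_i \sum_p \sum_q h j i p q = \sum_(t : idx) h t.1.1 t.1.2 t.2.1 t.2.2.
  rewrite -(pair_bigA _ (fun ji pq => h ji.1 ji.2 pq.1 pq.2)) /=.
  rewrite -(pair_bigA _ (fun j i => \sum_(pq : 'I_e * 'I_e) h j i pq.1 pq.2)) /=.
  by apply: eq_bigr => j _; apply: eq_bigr => i _; rewrite pair_bigA.
have ma (t : idx) : measurable_fun D1 (a t) by exact: measurable_funM.
have aA (t : idx) x : D1 x -> `|a t x| <= A * A.
  move=> Dx; rewrite normrM; apply: ler_pM => //.
    by have [] := fgA x t.1.1 Dx.
  by have [] := fgA x t.1.2 Dx.
have CBt (t : idx) z : (D1 `*` D2) z -> `|C z t.2.1 t.2.2| <= B by move=> Dz; exact: CB.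
transitivity (\int[(m1 \x m2)%E]_(z in D1 `*` D2) (\sum_t a t z.1 * F t z.1 z.2)).
  apply: eq_Rintegral => -[x y] _ /=.
  rewrite -(sum4 (fun j i p q => (g x j 0 * f x i 0) *
    (La y p j * C (x, y) p q * La y q i))).
  rewrite dotC dot_mulmx dotE; apply: eq_bigr => j _.
  rewrite !mulmxA mxE mulr_sumr; apply: eq_bigr => i _.
  rewrite quad_coef mulr_suml mulr_sumr; apply: eq_bigr => p _.
  rewrite mulr_suml mulr_sumr; apply: eq_bigr => q _.
  by rewrite mulrCA [RHS]mulrC mulrA.
have Fint t := form_integrable mD1 mD2 D1oo (ma t) (aA t) (mC t.2.1 t.2.2) (CBt t)
  (La2 t.2.1 t.1.1) (La2 t.2.2 t.1.2).
rewrite (Rintegral_sum _ _ _).2 //; last first.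
  move=> t _; have := Fint t; congr integrable; apply/funext => -[x y] //.
  exact: measurableX.
transitivity (\int[m1]_(x in D1) (\sum_t a t x * \int[m2]_(y in D2) F t x y)).
  rewrite (Rintegral_sum _ _ _).2 //.
    apply: eq_bigr => t _.
    have := fubini_form mD1 mD2 D1oo (ma t) (aA t) (mC t.2.1 t.2.2) (CBt t)
      (La2 t.2.1 t.1.1) (La2 t.2.2 t.1.2).
    by move=> <-; apply: eq_Rintegral => -[x y].
  move=> t _; exact: (marginal_integrable mD1 mD2 D1oo (ma t) (aA t) (mC t.2.1 t.2.2)
    (CBt t) (La2 t.2.1 t.1.1) (La2 t.2.2 t.1.2)).
apply: eq_Rintegral => x /set_mem Dx.
rewrite -(sum4 (fun j i p q => (g x j 0 * f x i 0) *
    \int[m2]_(y in D2) (La y p j * C (x, y) p q * La y q i))).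
rewrite dotC dotE; apply: eq_bigr => j _.
rewrite mxE mulr_sumr; apply: eq_bigr => i _.
have intF p q := section_integrable mD1 mD2 (mC p q)
  (fun z Dz => CB z Dz p q) (La2 p j) (La2 q i) Dx.
have -> : (\matrix_(i0, j0) \int[m2]_(y in D2) ((La y)^T *m C (x, y) *m La y) i0 j0) j i =
    \sum_p \sum_q \int[m2]_(y in D2) (La y p j * C (x, y) p q * La y q i).
  rewrite mxE; transitivity (\int[m2]_(y in D2)
      (\sum_p \sum_q La y p j * C (x, y) p q * La y q i)).
    by apply: eq_Rintegral => y _; exact: quad_coef.
  rewrite (Rintegral_sum _ _ _).2 //; last first.
    by move=> p _; apply: (Rintegral_sum _ _ _).1.
  by apply: eq_bigr => p _; rewrite (Rintegral_sum _ _ _).2.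
rewrite mulr_suml mulr_sumr; apply: eq_bigr => p _.
rewrite mulr_suml mulr_sumr; apply: eq_bigr => q _.
by ring.
Qed.

End product_integrals.

(** * Quadratic energies and their variations *)

Section quadratic_energy.
Context {R : realType} {l : nat} (D : set 'rV[R]_l).
Hypotheses (oD : open D) (bD : bounded_set D).
Local Notation cl := (closure D).

Lemma is_derive_quadratic (G : R -> 'rV[R]_l -> R) (A B C : 'rV[R]_l -> R) :
  smooth_near 0 cl A -> smooth_near 0 cl B -> smooth_near 0 cl C ->
  (forall eta x, D x -> G eta x = A x + (eta * B x + eta * (eta * C x))) ->
  is_derive (0 : R) 1 (fun eta => \int[leb l]_(x in D) G eta x)
    (\int[leb l]_(x in D) B x).
Proof.
move=> CA CB CC GE.
have mD : measurable D by exact: open_measurable_rV.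
have int h : smooth_near 0 cl h -> (leb l).-integrable D (EFin \o h).
  exact: smooth_near_integrable.
have smulc (e : R) h : smooth_near 0 cl h -> smooth_near 0 cl (fun x => e * h x).
  by apply: smooth_near_mul; exact: smooth_near_cst.
have -> : (fun eta => \int[leb l]_(x in D) G eta x) = fun eta =>
    \int[leb l]_(x in D) A x + (eta * \int[leb l]_(x in D) B x +
      eta * (eta * \int[leb l]_(x in D) C x)).
  apply/funext => eta.
  transitivity (\int[leb l]_(x in D) (A x + (eta * B x + eta * (eta * C x)))).
    by apply: eq_Rintegral => x /set_mem; exact: GE.
  rewrite RintegralD//; [|exact: int|]; last first.
    by apply: int; apply: smooth_near_add; apply: (smulc eta) => //; exact: smulc.
  rewrite RintegralD//; [|by apply: int; exact: smulc|]; last first.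
    by apply: int; apply: (smulc eta); exact: smulc.
  by rewrite !RintegralZl//; apply: int => //; exact: smulc.
set a := Rintegral _ _ A; set b := Rintegral _ _ B; set c := Rintegral _ _ C.
have did := is_derive_id (0 : R) (1 : R).
have dc (k : R) : is_derive (0 : R) (1 : R) (cst k) 0 by exact: is_derive_cst.
have := is_deriveD (dc a) (is_deriveD (is_deriveM did (dc b))
  (is_deriveM did (is_deriveM did (dc c)))).
move/is_derive_eq; apply; rewrite /GRing.scale /= -[(id * cst c) 0]/(0 * c); ring.
Qed.

(** The two cross terms of the quadratic form agree by symmetry, which cancels the
    factor one half. *)
Lemma is_derive_energy a (S : 'rV[R]_l -> 'M[R]_a) (u v : 'rV[R]_l -> 'cV[R]_a) :
  field_Cq 0 cl S -> (forall x, D x -> (S x)^T = S x) ->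
  field_Cq 0 cl u -> field_Cq 0 cl v ->
  is_derive (0 : R) 1 (fun eta => 2^-1 * \int[leb l]_(x in D)
      dot (S x *m (u x + eta *: v x)) (u x + eta *: v x))
    (\int[leb l]_(x in D) dot (S x *m u x) (v x)).
Proof.
move=> CS symS Cu Cv.
have Cdot f g : field_Cq 0 cl f -> field_Cq 0 cl g ->
    smooth_near 0 cl (fun x => dot (S x *m f x) (g x)).
  by move=> Cf Cg; apply: smooth_near_dot => //; exact: field_Cq_mul.
have := @is_derive_quadratic
  (fun eta x => dot (S x *m (u x + eta *: v x)) (u x + eta *: v x))
  (fun x => dot (S x *m u x) (u x)) (fun x => 2 * dot (S x *m u x) (v x))
  (fun x => dot (S x *m v x) (v x)).
move=> /(_ (Cdot _ _ Cu Cu) _ (Cdot _ _ Cv Cv)) H.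
have dG := H _ _; have := is_deriveZ (2^-1 : R) (dG _ _).
have S2 : smooth_near 0 cl (fun x => 2 * dot (S x *m u x) (v x)).
  by apply: smooth_near_mul; [exact: smooth_near_cst|exact: Cdot].
move=> /(_ S2) K; apply: is_derive_eq (K _) _ => [eta x Dx|].
  rewrite mulmxDr -scalemxAr !dotDr !dotDl !dotZr !dotZl.
  have -> : dot (S x *m v x) (u x) = dot (S x *m u x) (v x).
    by rewrite dot_mulmx symS// dotC.
  ring.
rewrite RintegralZl; [|exact: open_measurable_rV|]; last first.
  by apply: smooth_near_integrable => //; exact: Cdot.
by rewrite /GRing.scale /= mulKf.
Qed.

Lemma is_derive_energy_add a (S : 'rV[R]_l -> 'M[R]_a) (u v : 'rV[R]_l -> 'cV[R]_a)
    (c : 'rV[R]_l -> R) :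
  field_Cq 0 cl S -> (forall x, D x -> (S x)^T = S x) ->
  field_Cq 0 cl u -> field_Cq 0 cl v -> smooth_near 0 cl c ->
  is_derive (0 : R) (1 : R) (fun eta => 2^-1 * \int[leb l]_(x in D)
      (dot (u x + eta *: v x) (S x *m (u x + eta *: v x)) + c x))
    (\int[leb l]_(x in D) dot (S x *m u x) (v x)).
Proof.
move=> CS symS Cu Cv Cc; have dE := is_derive_energy CS symS Cu Cv.
have dc : is_derive (0 : R) (1 : R) (fun _ : R => 2^-1 * \int[leb l]_(x in D) c x) 0.
  exact: is_derive_cst.
rewrite -[X in is_derive _ _ _ X]addr0.
have := is_deriveD dE dc; congr is_derive; apply/funext => eta.
apply: etrans (esym (mulrDr _ _ _)) _; congr (_ * _); rewrite -RintegralD//.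
- by apply: eq_Rintegral => x _; congr (_ + _); exact: dotC.
- exact: open_measurable_rV.
- have Cw : field_Cq 0 cl (fun x => u x + eta *: v x).
    by apply: field_Cq_add => //; apply: field_Cq_scale => //; exact: smooth_near_cst.
  by apply: smooth_near_integrable => //; apply: smooth_near_dot => //; exact: field_Cq_mul.
- exact: smooth_near_integrable.
Qed.

Lemma field_bounded a (f : 'rV[R]_l -> 'cV[R]_a) : field_Cq 0 cl f ->
  exists A, forall x i, D x -> `|f x i 0| <= A.
Proof.
move=> Cf; have [M MP] := choice (fun i => smooth_near_bounded bD (Cf i 0)).
exists (\sum_i `|M i|) => x i Dx.
apply: le_trans (MP i x (subset_closure Dx)) _.
apply: le_trans (ler_norm _) _.
by rewrite (bigD1 i)//= lerDl sumr_ge0.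
Qed.

Lemma field_measurable a (f : 'rV[R]_l -> 'cV[R]_a) i : field_Cq 0 cl f ->
  measurable_fun D (fun x => f x i 0).
Proof.
move=> Cf; apply: smooth_near_measurable => //.
exact: smooth_near_sub (@subset_closure _ D) (Cf i 0).
Qed.

End quadratic_energy.

Section dtime_linear.
Context {R : realType} {l : nat}.

Lemma dtime_lin a (A : set 'rV[R]_l) (c : R) (f g : R -> 'rV[R]_l -> 'cV[R]_a) t x :
  field_Cq 1 ([set: R] `*` A) (uncurried f) ->
  field_Cq 1 ([set: R] `*` A) (uncurried g) -> A x ->
  dtime (fun s y => f s y + c *: g s y) t x = dtime f t x + c *: dtime g t x.
Proof.
move=> Cf Cg Ax; apply/colP => i; rewrite !mxE !derive1E.
have df := @time_derivable _ _ 0 a A f t x i Cf Ax.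
have dg := @time_derivable _ _ 0 a A g t x i Cg Ax.
have -> : (fun s => (f s x + c *: g s x) i 0) =
    (fun s => f s x i 0) + c *: (fun s => g s x i 0).
  by apply/funext => s; rewrite !mxE.
by rewrite (deriveD df (derivableZ dg)) (deriveZ c dg).
Qed.

Lemma dtime_mulmx a e (A : set 'rV[R]_l) (M : 'M[R]_(e, a))
    (f : R -> 'rV[R]_l -> 'cV[R]_a) (t : R) x :
  field_Cq 1 ([set: R] `*` A) (uncurried f) -> A x ->
  forall i, is_derive t (1 : R) (fun s => (M *m f s x) i 0) ((M *m dtime f t x) i 0).
Proof.
move=> Cf Ax i; rewrite mxE.
have -> : (fun s => (M *m f s x) i 0) = (fun s => \sum_j M i j * f s x j 0).
  by apply/funext => s; rewrite mxE.
apply: is_derive_bigsum => j _; rewrite mxE derive1E.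
exact: (is_deriveZ (M i j) (derivableP (@time_derivable _ _ 0 a A f t x j Cf Ax))).
Qed.

End dtime_linear.

(** A vector of the kernel would have zero energy. *)
Lemma posdef_unitmx {R : realType} a (A : 'M[R]_a) : posdef A -> A \in unitmx.
Proof.
move=> [symA posA]; rewrite unitmxE unitfE; apply/negP => /det0P[v v0 vA].
have vT0 : v^T != 0 by rewrite -trmx0 (inj_eq trmx_inj).
have := posA _ vT0; rewrite -[A]symA -trmx_mul vA trmx0 dot0r.
by rewrite ltxx.
Qed.

(** * The energies of the body *)

Section body_energy.
Context {R : realType} {l n m d N : nat} (b : elastic_body R l n m d N).
Hypotheses (dom : regular_domain b) (Omc_meas : measurable (Omc b)).
Hypotheses
  (lam1_L2 : forall i j,
    square_integrable (leb (3 - l)) (Omc b) (fun y => lam1 b y i j))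
  (lam2_L2 : forall i j,
    square_integrable (leb (3 - l)) (Omc b) (fun y => lam2 b y i j))
  (C_meas : forall i j, measurable_fun (body_set b) (fun X => Cmat b X i j))
  (C_bounded : bounded_field (body_set b) (Cmat b))
  (rho_smooth : smooth_near 0 (closure (Om b)) (rho b))
  (K_smooth : field_Cq N (closure (Om b)) (stiffness_matrix b))
  (M_posdef : forall x, closure (Om b) x -> posdef (mass_matrix b x))
  (K_posdef : forall x, closure (Om b) x -> posdef (stiffness_matrix b x)).

Local Notation D := (Om b).
Local Notation cl := (closure (Om b)).
Local Notation ST := ([set: R] `*` closure (Om b)).
Local Notation M := (mass_matrix b).
Local Notation K := (stiffness_matrix b).

Let oD := dom_open dom.
Let bD := dom_bounded dom.
Let mD : measurable D. Proof. exact: open_measurable_rV. Qed.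
Let Doo : (leb l D < +oo)%E. Proof. exact: leb_bounded_lty. Qed.

Lemma elastic_form (f g : 'rV[R]_l -> 'cV[R]_m) :
  field_Cq 0 cl f -> field_Cq 0 cl g ->
  \int[volume]_(X in body_set b)
    dot (Cmat b X *m (lam2 b X.2 *m f X.1)) (lam2 b X.2 *m g X.1) =
  \int[leb l]_(x in D) dot (K x *m f x) (g x).
Proof.
move=> Cf Cg.
have [A1 A1P] := field_bounded bD Cf; have [A2 A2P] := field_bounded bD Cg.
apply: (@fubini_quadratic_form _ _ _ _ _ (leb l) (leb (3 - l)) D (Omc b) d m
  (Num.max A1 A2)) => //.
- by move=> i; exact: field_measurable.
- by move=> i; exact: field_measurable.
- by move=> x i Dx; rewrite !le_max A1P ?A2P ?orbT.
Qed.

(** The density depends on [x] only, so it can be carried by the first field. *)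
Lemma inertia_form (f g : 'rV[R]_l -> 'cV[R]_n) :
  field_Cq 0 cl f -> field_Cq 0 cl g ->
  \int[volume]_(X in body_set b)
    (rho b X.1 * dot (lam1 b X.2 *m f X.1) (lam1 b X.2 *m g X.1)) =
  \int[leb l]_(x in D) dot (M x *m f x) (g x).
Proof.
move=> Cf Cg.
pose h x := rho b x *: f x.
have Ch : field_Cq 0 cl h by exact: field_Cq_scale.
have [A1 A1P] := field_bounded bD Ch; have [A2 A2P] := field_bounded bD Cg.
have := @fubini_quadratic_form _ _ _ _ _ (leb l) (leb (3 - l)) D (Omc b) 3 n
  (Num.max A1 A2) h g (lam1 b) (fun=> 1%:M) mD Omc_meas Doo.
set I1 := Rintegral _ _ _; set I2 := Rintegral _ _ _ => I12.
transitivity I1.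
  by apply: eq_Rintegral => X _; rewrite mul1mx /h -scalemxAr dotZl.
rewrite I12 //.
- apply: eq_Rintegral => x _; rewrite /mass_matrix.
  set Mc := \matrix_(i, j) _; set Mc' := \matrix_(i, j) _.
  have -> : Mc = Mc'.
    apply/matrixP => i j; rewrite [LHS]mxE [RHS]mxE.
    by apply: eq_Rintegral => y _; rewrite mulmx1.
  by rewrite /h -scalemxAr -scalemxAl.
- by move=> i; exact: field_measurable.
- by move=> i; exact: field_measurable.
- by move=> x i Dx; rewrite !le_max A1P ?A2P ?orbT.
- exists 1 => z _ i j; rewrite mxE; case: (_ == _); rewrite ?normr1// normr0//.
Qed.

Lemma elasticE (r : R -> 'rV[R]_l -> 'cV[R]_n) t : field_Cq 0 cl (Fop b (r t)) ->
  elastic b r t =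
  2^-1 * \int[leb l]_(x in D) dot (K x *m Fop b (r t) x) (Fop b (r t) x).
Proof. by move=> Cr; rewrite -elastic_form. Qed.

Lemma kineticE (r : R -> 'rV[R]_l -> 'cV[R]_n) t : field_Cq 1 ST (uncurried r) ->
  kinetic b r t =
  2^-1 * \int[leb l]_(x in D) dot (M x *m dtime r t x) (dtime r t x).
Proof.
move=> Cr; have Cdr := slice_Cq t (dtime_Cq Cr).
rewrite -inertia_form// /kinetic; congr (_ * _); apply: eq_Rintegral => X /set_mem[DX _].
have -> : dtime (displacement b r) t X = lam1 b X.2 *m dtime r t X.1.
  apply/colP => i; rewrite mxE derive1E.
  by have [_] := dtime_mulmx (lam1 b X.2) t Cr (subset_closure DX) i.
by [].
Qed.

Lemma mass_smooth : field_Cq 0 cl M.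
Proof. by apply: field_Cq_scale => //; exact: field_Cq_cst. Qed.

(** The mass matrix is the density times a constant matrix, so that it stays
    invertible a little outside of the body. *)
Let density_near : (0 < n)%N -> exists U, [/\ open U, cl `<=` U &
  forall x, U x -> [/\ {for x, continuous (rho b)}, rho b x != 0 & M x \in unitmx]].
Proof.
move=> n0; have [[x0 clx0]|cl0] := pselect (exists x, cl x); last first.
  by exists set0; split; [exact: open0|move=> x clx; case: cl0; exists x|].
have [U [oU clU [cU _]]] := rho_smooth.
pose Mc := \matrix_(i, j) \int[leb (3 - l)]_(y in Omc b) ((lam1 b y)^T *m lam1 b y) i j.
have detM x : \det (M x) = rho b x ^+ n * \det Mc by exact: detZ.
have Mcl x : cl x -> \det (M x) != 0.
  by move=> /M_posdef/posdef_unitmx; rewrite unitmxE unitfE.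
have Mc0 : \det Mc != 0 by have := Mcl _ clx0; rewrite detM mulf_eq0 => /norP[].
exists (U `&` [set x | rho b x != 0]); split.
- rewrite openE => x [Ux rx]; rewrite /interior.
  apply: filterI; first exact: open_nbhs_nbhs.
  exact: (cvgr_neq0 (rho b x) (cU x Ux) rx).
- move=> x clx; split; first exact: clU.
  by have := Mcl x clx; rewrite detM mulf_eq0 expf_eq0 n0 => /norP[].
- move=> x [Ux rx]; split => //; first exact: cU.
  by rewrite unitmxE unitfE detM mulf_neq0// expf_neq0.
Qed.

Lemma mass_unit_near : exists U, [/\ open U, cl `<=` U &
  forall x, U x -> M x \in unitmx].
Proof.
have [n0|n0] := posnP n.
  exists setT; split => // [|x _]; first exact: openT.
  by move: (M x); rewrite n0 => A; rewrite unitmxE det_mx00 unitr1.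
by have [U [oU clU UP]] := density_near n0; exists U; split => // x /UP[].
Qed.

Lemma inv_mass_smooth : field_Cq 0 cl (fun x => invmx (M x)).
Proof.
move=> i j; have n0 : (0 < n)%N by exact: leq_ltn_trans (ltn_ord i).
have [U [oU clU UP]] := density_near n0.
pose Mc := \matrix_(i, j) \int[leb (3 - l)]_(y in Omc b) ((lam1 b y)^T *m lam1 b y) i j.
exists U; split => //; apply: (@Cq_ext _ _ _ _ (fun x => (rho b x)^-1 * invmx Mc i j)) => //.
  by move=> x /UP[_ rx Mx]; rewrite /mass_matrix invmxZ ?mxE.
split=> // x /UP[cx rx _].
have cV : {for x, continuous (fun y => (rho b y)^-1)} by apply: continuousV; [exact: rx|exact: cx].
by apply: (@continuousM _ _ (fun y => (rho b y)^-1) (fun=> invmx Mc i j)); [exact: cV|exact: cst_continuous].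
Qed.

Lemma variation_elastic (r dr : R -> 'rV[R]_l -> 'cV[R]_n) t :
  field_Cq N cl (r t) -> field_Cq N cl (dr t) ->
  Defs.variation (elastic b) r dr t =
  \int[leb l]_(x in D) dot (K x *m Fop b (r t) x) (Fop b (dr t) x).
Proof.
move=> Cr Cdr; rewrite /Defs.variation derive1E.
have Clin eta : field_Cq N cl (fun x => r t x + eta *: dr t x).
  apply: field_Cq_add => //; apply: field_Cq_scale => //; exact: smooth_near_cst.
have CF w : field_Cq N cl w -> field_Cq 0 cl (Fop b w) by exact: diffop_Cq.
apply: derive_val.
have := is_derive_energy oD bD (field_Cq_le (leq0n N) K_smooth) _ (CF _ Cr) (CF _ Cdr).
have symK x : D x -> (K x)^T = K x by move=> /subset_closure/K_posdef[].
move=> /(_ symK); congr is_derive; apply/funext => eta.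
rewrite elasticE; last exact: CF.
congr (_ * _); apply: eq_Rintegral => x /set_mem Dx.
rewrite /Fop -(@diffop_lin _ _ _ _ _ _ _ D)//.
- exact: field_Cq_sub (@subset_closure _ D) Cr.
- exact: field_Cq_sub (@subset_closure _ D) Cdr.
Qed.

Lemma variation_kinetic (r dr : R -> 'rV[R]_l -> 'cV[R]_n) t :
  field_Cq 1 ST (uncurried r) -> field_Cq 1 ST (uncurried dr) ->
  Defs.variation (kinetic b) r dr t =
  \int[leb l]_(x in D) dot (M x *m dtime r t x) (dtime dr t x).
Proof.
move=> Cr Cdr; rewrite /Defs.variation derive1E.
have Clin eta : field_Cq 1 ST (uncurried (fun s x => r s x + eta *: dr s x)).
  apply: field_Cq_add => //; apply: field_Cq_scale => //; exact: smooth_near_cst.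
apply: derive_val.
have := is_derive_energy oD bD mass_smooth _ (slice_Cq t (dtime_Cq Cr))
  (slice_Cq t (dtime_Cq Cdr)).
have symM x : D x -> (M x)^T = M x by move=> /subset_closure/M_posdef[].
move=> /(_ symM); congr is_derive; apply/funext => eta.
rewrite kineticE//; congr (_ * _); apply: eq_Rintegral => x /set_mem Dx.
by rewrite (dtime_lin eta t Cr Cdr (subset_closure Dx)).
Qed.

End body_energy.

(** * From the variational principle to the equations of motion *)

Section time_by_parts.
Context {R : realType}.

Let LR_continuous (F : R -> R) (a b : R) : (forall t, derivable F t 1) ->
  derivable_oo_LRcontinuous F a b.
Proof.
move=> dF; have cF t : {for t, continuous F}.
  exact/differentiable_continuous/derivable1_diffP.
split; [by move=> t _; exact: dF| |].
- by apply: cvg_at_right_filter; exact: cF.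
- by apply: cvg_at_left_filter; exact: cF.
Qed.

Lemma time_by_parts (phi dphi B dB : R -> R) (t1 t2 : R) : t1 < t2 ->
  (forall t, is_derive t (1 : R) phi (dphi t)) -> continuous dphi ->
  (forall t, is_derive t (1 : R) B (dB t)) -> continuous dB ->
  phi t1 = 0 -> phi t2 = 0 ->
  \int[lebesgue_measure]_(t in `[t1, t2]) (phi t * dB t) =
  - \int[lebesgue_measure]_(t in `[t1, t2]) (dphi t * B t).
Proof.
move=> t12 dphiP cdphi dBP cdB phi1 phi2.
rewrite (@Rintegration_by_parts _ phi B dphi dB) //.
- by rewrite phi1 phi2 !mul0r subrr sub0r.
- exact: continuous_subspaceT.
- by apply: LR_continuous => t; have [] := dphiP t.
- by move=> t _; rewrite derive1E; have [_ ->] := dphiP t.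
- exact: continuous_subspaceT.
- by apply: LR_continuous => t; have [] := dBP t.
- by move=> t _; rewrite derive1E; have [_ ->] := dBP t.
Qed.

Lemma is_derive_dot a (f g : R -> 'cV[R]_a) (df dg : 'cV[R]_a) (t : R) :
  (forall i, is_derive t (1 : R) (fun s => f s i 0) (df i 0)) ->
  (forall i, is_derive t (1 : R) (fun s => g s i 0) (dg i 0)) ->
  is_derive t (1 : R) (fun s => dot (f s) (g s)) (dot df (g t) + dot (f t) dg).
Proof.
move=> dfP dgP.
have -> : (fun s => dot (f s) (g s)) = (fun s => \sum_i f s i 0 * g s i 0).
  by apply/funext => s; rewrite dotE.
rewrite !dotE -big_split /=.
apply: is_derive_bigsum => i _.
by apply: is_derive_eq (is_deriveM (dfP i) (dgP i)) _; rewrite /GRing.scale /=; ring.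
Qed.

End time_by_parts.

(** From linearity, written [c w = w + (c - 1) w]. *)
Lemma diffop_scale {R : realType} {l m n N : nat} (P0 : 'M[R]_(m, n))
    (P : 'I_l -> nat -> 'M[R]_(m, n)) (U : set 'rV[R]_l) (c : R)
    (w : 'rV[R]_l -> 'cV[R]_n) x :
  open U -> field_Cq N U w -> U x ->
  diffop N P0 P (fun y => c *: w y) x = c *: diffop N P0 P w x.
Proof.
move=> oU Cw Ux; have E (v : 'cV[R]_n) : c *: v = v + (c - 1) *: v.
  by rewrite -[X in X + _]scale1r -scalerDl addrC subrK.
have -> : (fun y => c *: w y) = (fun y => w y + (c - 1) *: w y).
  by apply/funext => y; exact: E.
rewrite (diffop_lin _ _ _ oU Cw Cw Ux) -[X in X + _]scale1r -scalerDl addrC subrK.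
by [].
Qed.

Section dynamics.
Context {R : realType} {l n m d N q : nat} (b : elastic_body R l n m d N).
Variables (r load : R -> 'rV[R]_l -> 'cV[R]_n).
Variable tau : R -> 'rV[R]_l -> 'cV[R]_(\sum_(a < N) blockdim l n a).
Hypotheses (dom : regular_domain b) (Omc_meas : measurable (Omc b)).
Hypotheses (bdry_cover : bdry_u b `|` bdry_s b = boundary (Om b)).
Hypotheses
  (lam1_L2 : forall i j,
    square_integrable (leb (3 - l)) (Omc b) (fun y => lam1 b y i j))
  (lam2_L2 : forall i j,
    square_integrable (leb (3 - l)) (Omc b) (fun y => lam2 b y i j))
  (C_meas : forall i j, measurable_fun (body_set b) (fun X => Cmat b X i j))
  (C_bounded : bounded_field (body_set b) (Cmat b))
  (rho_smooth : smooth_near 0 (closure (Om b)) (rho b))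
  (K_smooth : field_Cq N (closure (Om b)) (stiffness_matrix b))
  (M_posdef : forall x, closure (Om b) x -> posdef (mass_matrix b x))
  (K_posdef : forall x, closure (Om b) x -> posdef (stiffness_matrix b x)).
Hypotheses (N_pos : (0 < N)%N) (q_large : (2 * N <= q)%N)
  (r_smooth : field_Cq q.+1 (spacetime (Om b)) (uncurried r))
  (load_smooth : field_Cq 0 (spacetime (Om b)) (uncurried load)).

Local Notation D := (Om b).
Local Notation cl := (closure (Om b)).
Local Notation ST := ([set: R] `*` closure (Om b)).
Local Notation M := (mass_matrix b).
Local Notation K := (stiffness_matrix b).
Local Notation F := (Fop b).
Local Notation v := (dtime r).
Local Notation acc := (dtime (dtime r)).
Local Notation stress_resultant := (fun t x => K x *m F (r t) x).

Let oD := dom_open dom.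
Let bD := dom_bounded dom.
Let mD : measurable D. Proof. exact: open_measurable_rV. Qed.

Let q_ge : [/\ (N + N <= q)%N, (N <= q)%N, (1 <= q)%N & (2 <= q)%N].
Proof.
have NNq : (N + N <= q)%N by rewrite addnn -mul2n.
have Nq : (N <= q)%N by apply: leq_trans NNq; exact: leq_addr.
have q2 : (2 <= q)%N by apply: leq_trans NNq; rewrite addnn (leq_double 1).
by split => //; exact: ltnW.
Qed.

Let Cv : field_Cq q ST (uncurried v). Proof. exact: dtime_Cq. Qed.

Let Cacc : field_Cq 0 ST (uncurried acc).
Proof.
by apply: dtime_Cq; apply: field_Cq_le Cv; have [] := q_ge.
Qed.

Let CF : field_Cq N.+1 ST (uncurried (fun t => F (r t))).
Proof.
apply: diffop_time_Cq r_smooth; rewrite addSn ltnS; by have [] := q_ge.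
Qed.

Let CM : field_Cq 0 ST (uncurried (fun _ : R => M)).
Proof. by apply: const_time_Cq; exact: mass_smooth. Qed.

Let CK : field_Cq N ST (uncurried (fun _ : R => K)).
Proof. exact: const_time_Cq. Qed.

Lemma stress_resultant_smooth : field_Cq N ST (uncurried stress_resultant).
Proof.
by apply: field_Cq_mul => //; exact: field_Cq_le (leqnSn N) CF.
Qed.

Let symM x : cl x -> (M x)^T = M x. Proof. by case/M_posdef. Qed.
Let symK x : cl x -> (K x)^T = K x. Proof. by case/K_posdef. Qed.

Let v_derive x : cl x -> forall (s : R) i,
  is_derive s (1 : R) (fun s => v s x i 0) (acc s x i 0).
Proof.
move=> clx s i; rewrite mxE derive1E; apply: derivableP.
by apply: (@time_derivable _ _ 0 _ cl) => //; apply: field_Cq_le Cv; have [] := q_ge.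
Qed.

Let Mv_derive x : cl x -> forall (s : R) i,
  is_derive s (1 : R) (fun s => (M x *m v s x) i 0) ((M x *m acc s x) i 0).
Proof.
move=> clx s i; apply: (dtime_mulmx _ _ _ clx); apply: field_Cq_le Cv.
by have [] := q_ge.
Qed.

(** This derivative is what integration by parts in time leaves on the momentum. *)
Let momentum_derive (w : 'rV[R]_l -> 'cV[R]_n) (t : R) : field_Cq 0 cl w ->
  is_derive t (1 : R) (fun s => \int[leb l]_(x in D) dot (M x *m v s x) (w x))
    (\int[leb l]_(x in D) dot (M x *m acc t x) (w x)).
Proof.
move=> Cw; have CwT := const_time_Cq Cw.
apply: (@is_derive_Rintegral_time _ _ _ oD bD (fun s x => dot (M x *m v s x) (w x))
  (fun s x => dot (M x *m acc s x) (w x))).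
- apply: smooth_near_dot => //; apply: field_Cq_mul => //.
  by apply: field_Cq_le Cv.
- by apply: smooth_near_dot => //; exact: field_Cq_mul.
- move=> s x Dx; have clx := subset_closure Dx.
  have dw i : is_derive s (1 : R) (fun _ : R => w x i 0) ((0 : 'cV[R]_n) i 0).
    by rewrite mxE; exact: is_derive_cst.
  apply: is_derive_eq (is_derive_dot (Mv_derive clx s) dw) _.
  by rewrite dot0r addr0.
Qed.

Section weak_form.
Variables (w : 'rV[R]_l -> 'cV[R]_n) (A : set 'rV[R]_l).
Hypotheses (Cw : forall k i j, Cq k setT (fun x => w x i j)) (cA : compact A) (AD : A `<=` D)
  (w0 : forall x, ~ A x -> w x = 0).

Let Cwcl k : field_Cq k cl w.
Proof. by move=> i j; exists setT; split => //; exact: openT. Qed.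

Let a s := \int[leb l]_(x in D) dot (K x *m F (r s) x) (F w x).
Let B s := \int[leb l]_(x in D) dot (M x *m v s x) (w x).
Let dB s := \int[leb l]_(x in D) dot (M x *m acc s x) (w x).
Let L s := \int[leb l]_(x in D) dot (load s x) (w x).

Let ca : continuous a.
Proof.
apply: (Rintegral_time_continuous oD bD); apply: smooth_near_dot.
  exact: field_Cq_le (leq0n N) stress_resultant_smooth.
by apply: const_time_Cq; exact: diffop_Cq (Cwcl N).
Qed.

Let cdB : continuous dB.
Proof.
apply: (Rintegral_time_continuous oD bD); apply: smooth_near_dot.
  exact: field_Cq_mul.
exact: const_time_Cq.
Qed.

Let cL : continuous L.
Proof.
apply: (Rintegral_time_continuous oD bD); apply: smooth_near_dot => //.
exact: const_time_Cq.
Qed.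

Let cB : continuous B.
Proof.
apply: (Rintegral_time_continuous oD bD); apply: smooth_near_dot.
  by apply: field_Cq_mul => //; exact: field_Cq_le Cv.
exact: const_time_Cq.
Qed.

Section separated.
Variables (phi dphi : R -> R).
Hypotheses (Cphi : forall k, Cq k setT phi)
  (dphiP : forall t, is_derive t (1 : R) phi (dphi t)).

Let dr s x := phi s *: w x.

Lemma separated_Coo : field_Coo ST (uncurried dr).
Proof.
move=> i j; exists setT; split => // [|k]; first exact: openT.
have -> : (fun z => uncurried dr z i j) = (fun z => phi z.1 * w z.2 i j).
  by apply/funext => z; rewrite /uncurried /dr mxE.
apply: Cq_mul; first exact: openT.
- have cf : continuous (fst : R * 'rV[R]_l -> R).
    by move=> z; apply: (@cvg_fst _ _ (nbhs z.1) (nbhs z.2)).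
  by have := Cq_comp_affine (L0 := fst) cf (fun _ _ _ => erefl) (Cphi k).
- have cs : continuous (snd : R * 'rV[R]_l -> 'rV[R]_l).
    by move=> z; apply: (@cvg_snd _ _ (nbhs z.1) (nbhs z.2)).
  by have := Cq_comp_affine (L0 := snd) cs (fun _ _ _ => erefl) (Cw k i j).
Qed.

Let Cdr k : field_Cq k ST (uncurried dr).
Proof. by apply: field_Coo_Cq; exact: separated_Coo. Qed.

Let Cr_slice t : field_Cq q.+1 cl (r t). Proof. exact: slice_Cq. Qed.

(** Near the boundary the variation vanishes, hence so do its derivatives. *)
Let jet_unvaried t eta s : bdry_s b s ->
  jet N (fun x => r t x + eta *: dr t x) s = jet N (r t) s.
Proof.
move=> bs; have [_ Ds] : boundary D s by rewrite -bdry_cover; right.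
have oA : open (~` A) by apply: closed_openC; exact: compact_closed.
apply: jet_ext oA _ _ => [y Ay|/AD Ds']; last first.
  by apply: Ds; exact: open_nbhs_nbhs (conj oD Ds').
by rewrite /dr w0// !scaler0 addr0.
Qed.

Let variation_work t :
  Defs.variation (work b load tau) r dr t = - (phi t * L t).
Proof.
rewrite /Defs.variation derive1E; apply: derive_val.
pose S := \int[surf b]_(s in bdry_s b) dot (tau t s) (jet N (r t) s).
pose G eta x := dot (load t x) (r t x + eta *: dr t x).
have -> : (fun eta => work b load tau (fun s x => r s x + eta *: dr s x) t) =
    (fun eta => - (\int[leb l]_(x in D) G eta x + S)).
  apply/funext => eta.
  have SE : \int[surf b]_(s in bdry_s b)
      dot (tau t s) (jet N (fun x => r t x + eta *: dr t x) s) = S.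
    by apply: eq_Rintegral => s /set_mem bs; rewrite jet_unvaried.
  exact: (congr1 (fun S' => - (\int[leb l]_(x in D) G eta x + S')) SE).
have Cload : field_Cq 0 cl (load t) by exact: slice_Cq load_smooth.
have Clr : smooth_near 0 cl (fun x => dot (load t x) (r t x)).
  by apply: smooth_near_dot => //; exact: field_Cq_le (Cr_slice t).
have Clw : smooth_near 0 cl (fun x => dot (load t x) (w x)).
  by apply: smooth_near_dot.
have Cphiw : smooth_near 0 cl (fun x => phi t * dot (load t x) (w x)).
  by apply: smooth_near_mul => //; exact: smooth_near_cst.
have dG : is_derive (0 : R) (1 : R) (fun eta => \int[leb l]_(x in D) G eta x) (phi t * L t).
  have GE eta x : D x -> G eta x = dot (load t x) (r t x) +
      (eta * (phi t * dot (load t x) (w x)) + eta * (eta * 0)).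
    by move=> _; rewrite /G dotDr !dotZr !mulr0 addr0.
  apply: is_derive_eq (is_derive_quadratic oD bD Clr Cphiw (smooth_near_cst _ _ 0) GE) _.
  by rewrite RintegralZl//; exact: smooth_near_integrable.
have dS : is_derive (0 : R) (1 : R) (fun _ : R => S) 0 by exact: is_derive_cst.
by apply: is_derive_eq (is_deriveN (is_deriveD dG dS)) _; rewrite addr0.
Qed.

Let variation_elastic_separated t :
  Defs.variation (elastic b) r dr t = phi t * a t.
Proof.
rewrite variation_elastic//; last 2 first.
- by apply: field_Cq_le (Cr_slice t); have [_ Nq _ _] := q_ge; exact: ltnW.
- exact: slice_Cq (Cdr N).
rewrite /a -RintegralZl//; last first.
  apply: smooth_near_integrable => //; apply: smooth_near_dot.
    exact: field_Cq_le (leq0n N) (slice_Cq t stress_resultant_smooth).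
  exact: diffop_Cq (Cwcl N).
apply: eq_Rintegral => x /set_mem Dx.
rewrite /Fop (diffop_scale (P0 b) (Pk b) (phi t) oD (w := w))// ?dotZr//.
by move=> i j; exact: smooth_near_sub (@subset_closure _ D) (Cwcl N i j).
Qed.

Let variation_kinetic_separated t :
  Defs.variation (kinetic b) r dr t = dphi t * B t.
Proof.
rewrite variation_kinetic//; last first.
  by apply: field_Cq_le r_smooth.
rewrite /B -RintegralZl//; last first.
  apply: smooth_near_integrable => //; apply: smooth_near_dot => //.
  apply: field_Cq_mul; first exact: mass_smooth.
  by apply: field_Cq_le (slice_Cq t Cv).
apply: eq_Rintegral => x /set_mem Dx; rewrite -dotZr; congr dot.
apply/colP => i; rewrite !mxE derive1E; apply: derive_val.
have -> : (fun s => dr s x i 0) = (fun s => phi s * w x i 0).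
  by apply/funext => s; rewrite /dr mxE.
have dw : is_derive t (1 : R) (fun _ : R => w x i 0) 0 by exact: is_derive_cst.
apply: is_derive_eq (is_deriveM (dphiP t) dw) _.
by rewrite /GRing.scale /= mulr0 add0r mulrC.
Qed.

(** Only the kinetic energy sees the time derivative of the bump. *)
Lemma variation_separated t :
  Defs.variation (elastic b) r dr t + Defs.variation (work b load tau) r dr t
    - Defs.variation (kinetic b) r dr t =
  phi t * (a t - L t) - dphi t * B t.
Proof.
by rewrite variation_elastic_separated variation_work variation_kinetic_separated mulrBr.
Qed.

End separated.

Hypothesis hamilton : hamilton_principle b load tau r.

(** Integrating by parts in time moves the derivative from [phi] to the momentum;
    as [phi] is an arbitrary bump, the remaining factor vanishes. *)
Lemma weak_form t : a t + dB t - L t = 0.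
Proof.
have cG : continuous (fun s => a s + dB s - L s).
  move=> s; apply: (@continuousB _ _ _ (fun s => a s + dB s) L); last exact: cL.
  by apply: (@continuousD _ _ _ a dB); [exact: ca|exact: cdB].
have t12 : t - 1 < t + 1 by rewrite ltrBlDr -addrA ltrDl.
apply: (fundamental_itv t12 cG) => [al be tal alb bet|]; last first.
  by rewrite ltrBlDr ltrDl ltr01.
pose phi := bump1 al be; pose dphi := 'D_1 phi.
have Cphi k : Cq k setT phi by exact: bump1_Cq.
have dphiP s : is_derive s (1 : R) phi (dphi s).
  by apply: derivableP; exact: Cq_derivable (Cphi 1%N) _.
have cphi : continuous phi by move=> s; exact: (Cq_cont (Cphi 0%N) (I : setT s)).
have cdphi : continuous dphi.
  by move=> s; exact: (Cq_cont (Cq_derive (1 : R) (Cphi 1%N)) (I : setT s)).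
have dBP s : is_derive s (1 : R) B (dB s) by exact: momentum_derive.
have phi1 : phi (t - 1) = 0.
  by apply: bump1_eq0; rewrite negb_and -!leNgt ltW.
have phi2 : phi (t + 1) = 0.
  by apply: bump1_eq0; rewrite negb_and -!leNgt (ltW bet) orbT.
have int h : continuous h ->
    (@lebesgue_measure R).-integrable `[t - 1, t + 1] (EFin \o h).
  move=> ch; apply: continuous_compact_integrable; first exact: segment_compact.
  exact: continuous_subspaceT.
have cM (f g : R -> R) : continuous f -> continuous g -> continuous (fun s => f s * g s).
  by move=> cf cg s; apply: (@continuousM _ _ f g); [exact: cf|exact: cg].
have cAL : continuous (fun s => a s - L s).
  by move=> s; apply: (@continuousB _ _ _ a L); [exact: ca|exact: cL].
pose h1 s := phi s * (a s - L s) - dphi s * B s.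
have ch1 : continuous h1.
  move=> s; apply: (@continuousB _ _ _ (fun s => phi s * (a s - L s))
    (fun s => dphi s * B s)); [exact: cM|exact: cM].
have H1 : \int[lebesgue_measure]_(s in `[t - 1, t + 1]) h1 s = 0.
  rewrite -[RHS](hamilton t12 (separated_Coo Cphi)).
  - by apply: eq_Rintegral => s _; rewrite variation_separated.
  - by move=> x _; rewrite phi1 phi2 !scale0r.
  - move=> s x bx; have [_ Dx] : boundary D x by rewrite -bdry_cover; left.
    rewrite w0 ?scaler0// => /AD Dx'.
    by apply: Dx; exact: open_nbhs_nbhs (conj oD Dx').
transitivity (\int[lebesgue_measure]_(s in `[t - 1, t + 1])
    (h1 s + (phi s * dB s + dphi s * B s))).
  by apply: eq_Rintegral => s _; rewrite /h1 -/(phi s); ring.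
have ch2 := cM _ _ cphi cdB; have ch3 := cM _ _ cdphi cB.
have ch23 : continuous (fun s => phi s * dB s + dphi s * B s).
  move=> s; apply: (@continuousD _ _ _ (fun s => phi s * dB s)
    (fun s => dphi s * B s)); [exact: ch2|exact: ch3].
have sum_eq0 (f g : R -> R) : continuous f -> continuous g ->
    (\int[lebesgue_measure]_(s in `[t - 1, t + 1]) f s =
      - (\int[lebesgue_measure]_(s in `[t - 1, t + 1]) g s)) ->
    \int[lebesgue_measure]_(s in `[t - 1, t + 1]) (f s + g s) = 0.
  move=> cf cg fg; rewrite RintegralD//; [|exact: int|exact: int].
  by rewrite fg addNr.
have H23 := sum_eq0 _ _ ch2 ch3
  (time_by_parts t12 dphiP cdphi dBP cdB phi1 phi2).
by apply: sum_eq0 => //; apply: etrans H1 _; rewrite H23 oppr0.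
Qed.

End weak_form.

Hypothesis hamilton : hamilton_principle b load tau r.

Let Fadj_smooth t : field_Cq 0 cl (Fadj b (stress_resultant t)).
Proof. exact: diffop_adj_Cq (slice_Cq t stress_resultant_smooth). Qed.

(** Integration by parts in space moves the operator from the test field to the
    stress resultant; bumps in one component then isolate the components of the
    equation. *)
Lemma equation_of_motion t x : D x ->
  M x *m acc t x = - Fadj b (stress_resultant t) x + load t x.
Proof.
move=> Dx; apply/colP => i.
pose g y := M y *m acc t y + Fadj b (stress_resultant t) y + (-1) *: load t y.
have Cload : field_Cq 0 cl (load t) by exact: slice_Cq load_smooth.
have CMacc : field_Cq 0 cl (fun y => M y *m acc t y).
  by apply: field_Cq_mul; [exact: mass_smooth|exact: slice_Cq Cacc].
have Cg : field_Cq 0 cl g.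
  apply: field_Cq_add; first exact: field_Cq_add.
  by apply: field_Cq_scale => //; exact: smooth_near_cst.
suff gi0 : g x i 0 = 0.
  apply/eqP; rewrite -subr_eq0; apply/eqP; rewrite -[RHS]gi0 /g.
  move: (M x *m acc t x) (Fadj b _ x) (load t x) => u1 u2 u3.
  by rewrite !mxE; ring.
apply: (fundamental_rV oD bD (Cg i 0)) (Dx) => phi A Cphi cA AD phi0.
pose w (y : 'rV[R]_l) : 'cV[R]_n := phi y *: delta_mx i 0.
have Cw k u v' : Cq k setT (fun y => w y u v').
  apply: (@Cq_ext _ _ _ _ (fun y => phi y * (delta_mx i 0 : 'cV[R]_n) u v')).
  - exact: openT.
  - by move=> y _; rewrite /w [RHS]mxE.
  - by apply: Cq_mul; [exact: openT|exact: Cphi|exact: Cq_cst].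
have w0 y : ~ A y -> w y = 0 by move=> /phi0; rewrite /w => ->; rewrite scale0r.
have Cwcl k : field_Cq k cl w by move=> u v'; exists setT; split => //; exact: openT.
have dotw (u : 'cV[R]_n) y : dot u (w y) = u i 0 * phi y.
  rewrite /w dotZr mulrC; congr (_ * _); rewrite dotE (bigD1 i)//= mxE !eqxx mulr1.
  by rewrite big1 ?addr0// => j /negbTE ji; rewrite mxE ji mulr0.
have int u : field_Cq 0 cl u -> (leb l).-integrable D (EFin \o (fun y => dot (u y) (w y))).
  by move=> Cu; apply: smooth_near_integrable => //; exact: smooth_near_dot.
transitivity (\int[leb l]_(y in D) (dot (Fadj b (stress_resultant t) y) (w y) +
    (dot (M y *m acc t y) (w y) - dot (load t y) (w y)))).
  apply: eq_Rintegral => y _; rewrite !dotw /g.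
  move: (M y *m acc t y) (Fadj b _ y) (load t y) => u1 u2 u3.
  by rewrite !mxE; ring.
rewrite RintegralD//; [|exact: int|]; last first.
  by have := integrableB mD (int _ CMacc) (int _ Cload).
rewrite RintegralB//; [|exact: int|exact: int].
rewrite -[RHS](weak_form Cw cA AD w0 hamilton t) addrA; congr (_ + _ - _).
transitivity (\int[leb l]_(y in D) dot (F w y) (stress_resultant t y)); last first.
  by apply: eq_Rintegral => y _; rewrite dotC.
rewrite (by_parts_compact oD bD (dom_divergence dom) (P0 b) (Pk b) (Cwcl N)
  (slice_Cq t stress_resultant_smooth) cA AD (or_introl w0)).
by apply: eq_Rintegral => y _; rewrite dotC.
Qed.

Let F_derive x : cl x -> forall (s : R) i,
  is_derive s (1 : R) (fun s => F (r s) x i 0) (F (v s) x i 0).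
Proof.
move=> clx s i.
have <- : dtime (fun s => F (r s)) s x = F (v s) x.
  apply: (@dtime_diffop R l m n N (P0 b) (Pk b) cl r s x _ clx); apply: field_Cq_le r_smooth.
  by have [_ Nq _ _] := q_ge.
rewrite mxE derive1E; apply: derivableP.
by apply: (@time_derivable _ _ 0 _ cl (fun s => F (r s))) => //; exact: field_Cq_le CF.
Qed.

Let KF_derive x : cl x -> forall (s : R) i,
  is_derive s (1 : R) (fun s => (K x *m F (r s) x) i 0) ((K x *m F (v s) x) i 0).
Proof.
move=> clx s i.
have <- : dtime (fun s => F (r s)) s x = F (v s) x.
  apply: (@dtime_diffop R l m n N (P0 b) (Pk b) cl r s x _ clx); apply: field_Cq_le r_smooth.
  by have [_ Nq _ _] := q_ge.
by apply: (dtime_mulmx _ _ _ clx); exact: field_Cq_le CF.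
Qed.

(** By symmetry of [M] and [K], each quadratic form contributes twice one of its
    two terms. *)
Lemma energy_derive (t : R) :
  is_derive t (1 : R) (fun s => 2^-1 * \int[leb l]_(x in D)
      (dot (M x *m v s x) (v s x) + dot (F (r s) x) (K x *m F (r s) x)))
    (\int[leb l]_(x in D) dot (v t x) (M x *m acc t x) +
     \int[leb l]_(x in D) dot (F (v t) x) (stress_resultant t x)).
Proof.
have Cv0 : field_Cq 0 ST (uncurried v) by exact: field_Cq_le Cv.
have CF0 : field_Cq 0 ST (uncurried (fun s => F (r s))) by exact: field_Cq_le CF.
have CK0 : field_Cq 0 ST (uncurried (fun _ : R => K)) by exact: field_Cq_le CK.
have CFv : field_Cq 0 ST (uncurried (fun s => F (v s))).
  by apply: diffop_time_Cq Cv; rewrite add0n; have [] := q_ge.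
pose h s x := dot (v s x) (M x *m acc s x) + dot (F (v s) x) (K x *m F (r s) x).
have Ch : smooth_near 0 ST (uncurried h).
  apply: smooth_near_add; apply: smooth_near_dot => //; exact: field_Cq_mul.
pose h2 s x := 2 * h s x.
have Ch2 : smooth_near 0 ST (uncurried h2).
  by apply: smooth_near_mul => //; exact: smooth_near_cst.
pose E s x := dot (M x *m v s x) (v s x) + dot (F (r s) x) (K x *m F (r s) x).
have CE : smooth_near 0 ST (uncurried E).
  apply: smooth_near_add; apply: smooth_near_dot => //; exact: field_Cq_mul.
have dE (s : R) x : D x -> is_derive s (1 : R) (E ^~ x) (h2 s x).
  move=> Dx; have clx := subset_closure Dx.
  have d1 := is_derive_dot (Mv_derive clx s) (v_derive clx s).
  have d2 := is_derive_dot (F_derive clx s) (KF_derive clx s).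
  apply: is_derive_eq (is_deriveD d1 d2) _; rewrite /h2 /h.
  have -> : dot (M x *m v s x) (acc s x) = dot (v s x) (M x *m acc s x).
    by rewrite dot_mulmx symM.
  have -> : dot (F (r s) x) (K x *m F (v s) x) = dot (F (v s) x) (K x *m F (r s) x).
    by rewrite dotC dot_mulmx symK.
  by rewrite [dot (M x *m acc s x) _]dotC; ring.
have := is_deriveZ (2^-1 : R) (is_derive_Rintegral_time oD bD t CE Ch2 dE).
move/is_derive_eq; apply.
rewrite /h2 RintegralZl//; last first.
  by apply: smooth_near_integrable => //; exact: slice_smooth Ch.
rewrite /GRing.scale /= mulKf// /h RintegralD//.
- apply: smooth_near_integrable => //; apply: smooth_near_dot.
    exact: slice_Cq Cv0.
  by apply: field_Cq_mul; [exact: mass_smooth|exact: slice_Cq Cacc].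
- apply: smooth_near_integrable => //; apply: smooth_near_dot.
    exact: slice_Cq CFv.
  exact: field_Cq_le (leq0n N) (slice_Cq t stress_resultant_smooth).
Qed.

End dynamics.

(** * The port-Hamiltonian form *)

(** Two integrations by parts with compactly supported factors, one for each
    off-diagonal block. *)
Lemma interconnection_skew {R : realType} {l n m d N : nat}
    (b : elastic_body R l n m d N) : regular_domain b ->
  formal_adjoint (Om b) (Jop b) (fun z x => - Jop b z x).
Proof.
move=> dom v w [Cv [A [cA AD v0]]] [Cw [B [cB BD w0]]].
have [oD bD] := (dom_open dom, dom_bounded dom).
have mD : measurable (Om b) by exact: open_measurable_rV.
set cl := closure (Om b).
have entry a (z : 'rV[R]_l -> 'cV[R]_a) k i j : field_Coo setT z ->
    smooth_near k cl (fun x => z x i j).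
  by move=> Cz; exact: smooth_near_sub (@subsetT _ cl) (field_Coo_Cq k Cz i j).
have up a e (z : 'rV[R]_l -> 'cV[R]_(a + e)) k : field_Coo setT z ->
    field_Cq k cl (fun x => usubmx (z x)).
  move=> Cz i j; apply: eq_smooth_near (entry _ z k (lshift e i) j Cz) => x.
  by rewrite mxE.
have dn a e (z : 'rV[R]_l -> 'cV[R]_(a + e)) k : field_Coo setT z ->
    field_Cq k cl (fun x => dsubmx (z x)).
  move=> Cz i j; apply: eq_smooth_near (entry _ z k (rshift a i) j Cz) => x.
  by rewrite mxE.
pose vu x := usubmx (v x); pose vd x := dsubmx (v x).
pose wu x := usubmx (w x); pose wd x := dsubmx (w x).
have vu0 x : ~ A x -> vu x = 0 by move=> /v0; rewrite /vu => ->; rewrite linear0.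
have wu0 x : ~ B x -> wu x = 0 by move=> /w0; rewrite /wu => ->; rewrite linear0.
have parts := by_parts_compact oD bD (dom_divergence dom) (P0 b) (Pk b).
have Ew := parts N wu vd (up _ _ w N Cw) (dn _ _ v N Cv) B cB BD (or_introl wu0).
have Ev := parts N vu wd (up _ _ v N Cv) (dn _ _ w N Cw) A cA AD (or_introl vu0).
have CF z : field_Coo setT z -> field_Cq 0 cl (Fop b (fun x => usubmx (z x))).
  by move=> Cz; exact: diffop_Cq (up _ _ z N Cz).
have CFs z : field_Coo setT z -> field_Cq 0 cl (Fadj b (fun x => dsubmx (z x))).
  by move=> Cz; exact: diffop_adj_Cq (dn _ _ z N Cz).
have int a (f g : 'rV[R]_l -> 'cV[R]_a) : field_Cq 0 cl f -> field_Cq 0 cl g ->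
    (leb l).-integrable (Om b) (EFin \o (fun x => dot (f x) (g x))).
  by move=> Cf Cg; apply: smooth_near_integrable => //; exact: smooth_near_dot.
transitivity (\int[leb l]_(x in Om b)
    (dot (Fop b wu x) (vd x) - dot (vu x) (Fadj b wd x))).
  apply: eq_Rintegral => x _; rewrite -[v x]vsubmxK dot_col_mx dotNr addrC.
  by rewrite [dot (dsubmx _) _]dotC.
transitivity (\int[leb l]_(x in Om b)
    (dot (wu x) (Fadj b vd x) - dot (Fop b vu x) (wd x))); last first.
  apply: eq_Rintegral => x _; rewrite -[w x]vsubmxK /Jop /interconnection opp_col_mx.
  by rewrite opprK dot_col_mx dotNl dotC.
rewrite RintegralB//; last 2 first.
- by apply: int; [exact: CF|exact: dn].
- by apply: int; [exact: up|exact: CFs].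
rewrite RintegralB//; last 2 first.
- by apply: int; [exact: up|exact: CFs].
- by apply: int; [exact: CF|exact: dn].
by congr (_ - _); [exact: Ew|exact/esym/Ev].
Qed.

Theorem theorem1 (R : realType) (l n m d N c q : nat)
  (b : elastic_body R l n m d N)
  (r : R -> 'rV[R]_l -> 'cV[R]_n)
  (ud : R -> 'rV[R]_l -> 'cV[R]_c)
  (Bd : ('rV[R]_l -> 'cV[R]_c) -> 'rV[R]_l -> 'cV[R]_n)
  (Bds : ('rV[R]_l -> 'cV[R]_n) -> 'rV[R]_l -> 'cV[R]_c)
  (tau : R -> 'rV[R]_l -> 'cV[R]_(\sum_(a < N) blockdim l n a))
  (* dimensions and domains *)
  (l_range : (1 <= l <= 3)%N)
  (dom : regular_domain b)
  (bdry_cover : bdry_u b `|` bdry_s b = boundary (Om b))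
  (bdry_disj : bdry_u b `&` bdry_s b = set0)
  (bdry_s_meas : measurable (bdry_s b))
  (Omc_meas : measurable (Omc b))
  (Omc_full : l = 3%N -> Omc b = setT)
  (* kinematics and constitutive law *)
  (lam1_col : no_zero_col (Omc b) (lam1 b))
  (lam2_col : no_zero_col (Omc b) (lam2 b))
  (lam2_row : no_zero_row (Omc b) (lam2 b))
  (lam1_L2 : forall i j,
    square_integrable (leb (3 - l)) (Omc b) (fun y => lam1 b y i j))
  (lam2_L2 : forall i j,
    square_integrable (leb (3 - l)) (Omc b) (fun y => lam2 b y i j))
  (lam1_diff : forall i j y, (Omc b)° y -> differentiable (fun z => lam1 b z i j) y)
  (C_posdef : forall X, body_set b X -> posdef (Cmat b X))
  (C_meas : forall i j, measurable_fun (body_set b) (fun X => Cmat b X i j))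
  (C_bounded : bounded_field (body_set b) (Cmat b))
  (rho_smooth : smooth_near 0 (closure (Om b)) (rho b))
  (K_smooth : field_Cq N (closure (Om b)) (stiffness_matrix b))
  (M_posdef : forall x, closure (Om b) x -> posdef (mass_matrix b x))
  (K_posdef : forall x, closure (Om b) x -> posdef (stiffness_matrix b x))
  (* the differential operator, of order N *)
  (N_pos : (0 < N)%N)
  (N_order : exists k, Pk b k N != 0)
  (F_col : op_no_zero_col N (P0 b) (Pk b))
  (F_row : op_no_zero_row N (P0 b) (Pk b))
  (* the motion *)
  (q_large : (2 * N <= q)%N)
  (r_smooth : field_Cq q.+1 (spacetime (Om b)) (uncurried r))
  (r_strain : strain_is_voigt b r)
  (* external data *)
  (ud_smooth : field_Cq q (spacetime (Om b)) (uncurried ud))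
  (ud_bdry : forall t s, boundary (Om b) s -> ud t s = 0)
  (Bd_linear : linear_input q (Om b) Bd)
  (Bd_adjoint : input_adjoint q (Om b) Bd Bds)
  (load_smooth :
    field_Cq 0 (spacetime (Om b)) (uncurried (fun t => Bd (ud t))))
  (tau_cont : {within setT `*` bdry_s b, continuous (uncurried tau)})
  (tau_bounded : forall t1 t2 : R,
    bounded_field (`[t1, t2] `*` bdry_s b) (uncurried tau))
  (hamilton : hamilton_principle b (fun t => Bd (ud t)) tau r) :
  let M := mass_matrix b in
  let K := stiffness_matrix b in
  let H := hamiltonian b in
  let p := fun t x => M x *m dtime r t x in
  let eps := fun t => Fop b (r t) in
  let f_p := dtime p in
  let f_eps := dtime eps in
  let e_p := fun t x => invmx (M x) *m p t x in
  let e_eps := fun t x => K x *m eps t x in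
  let y_d := fun t => Bds (e_p t) in
  (* the Hamiltonian is the total energy *)
  (forall t, H (p t) (eps t) = kinetic b r t + elastic b r t) /\
  (* flows and efforts *)
  (forall t x, closure (Om b) x ->
    [/\ f_p t x = M x *m dtime (dtime r) t x,
        f_eps t x = Fop b (dtime r t) x,
        e_p t x = dtime r t x &
        e_eps t x = K x *m Fop b (r t) x]) /\
  (forall t,
    variational_derivative (Om b) (fun w => H w (eps t)) (p t) (e_p t) /\
    variational_derivative (Om b) (fun w => H (p t) w) (eps t) (e_eps t)) /\
  (* port-Hamiltonian dynamics *)
  (forall t x, Om b x ->
    col_mx (f_p t x) (f_eps t x) =
    Jop b (fun y => col_mx (e_p t y) (e_eps t y)) x +
    col_mx (Bd (ud t) x) 0) /\
  (* formal skew-adjointness of the interconnection operator *)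
  formal_adjoint (Om b) (Jop b) (fun z x => - Jop b z x) /\
  (* power balance, matrix form *)
  (forall t : R,
    is_derive t (1 : R) (fun s => H (p s) (eps s))
      (\int[leb l]_(x in Om b) dot (y_d t x) (ud t x) +
       \int[surf b]_(s in boundary (Om b))
         dot (jet N (e_p t) s)
             (Qbdry N (Pk b) (normal b s) *m jet N (e_eps t) s))) /\
  (* power balance, expanded form *)
  (forall t : R,
    is_derive t (1 : R) (fun s => H (p s) (eps s))
      (\int[leb l]_(x in Om b) dot (y_d t x) (ud t x) +
       \sum_(k < l) \sum_(1 <= i < N.+1) \sum_(1 <= j < i.+1)
         (-1) ^+ (j - 1) *
         \int[surf b]_(s in boundary (Om b))
           dot (dpartn (i - j) k (e_p t) s)
               ((normal b s 0 k *: (Pk b k i)^T) *m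
                dpartn (j - 1) k (e_eps t) s))).
Proof.
have [oD bD] := (dom_open dom, dom_bounded dom).
have mD : measurable (Om b) by exact: open_measurable_rV.
set D := Om b; set cl := closure (Om b).
have ND : (N + N <= q)%N by rewrite addnn -mul2n.
have Nq : (N <= q)%N by apply: leq_trans ND; exact: leq_addr.
have q1 : (1 <= q)%N by exact: leq_trans N_pos Nq.
have Cv : field_Cq q ([set: R] `*` cl) (uncurried (dtime r)) by exact: dtime_Cq.
move=> M K H p eps f_p f_eps e_p e_eps y_d.
have [U [oU clU MU]] := mass_unit_near rho_smooth M_posdef.
(* An identity on an open set, so that it may be differentiated on the boundary. *)
have e_pE t x : U x -> e_p t x = dtime r t x.
  by move=> Ux; rewrite /e_p /p mulmxA mulVmx ?mul1mx//; exact: MU.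
have Ce_p t : field_Cq q cl (e_p t).
  apply: (field_Cq_ext oU clU _ (slice_Cq t Cv)) => x Ux; exact/esym/e_pE.
have Ceps t : field_Cq N.+1 cl (eps t).
  by apply: diffop_Cq (slice_Cq t r_smooth); rewrite addSn ltnS.
have Ce_eps t : field_Cq N cl (e_eps t).
  by apply: field_Cq_mul => //; exact: field_Cq_le (leqnSn N) (Ceps t).
have f_pE t x : cl x -> f_p t x = M x *m dtime (dtime r) t x.
  move=> clx; apply/colP => i; rewrite /f_p mxE derive1E.
  have Cv1 := field_Cq_le q1 Cv.
  by have [_] := dtime_mulmx (M x) t Cv1 clx i.
have f_epsE t x : cl x -> f_eps t x = Fop b (dtime r t) x.
  move=> clx; apply: (@dtime_diffop R l m n N (P0 b) (Pk b) cl r t x _ clx).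
  exact: field_Cq_le r_smooth.
have Dcl x : D x -> cl x by exact: subset_closure.
have CM : field_Cq 0 cl M by exact: mass_smooth.
have CK0 : field_Cq 0 cl K by exact: field_Cq_le K_smooth.
have Cv0 t : field_Cq 0 cl (dtime r t) by exact: field_Cq_le (slice_Cq t Cv).
have Cp t : field_Cq 0 cl (p t) by exact: field_Cq_mul.
have Ceps0 t : field_Cq 0 cl (eps t) by exact: field_Cq_le (Ceps t).
have Cstored t : smooth_near 0 cl (fun x => dot (eps t x) (K x *m eps t x)).
  by apply: smooth_near_dot => //; exact: field_Cq_mul.
have Ckin t : smooth_near 0 cl (fun x => dot (p t x) (invmx (M x) *m p t x)).
  apply: smooth_near_dot => //; apply: field_Cq_mul => //.
  exact: inv_mass_smooth rho_smooth M_posdef.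
have int h : smooth_near 0 cl h -> (leb l).-integrable D (EFin \o h).
  exact: smooth_near_integrable.
have motion t x : D x -> M x *m dtime (dtime r) t x = - Fadj b (e_eps t) x + Bd (ud t) x.
  move=> Dx.
  exact: (equation_of_motion dom Omc_meas bdry_cover lam1_L2 lam2_L2 C_meas C_bounded
    rho_smooth K_smooth M_posdef K_posdef N_pos q_large r_smooth load_smooth hamilton t Dx).
have HE t : H (p t) (eps t) = 2^-1 * \int[leb l]_(x in D)
    (dot (M x *m dtime r t x) (dtime r t x) + dot (eps t x) (K x *m eps t x)).
  congr (_ * _); apply: eq_Rintegral => x /set_mem Dx.
  exact: (congr1 (fun u => dot (p t x) u + dot (eps t x) (K x *m eps t x))
    (e_pE t x (clU _ (Dcl _ Dx)))).
split.
  move=> t; rewrite HE kineticE//; last exact: field_Cq_le r_smooth.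
  rewrite elasticE//; last exact: (Ceps0 t).
  apply: etrans _ (mulrDr _ _ _); congr (_ * _); rewrite -RintegralD//.
  - by apply: eq_Rintegral => x _; congr (_ + _); exact: dotC.
  - by apply: int; apply: smooth_near_dot => //; exact: field_Cq_mul.
  - apply: int; apply: smooth_near_dot; last exact: (Ceps0 t).
    by apply: field_Cq_mul => //; exact: (Ceps0 t).
split.
  by move=> t x clx; rewrite f_pE// f_epsE// e_pE//; exact: clU.
split.
  move=> t; split; split => //.
  - exact: field_Cq_le (Ce_p t).
  - move=> dw Cdw; apply: is_derive_energy_add => //; last exact: field_Coo_Cq.
    - exact: inv_mass_smooth rho_smooth M_posdef.
    - by move=> x /Dcl/M_posdef[symM _]; rewrite trmx_inv symM.
  - exact: field_Cq_le (Ce_eps t).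
  - move=> dw Cdw.
    have := is_derive_energy_add oD bD CK0 _ (Ceps0 t) (field_Coo_Cq 0 Cdw) (Ckin t).
    have symK x : D x -> (K x)^T = K x by move=> /Dcl/K_posdef[].
    move=> /(_ symK); congr is_derive; apply/funext => eta; congr (_ * _).
    by apply: eq_Rintegral => x _; exact: addrC.
have FE t x : D x -> Fop b (e_p t) x = Fop b (dtime r t) x.
  move=> Dx; apply: (@diffop_ext R l m n N (P0 b) (Pk b) U _ _ x oU (e_pE t)).
  exact/clU/Dcl.
split.
  move=> t x Dx; rewrite /Jop /interconnection.
  have -> : (fun y => dsubmx (col_mx (e_p t y) (e_eps t y))) = e_eps t.
    by apply/funext => y; rewrite col_mxKd.
  have -> : (fun y => usubmx (col_mx (e_p t y) (e_eps t y))) = e_p t.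
    by apply/funext => y; rewrite col_mxKu.
  rewrite add_col_mx addr0 FE// f_epsE ?f_pE//; try exact: Dcl.
  congr col_mx; exact: motion.
split.
  exact: interconnection_skew.
have power t : is_derive t (1 : R) (fun s => H (p s) (eps s))
    (\int[leb l]_(x in D) dot (y_d t x) (ud t x) +
     (\int[leb l]_(x in D) dot (Fop b (e_p t) x) (e_eps t x) -
      \int[leb l]_(x in D) dot (e_p t x) (Fadj b (e_eps t) x))).
  rewrite (_ : (fun s => H (p s) (eps s)) = (fun s => 2^-1 * \int[leb l]_(x in D)
    (dot (M x *m dtime r s x) (dtime r s x) + dot (eps s x) (K x *m eps s x)))); last first.
    by apply/funext => s; exact: HE.
  have dE := energy_derive dom rho_smooth K_smooth M_posdef K_posdef N_pos q_large
    r_smooth t.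
  have Cload : field_Cq 0 cl (Bd (ud t)) by exact: slice_Cq load_smooth.
  have CFad : field_Cq 0 cl (Fadj b (e_eps t)) by exact: diffop_adj_Cq (Ce_eps t).
  have Ce0 : field_Cq 0 cl (e_p t) by exact: field_Cq_le (Ce_p t).
  have inertia : \int[leb l]_(x in D) dot (dtime r t x) (M x *m dtime (dtime r) t x) =
      \int[leb l]_(x in D) dot (y_d t x) (ud t x) -
      \int[leb l]_(x in D) dot (e_p t x) (Fadj b (e_eps t) x).
    transitivity (\int[leb l]_(x in D)
        (dot (e_p t x) (Bd (ud t) x) - dot (e_p t x) (Fadj b (e_eps t) x))).
      apply: eq_Rintegral => x /set_mem Dx.
      by rewrite motion// dotDr dotNr addrC e_pE//; exact/clU/Dcl.
    rewrite RintegralB//; last 2 first.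
    - by apply: int; exact: smooth_near_dot.
    - by apply: int; exact: smooth_near_dot.
    congr (_ - _).
    apply: etrans (Bd_adjoint.2 _ _ (Ce_p t) (slice_Cq t ud_smooth) (ud_bdry t)) _.
    by apply: eq_Rintegral => x _; exact: dotC.
  have internal : \int[leb l]_(x in D) dot (Fop b (dtime r t) x) (e_eps t x) =
      \int[leb l]_(x in D) dot (Fop b (e_p t) x) (e_eps t x).
    by apply: eq_Rintegral => x /set_mem Dx; rewrite FE.
  apply: is_derive_eq dE _; apply: etrans (f_equal2 +%R inertia internal) _.
  by rewrite -addrA; congr (_ + _); exact: addrC.
have diffEq (x y z : R) : x = y + z -> x - y = z by move=> ->; rewrite addrC addKr.
split=> t.
  apply: is_derive_eq (power t) _; congr (_ + _); apply: diffEq.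
  rewrite (by_parts_form oD bD (dom_divergence dom) (P0 b) (Pk b)
    (field_Cq_le Nq (Ce_p t)) (Ce_eps t)).
  by congr (_ + _); apply: eq_Rintegral => s _; rewrite boundary_matrixE.
apply: is_derive_eq (power t) _; congr (_ + _); apply: diffEq.
exact: (by_parts_expanded oD bD (dom_divergence dom) (P0 b) (Pk b)
  (field_Cq_le Nq (Ce_p t)) (Ce_eps t)).
Qed.
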